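(* Let $n\ge2$ and $\varphi_1,\dots,\varphi_n\in\mathcal{S}_r\cap\mathcal{C}$, and suppose there is an odd positive integer $t$ such that every jump discontinuity of each of $\varphi_1,\dots,\varphi_n$ has the form $\frac st$ for some integer $s$. Set $h_i(m)=J_{\varphi_i}(\frac{2m}{t})$ for $m\ge1$, $i=1,\dots,n$. If $h_1=h_2=\cdots=h_n$ and this common function is not identically $0$, then $c_1\varphi_1+\cdots+c_n\varphi_n\in\mathcal{C}$ for all $c_1,\dots,c_n>0$.
   Context: $L^2=L^2(0,1)$; each $\varphi\in L^2$ is identified with its odd $2$-periodic extension to $\mathbb{R}$. $\mathcal{C}$ is the set of $\varphi\in L^2$ such that the span of $\{\varphi(kx):k\in\mathbb{N}\}$ is dense in $L^2$. $\mathcal{S}_r$ is the class of step functions on $(0,1)$ (finitely many jumps) all of whose jump discontinuities in $(0,1)$ are rational. $J_\varphi(x)=\varphi(x^+)-\varphi(x^-)$, computed for the odd $2$-periodic extension. *)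

(* Defs.v *)
From HB Require Import structures.
From mathcomp Require Import all_boot all_order all_algebra.
From mathcomp Require Import all_classical all_reals all_analysis.
Set Implicit Arguments. Unset Strict Implicit. Unset Printing Implicit Defensive.
Import Order.TTheory GRing.Theory Num.Theory.
Import numFieldNormedType.Exports.
Local Open Scope classical_set_scope.
Local Open Scope ring_scope.

Section Defs.
Variable R : realType.

Definition I01 : set R := `]0%R, 1%R[.

(* A function phi : R -> R represents an element of L^2(0,1) through its
   values on (0,1); values outside (0,1) are ignored. *)

Definition oddext (phi : R -> R) (x : R) : R :=
  let y := x - 2 * (Num.floor (x / 2))%:~R in
  if (0 < y) && (y < 1) then phi y
  else if (1 < y) && (y < 2) then - phi (2 - y)
  else 0.

Definition inL2 (f : R -> R) : Prop :=
  measurable_fun I01 f /\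
  (\int[lebesgue_measure]_(x in I01) ((f x) ^+ 2)%:E < +oo)%E.

Definition complete_dil (phi : R -> R) : Prop :=
  inL2 phi /\
  forall g : R -> R, inL2 g -> forall eps : R, 0 < eps ->
    exists (N : nat) (a : nat -> R),
      (\int[lebesgue_measure]_(x in I01)
         ((g x - \sum_(k < N) a k * oddext phi (k.+1%:R * x)) ^+ 2)%:E
       < eps%:E)%E.

Definition jump (phi : R -> R) (x : R) : R :=
  lim (oddext phi y @[y --> x^'+]) - lim (oddext phi y @[y --> x^'-]).

Definition is_step (phi : R -> R) : Prop :=
  exists s : seq R, forall x y : R, 0 < x -> y < 1 -> x <= y ->
    (forall z, z \in s -> ~ (x <= z /\ z <= y)) -> phi x = phi y.

Definition Sr (phi : R -> R) : Prop :=
  is_step phi /\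
  forall x : R, 0 < x < 1 -> jump phi x != 0 -> exists q : rat, x = ratr q.

End Defs.

(* Main.v *)
(* In terms of sine coefficients, dilation completeness of a step function with
   jumps in (1/t)Z says that the dilates of b(n) = f(n)/n span l^2 densely,
   where f is 2t-periodic; equivalently the Dirichlet series of b is cyclic.
   - Evaluation at a square summable completely multiplicative psi is bounded,
     so a cyclic b does not vanish at psi. Spreading psi over a long block of
     primes in one residue class makes this value a zero-free polynomial in one
     variable, and Borel-Caratheodory forces f(g m) = +-f(m) for that class.
     Classes with enough primes generate all units, so f(g m) = chi(g) f(m) for
     every unit g. Here chi is the same for all f_i, being determined by
     2 H(n) = f_i(n) + f_i(n + t), which encodes the jumps at the points 2m/t.
   - Hence, after removing the primes not dividing 2t and multiplying by finitely
     many Euler factors, b_i becomes a Dirichlet polynomial Q_i without zeros in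
     the open polydisc, of the form a_i +- psi(2) (h - a_i) with h independent
     of i and a_i, h not involving psi(2). Zero-freeness in psi(2) reads
     |h - a_i| <= |a_i|, that is |h|^2 <= 2 Re(a_i conj h), a condition stable
     under positive combinations; it also shows that h never vanishes. So the
     corresponding Q of sum c_i b_i is zero-free.
   - A zero-free Dirichlet polynomial Q is cyclic: Q times the dilated and
     truncated Dirichlet inverse is bounded on the torus, converges to 1
     coefficientwise, and one concludes by averaging. *)
Require Import Defs.
From HB Require Import structures.
From mathcomp Require Import all_boot all_order all_algebra.
From mathcomp Require Import cyclic.
From mathcomp Require Import all_classical all_reals all_analysis measurable_realfun.
From mathcomp Require Import complex.
From mathcomp Require Import ring lra zify.
Set Implicit Arguments. Unset Strict Implicit. Unset Printing Implicit Defensive.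
Import Order.TTheory GRing.Theory Num.Theory.
Import numFieldNormedType.Exports.
Local Open Scope ring_scope.

(** * Primes outside a subgroup of residue classes *)

(** Fix a class [g] whose primes have divergent reciprocal sum [S]. The coefficients of the
    evaluation on a block tend to those of [sum c_k y^k / k!], where [c_k] is the Dirichlet series
    of [n -> f (g ^ k * n)]. The polynomials have no zero for [|y| <= S / 2], while the logarithm of
    their size grows only linearly in [S]; in the limit this leaves [c_0 exp (a y)], so [c_k] is
    geometric in [k]. Its ratio is real and a root of unity, hence a sign. The multipliers form a
    set of classes closed under products, and if it missed a unit, some missed class would have
    divergent reciprocal sum; this consequence of the harmonic series is all that is asked of the
    primes. The passage between L2 and sequences is finite: on a rational grid, cosine sums replace
    integrals, and norms are compared up to constants. A general element of L2 is first approximated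
    by dilates of one of the given complete functions, which brings it back to step functions. *)

Lemma sum_blocks (V : nmodType) (X p : nat) (F : nat -> V) :
  \sum_(0 <= k < X * p) F k = \sum_(0 <= l < X) \sum_(0 <= j < p) F (l * p + j)%N.
Proof.
elim: X => [|X IH]; first by rewrite mul0n !big_geq.
rewrite big_nat_recr //= -IH mulSn addnC (big_cat_nat (n := (X * p)%N)) ?leq_addr //=.
congr (_ + _); rewrite -{1}[X in \sum_(X <= _ < _) _]add0n big_addn addKn.
by apply: eq_bigr => j _; rewrite addnC.
Qed.

Lemma harmonic_unbounded (R : realType) (M : R) :
  exists n : nat, M <= \sum_(0 <= i < n) i.+1%:R^-1.
Proof.
apply: contrapT => /forallNP nM; apply: (@dvg_harmonic R).
apply: nondecreasing_is_cvgn.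
  by apply: nondecreasing_series => n _ _; rewrite invr_ge0 ler0n.
exists M => _ [n _ <-]; rewrite /series /= ltW //.
by have /negP := nM n; rewrite -ltNge.
Qed.

(** Among [p] consecutive indices at most one gives a multiple of [p], since [q] is invertible
    modulo [p]. In block [l] this multiple is at least [p * (1 + q * l)], because [r + q * j0] is
    itself a positive multiple of [p]. Block 0 accounts for the summand 1. *)
Lemma sum_inv_ap_dvdn (R : realType) (p q r X : nat) :
  (0 < p)%N -> (0 < q)%N -> (0 < r)%N -> coprime p q ->
  \sum_(0 <= k < X | (p %| r + q * k)%N) (r + q * k)%:R^-1 <=
    p%:R^-1 * (1 + q%:R^-1 * \sum_(0 <= k < X) k.+1%:R^-1) :> R.
Proof.
move=> p0 q0 r0 cpq; pose F k : R := if (p %| r + q * k)%N then (r + q * k)%:R^-1 else 0.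
have F0 k : 0 <= F k by rewrite /F; case: ifP => // _; rewrite invr_ge0 ler0n.
rewrite big_mkcond /= -/F.
have le1 : \sum_(0 <= k < X) F k <= \sum_(0 <= k < X * p) F k.
  rewrite [leRHS](big_cat_nat (n := X)) //= ?leq_pmulr // lerDl.
  by apply: sumr_ge0 => k _; exact: F0.
apply: (le_trans le1); rewrite sum_blocks.
have blk l : \sum_(0 <= j < p) F (l * p + j)%N <= p%:R^-1 * (1 + q * l)%:R^-1.
  have [[j0 /andP[j0p dj0]]|nj] := pselect (exists j0, (j0 < p)%N && (p %| r + q * (l * p + j0))%N); last first.
    rewrite big_nat_cond big1 ?mulr_ge0 ?invr_ge0 ?ler0n // => j /andP[/andP[_ jp] _].
    rewrite /F; case: ifP => // dj; case: nj; exists j; by rewrite jp.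
  have dj1 : (p %| r + q * j0)%N.
    by move: dj0; rewrite mulnDr addnCA dvdn_addr // mulnA dvdn_mull.
  have uniq j : (j < p)%N -> (p %| r + q * (l * p + j))%N -> j = j0.
    move=> jp; rewrite mulnDr addnCA dvdn_addr ?mulnA ?dvdn_mull // => dj.
    wlog: j j0 jp j0p dj dj1 {dj0} / (j <= j0)%N.
      move=> W; case/orP: (leq_total j j0) => h; first exact: W.
      by apply/esym; apply: W.
    move=> jj0; have : (p %| q * (j0 - j))%N.
      rewrite mulnBr -(subnDl r) dvdn_sub //.
    rewrite Gauss_dvdr // => h; case: (posnP (j0 - j)) => [|h0]; first by lia.
    by have := dvdn_leq h0 h; lia.
  rewrite (bigD1_seq j0) ?mem_index_iota ?iota_uniq //=.
  rewrite big1_seq ?addr0; last first.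
    move=> j /andP[/negP nj]; rewrite mem_index_iota => /andP[_ jp]; rewrite /F.
    by case: ifP => // /(uniq _ jp) E; case: nj; apply/eqP.
  rewrite /F dj0 -invfM lef_pV2 ?posrE -?natrM ?ltr0n ?ler_nat //; last 2 first.
  - by rewrite addn_gt0 r0.
  - by rewrite muln_gt0 p0.
  have : (p <= r + q * j0)%N by apply: dvdn_leq => //; rewrite addn_gt0 r0.
  nia.
apply: (@le_trans _ _ (\sum_(0 <= l < X) p%:R^-1 * (1 + q * l)%:R^-1)).
  by apply: ler_sum => l _; exact: blk.
rewrite -mulr_sumr ler_wpM2l ?invr_ge0 ?ler0n //.
case: X {le1} => [|X].
  by rewrite !big_geq // mulr0 addr0 ler01.
rewrite (big_nat_recl X 0 (fun l => (1 + q * l)%:R^-1)) // muln0 addn0 invr1 lerD2l mulr_sumr.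
rewrite [leRHS]big_nat_recr //= -[leLHS]addr0 lerD ?mulr_ge0 ?invr_ge0 ?ler0n //.
apply: ler_sum => l _; rewrite -invfM lef_pV2 ?posrE -?natrM ?ltr0n ?ler_nat ?muln_gt0 ?q0 //.
Qed.

(** For [L >= 1] it says that divisors [ps] covering the first [X] terms of a progression have
    reciprocal sum at least 1/2: the harmonic sum of the progression is distributed over them. *)
Lemma sum_inv_primes_ap (R : realType) (q r X : nat) (ps : seq nat) (L : R) :
  (0 < r <= q)%N -> (forall p, p \in ps -> (0 < p)%N && coprime p q) ->
  (forall k, (k < X)%N -> exists2 p, p \in ps & (p %| r + q * k)%N) ->
  L = q%:R^-1 * \sum_(0 <= k < X) k.+1%:R^-1 ->
  L <= \sum_(p <- ps) p%:R^-1 * (1 + L).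
Proof.
move=> /andP[r0 rq] psP ex LE; have q0 : (0 < q)%N := leq_trans r0 rq.
apply: (@le_trans _ _ (\sum_(0 <= k < X) (r + q * k)%:R^-1)).
  rewrite LE mulr_sumr; apply: ler_sum => k _.
  rewrite -invfM lef_pV2 ?posrE -?natrM ?ltr0n ?ler_nat ?muln_gt0 ?q0 ?addn_gt0 ?r0 //.
  by rewrite mulnS leq_add2r.
apply: (@le_trans _ _ (\sum_(0 <= k < X) \sum_(p <- ps | (p %| r + q * k)%N) (r + q * k)%:R^-1)).
  rewrite big_nat_cond [leRHS]big_nat_cond; apply: ler_sum => k /andP[/andP[_ kX] _].
  have [p pps dp] := ex k kX.
  rewrite -big_filter (big_rem p) ?mem_filter ?dp //= lerDl; apply: sumr_ge0 => i _.
  by rewrite invr_ge0 ler0n.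
have -> : \sum_(0 <= k < X) \sum_(p <- ps | (p %| r + q * k)%N) (r + q * k)%:R^-1 =
  \sum_(p <- ps) \sum_(0 <= k < X | (p %| r + q * k)%N) (r + q * k)%:R^-1 :> R.
  under eq_bigr do rewrite big_mkcond.
  rewrite exchange_big /=; apply: eq_bigr => p _; by rewrite [RHS]big_mkcond.
rewrite big_seq [leRHS]big_seq; apply: ler_sum => p /psP /andP[p0 cp].
by rewrite LE sum_inv_ap_dvdn.
Qed.

Section PrimesOutsideSubgroup.
Variables (R : realType) (q : nat) (H : pred nat).
Hypothesis q0 : (0 < q)%N.
Hypothesis H1 : H 1%N.
Hypothesis HM : forall m n, H m -> H n -> H (m * n)%N.
Hypothesis Hmod : forall m n, m = n %[mod q] -> H m = H n.

Lemma mem_of_primes n : (0 < n)%N -> (forall p, prime p -> (p %| n)%N -> H p) -> H n.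
Proof.
elim/ltn_ind: n => n IH n0 Hp.
have [n1|n1] := leqP n 1; first by have -> : n = 1%N by lia.
have pp := pdiv_prime n1; have dp := pdiv_dvd n.
rewrite -(divnK dp); apply: HM; last exact: Hp.
apply: IH; first by rewrite ltn_Pdiv ?prime_gt1.
  by rewrite divn_gt0 ?pdiv_gt0 // dvdn_leq.
by move=> p' p'p dp'; apply: Hp => //; apply: dvdn_trans dp' _; by apply/dvdnP; exists (pdiv n); rewrite mulnC divnK.
Qed.

Lemma primes_outside (g N : nat) : coprime g q -> ~~ H g ->
  exists ps : seq nat, [/\ uniq ps,
    forall p, p \in ps -> [/\ prime p, (N < p)%N, coprime p q & ~~ H p] &
    3^-1 <= \sum_(p <- ps) p%:R^-1 :> R].
Proof.
move=> cg nHg; apply: contrapT => /forallNP nex.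
pose P := (\prod_(0 <= p < N.+1 | prime p && coprime p q) p)%N.
have cqP : coprime q P.
  rewrite /P; elim/big_ind: _ => [|x y hx hy|p /andP[_ h]]; first exact: coprimen1.
    by rewrite coprimeMr hx hy.
  by rewrite coprime_sym.
have P0 : (0 < P)%N by rewrite /P prodn_cond_gt0 // => p /andP[/prime_gt0].
pose Q := (q * P)%N; have Q0 : (0 < Q)%N by rewrite muln_gt0 q0 P0.
pose r0 := (chinese q P g 1 %% Q)%N.
(* The representative lies in [1..Q]: the comparison with the harmonic sum needs a positive first
   term. *)
pose r := if r0 == 0%N then Q else r0.
have rbd : (0 < r <= Q)%N.
  rewrite /r; case: eqP => [_|/eqP h]; first by rewrite Q0 leqnn.
  by rewrite lt0n h /= ltnW // ltn_pmod.
have rQ : r = chinese q P g 1 %[mod Q].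
  by rewrite /r; case: eqP => [h|_]; [rewrite modnn -/r0 h | rewrite /r0 modn_mod].
have rg : r = g %[mod q].
  rewrite -(chinese_modl cqP g 1) -(modn_dvdm r (dvdn_mulr P (dvdnn q))) rQ.
  by rewrite modn_dvdm ?dvdn_mulr.
have r1 : r = 1 %[mod P].
  rewrite -[RHS](chinese_modr cqP g 1) -(modn_dvdm r (dvdn_mull q (dvdnn P))) rQ.
  by rewrite modn_dvdm ?dvdn_mull.
have [X LX] := @harmonic_unbounded R Q%:R.
pose ps := [seq p <- iota N.+1 (r + Q * X) | [&& prime p, coprime p q & ~~ H p]].
have psP p : p \in ps -> [/\ prime p, (N < p)%N, coprime p q & ~~ H p].
  by rewrite mem_filter mem_iota => /andP[/and3P[-> -> ->] /andP[-> _]].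
apply: (nex ps); split => //; first by rewrite filter_uniq ?iota_uniq.
have cpP p : p \in ps -> coprime p P.
  move=> /psP[pp Np _ _]; rewrite /P; rewrite big_nat_cond; elim/big_ind: _ => [|x y hx hy|p']; first exact: coprimen1.
    by rewrite coprimeMr hx hy.
  move=> /andP[/andP[_ p'N] /andP[pp' _]].
  by rewrite prime_coprime // dvdn_prime2 //; apply/negP => /eqP E; move: p'N; rewrite -E ltnS leqNgt Np.
have key := @sum_inv_primes_ap R Q r X ps _ rbd _ _ erefl; move: key.
have h1 p : p \in ps -> (0 < p)%N && coprime p Q.
  by move=> hp; have [pp _ cp _] := psP p hp; rewrite prime_gt0 //= coprimeMr cp cpP.
have h2 k : (k < X)%N -> exists2 p, p \in ps & (p %| r + Q * k)%N.
  move=> kX; have rkg : (r + Q * k = g %[mod q])%N.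
    by rewrite addnC /Q -mulnA mulnC modnMDl.
  have nH : ~~ H (r + Q * k)%N by rewrite (Hmod rkg).
  have n0 : (0 < r + Q * k)%N by case/andP: rbd => ? _; rewrite addn_gt0; apply/orP; left.
  have [p [pp dp nHp]] : exists p, [/\ prime p, (p %| r + Q * k)%N & ~~ H p].
    apply: contrapT => /forallNP nx; move/negP: nH; apply; apply: mem_of_primes => // p pp dp.
    by apply/negPn/negP => h; apply: (nx p).
  have cn : coprime (r + Q * k) q.
    by rewrite -coprime_modl rkg coprime_modl.
  have cp : coprime p q by exact: coprime_dvdl dp cn.
  exists p => //; rewrite mem_filter pp cp nHp /= mem_iota.
  have dpl := dvdn_leq n0 dp.
  apply/andP; split; last first.
    apply: (leq_ltn_trans dpl); rewrite addSn ltnS.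
    by rewrite (leq_trans _ (leq_addl N _)) // leq_add2l leq_mul2l (ltnW kX) orbT.
  rewrite ltnNge; apply/negP => pN.
  have dpP : (p %| P)%N.
    rewrite /P -big_filter (big_rem p) ?mem_filter ?mem_index_iota ?pp ?cp ?ltnS //=.
    exact: dvdn_mulr.
  have : (p %| r)%N by rewrite -(dvdn_addl _ (n:=(Q * k)%N)) // dvdn_mulr // dvdn_mull.
  rewrite /dvdn -(modn_dvdm _ dpP) r1 modn_dvdm // => /eqP h.
  have := prime_gt1 pp; have : (p %| 1)%N by rewrite /dvdn h.
  by rewrite dvdn1 => /eqP ->.
move=> /(_ h1 h2); rewrite -mulr_suml; set L := _ * _; set Sg := \sum_(p <- ps) _ => key.
have L1 : 1 <= L.
  by rewrite /L ler_pdivlMl ?ltr0n // mulr1.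
by rewrite leNgt; apply/negP => S3; move: key; apply/negP; rewrite -ltNge; nra.
Qed.

(** Pigeonhole over the [q] classes: if every class outside [H] had reciprocal sums below [tau]
    beyond some bound, the primes outside [H] beyond the largest bound would sum to less than 1/3.
    The class found has a block of weight [tau] beyond every bound; disjoint blocks are concatenated
    until they reach [S]. *)
Lemma class_outside (g : nat) : coprime g q -> ~~ H g ->
  exists c, [/\ coprime c q, ~~ H c & forall N (S : R), exists ps : seq nat,
    [/\ uniq ps, forall p, p \in ps -> [/\ prime p, (N < p)%N & p = c %[mod q]] &
     S <= \sum_(p <- ps) p%:R^-1]].
Proof.
move=> cg nHg; pose tau : R := (3 * q%:R)^-1.
have tau0 : 0 < tau by rewrite invr_gt0 mulr_gt0 // ltr0n.
have [c [cc nHc cb]] : exists c, [/\ coprime c q, ~~ H c & forall N, exists ps : seq nat,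
    [/\ uniq ps, forall p, p \in ps -> [/\ prime p, (N < p)%N & p = c %[mod q]] &
     tau <= \sum_(p <- ps) p%:R^-1]].
  apply: contrapT => /forallNP nex.
  have /choice[NN hN] : forall c, exists N, coprime c q -> ~~ H c -> forall ps : seq nat, uniq ps ->
     (forall p, p \in ps -> [/\ prime p, (N < p)%N & p = c %[mod q]]) ->
     \sum_(p <- ps) p%:R^-1 < tau.
    move=> c; have [[cc nHc]|h] := pselect (coprime c q /\ ~~ H c); last first.
      by exists 0%N => cc nHc; case: h.
    apply: contrapT => /forallNP nN; apply: (nex c); split => // N.
    apply: contrapT => /forallNP nps; apply: (nN N) => _ _ ps ups hps.
    by rewrite ltNge; apply/negP => h; apply: (nps ps).
  pose N := (\max_(c < q) NN c)%N.
  have [ps [ups psP]] := primes_outside N cg nHg; apply/negP; rewrite -ltNge.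
  have -> : \sum_(p <- ps) p%:R^-1 = \sum_(c < q) \sum_(p <- [seq p <- ps | (p %% q)%N == c]) p%:R^-1 :> R.
    under [RHS]eq_bigr do rewrite big_filter big_mkcond.
    rewrite exchange_big /=; apply: eq_bigr => p _.
    rewrite (bigD1 (Ordinal (ltn_pmod p q0))) //= eqxx big1 ?addr0 // => c.
    by rewrite -val_eqE /= eq_sym => /negbTE ->.
  apply: (@lt_le_trans _ _ (\sum_(c < q) tau)); last first.
    by rewrite sumr_const card_ord -[leLHS]mulr_natr /tau invfM mulfVK // pnatr_eq0 -lt0n.
  apply: ltr_sum; first by apply/hasP; exists (Ordinal q0); rewrite ?mem_index_enum.
  move=> c _; have [[cc nHc]|h] := pselect (coprime c q /\ ~~ H c).
    apply: (hN c) => //; first by rewrite filter_uniq.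
    move=> p; rewrite mem_filter => /andP[/eqP pc /psP[pp Np _ _]].
    split => //; last by rewrite -pc modn_mod.
    exact: leq_ltn_trans (leq_bigmax c) Np.
  rewrite big_filter big_seq_cond big1 // => p /andP[/psP[pp Np cp nHp] /eqP pc]; case: h.
  split; first by rewrite -pc coprime_modl.
  by rewrite (@Hmod c p) // -pc modn_mod.
exists c; split => // N S.
have [m hm] : exists m : nat, S <= m%:R * tau.
  exists (Num.truncn (S / tau)).+1.
  by rewrite -ler_pdivrMr // ltW // truncnS_gt.
suff [ps [ups psP sps]] : exists ps : seq nat,
    [/\ uniq ps, forall p, p \in ps -> [/\ prime p, (N < p)%N & p = c %[mod q]] &
     m%:R * tau <= \sum_(p <- ps) p%:R^-1].
  by exists ps; split => //; apply: le_trans sps.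
elim: m {hm} => [|m [ps [ups psP sps]]].
  by exists [::]; split => //; rewrite big_nil mul0r.
have [ps' [ups' psP' sps']] := cb (maxn N (\max_(p <- ps) p)%N).
exists (ps ++ ps'); split.
- rewrite cat_uniq ups ups' andbT /=; apply/hasPn => p /psP'[_ hp _].
  apply/negP => pps; have : (p <= \max_(p <- ps) p)%N by exact: leq_bigmax_seq.
  by move: hp; rewrite gtn_max => /andP[_]; rewrite ltnNge => /negP.
- move=> p; rewrite mem_cat => /orP[/psP//|/psP'[pp hp pc]]; split => //.
  by move: hp; rewrite gtn_max => /andP[].
- by rewrite big_cat /= -natr1 mulrDl mul1r lerD.
Qed.
End PrimesOutsideSubgroup.

(** * Completely multiplicative functions *)

Section CompletelyMultiplicative.

(* The completely additive, and below the completely multiplicative, function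
   with prescribed values at the primes. *)
Definition tadd (w : nat -> nat) (n : nat) : nat :=
  (\sum_(0 <= p < n.+1) logn p n * w p)%N.

Definition cmul (T : comNzRingType) (z : nat -> T) (n : nat) : T :=
  \prod_(0 <= p < n.+1) z p ^+ logn p n.

Definition cmultiplicative (T : comNzRingType) (psi : nat -> T) : Prop :=
  psi 1%N = 1 /\ forall m n, (0 < m)%N -> (0 < n)%N -> psi (m * n)%N = psi m * psi n.

Lemma logn_gt p n : (n < p)%N -> logn p n = 0%N.
Proof.
move=> np; case: n np => [|n] np; first by rewrite logn0.
rewrite lognE; case: and3P => // -[_ _ /dvdn_leq h].
by have := h isT; rewrite leqNgt np.
Qed.

Lemma tadd_widen w n M : (n < M)%N -> tadd w n = (\sum_(0 <= p < M) logn p n * w p)%N.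
Proof.
move=> nM; rewrite [RHS](big_cat_nat (n := n.+1)) //=.
rewrite [X in (_ + X)%N]big_nat_cond [X in (_ + X)%N]big1 ?addn0 // => p /andP[/andP[np _] _].
by rewrite logn_gt.
Qed.

Lemma cmul_widen (T : comNzRingType) (z : nat -> T) n M :
  (n < M)%N -> cmul z n = \prod_(0 <= p < M) z p ^+ logn p n.
Proof.
move=> nM; rewrite [RHS](big_cat_nat (n := n.+1)) //=.
rewrite [X in _ * X]big_nat_cond [X in _ * X]big1 ?mulr1 // => p /andP[/andP[np _] _].
by rewrite logn_gt.
Qed.

Lemma tadd1 w : tadd w 1 = 0%N.
Proof. by rewrite /tadd big1 // => p _; rewrite logn1. Qed.

Lemma taddM w m n : (0 < m)%N -> (0 < n)%N -> tadd w (m * n) = (tadd w m + tadd w n)%N.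
Proof.
move=> m0 n0; pose M := (m * n).+1.
rewrite (@tadd_widen w m M) ?(@tadd_widen w n M) ?ltnS ?leq_pmulr ?leq_pmull //.
by rewrite /tadd -big_split /=; apply: eq_bigr => p _; rewrite lognM // mulnDl.
Qed.

Lemma tadd_prime w p : prime p -> tadd w p = w p.
Proof.
move=> pp; rewrite /tadd (bigD1_seq p) ?mem_index_iota ?iota_uniq ?ltnS //=.
rewrite logn_prime // eqxx mul1n big1 ?addn0 // => i ip.
by rewrite logn_prime // (negbTE ip).
Qed.

Lemma tadd_const1_gt0 w n : (forall p, prime p -> (0 < w p)%N) -> (1 < n)%N -> (0 < tadd w n)%N.
Proof.
move=> w0 n1; have pp := pdiv_prime n1; have n0 : (0 < n)%N by exact: ltnW.
rewrite /tadd (bigD1_seq (pdiv n)) ?mem_index_iota ?iota_uniq ?ltnS //=; last first.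
  by apply: dvdn_leq (pdiv_dvd n).
by rewrite addn_gt0 muln_gt0 w0 // andbT logn_gt0 mem_primes pp n0 pdiv_dvd.
Qed.

Lemma cmulP (T : comNzRingType) (z : nat -> T) : cmultiplicative (cmul z).
Proof.
split=> [|m n m0 n0]; first by rewrite /cmul big1 // => p _; rewrite logn1.
pose M := (m * n).+1.
rewrite (@cmul_widen _ z m M) ?(@cmul_widen _ z n M) ?ltnS ?leq_pmulr ?leq_pmull //.
by rewrite /cmul -big_split /=; apply: eq_bigr => p _; rewrite lognM // exprD.
Qed.

Lemma cmul_prime (T : comNzRingType) (z : nat -> T) p : prime p -> cmul z p = z p.
Proof.
move=> pp; rewrite /cmul (bigD1_seq p) ?mem_index_iota ?iota_uniq ?ltnS //=.
rewrite logn_prime // eqxx expr1 big1 ?mulr1 // => i ip.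
by rewrite logn_prime // (negbTE ip).
Qed.

Lemma cmult_expr (T : comNzRingType) (y : T) w : cmultiplicative (fun n => y ^+ tadd w n).
Proof. by split=> [|m n m0 n0]; rewrite ?tadd1 ?taddM ?exprD. Qed.

Lemma cmultM (T : comNzRingType) (f g : nat -> T) :
  cmultiplicative f -> cmultiplicative g -> cmultiplicative (fun n => f n * g n).
Proof.
move=> [f1 fM] [g1 gM]; split=> [|m n m0 n0]; first by rewrite f1 g1 mulr1.
by rewrite fM // gM // mulrACA.
Qed.

Lemma cmult_comp (T U : comNzRingType) (h : T -> U) (f : nat -> T) :
  h 1 = 1 -> {morph h : x y / x * y} -> cmultiplicative f -> cmultiplicative (h \o f).
Proof. by move=> h1 hM [f1 fM]; split=> [|m n m0 n0] /=; rewrite ?f1 ?fM ?hM. Qed.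

Lemma cmult_eq (T : comNzRingType) (f g : nat -> T) n :
  cmultiplicative f -> cmultiplicative g -> (forall p, prime p -> (p %| n)%N -> f p = g p) ->
  (0 < n)%N -> f n = g n.
Proof.
move=> [f1 fM] [g1 gM]; elim/ltn_ind: n => n IH fg n0.
have [n1|n1] := leqP n 1; first by rewrite (_ : n = 1%N) ?f1 ?g1 //; lia.
have pp := pdiv_prime n1; have dp := pdiv_dvd n.
have q0 : (0 < n %/ pdiv n)%N by rewrite divn_gt0 ?pdiv_gt0 // dvdn_leq.
rewrite -(divnK dp) fM ?gM ?pdiv_gt0 // (fg (pdiv n)) //; congr (_ * _).
apply: IH => //; first by rewrite ltn_Pdiv ?prime_gt1.
move=> p p'p dp'; apply: fg => //; apply: dvdn_trans dp' _.
by apply/dvdnP; exists (pdiv n); rewrite mulnC divnK.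
Qed.

Lemma cmultX (T : comNzRingType) (f : nat -> T) (k : nat) n :
  cmultiplicative f -> (0 < n)%N -> f (n ^ k)%N = f n ^+ k.
Proof.
move=> [f1 fM] n0; elim: k => [|k IH]; first by rewrite expn0 f1 expr0.
by rewrite expnS fM ?expn_gt0 ?n0 // IH exprS.
Qed.

End CompletelyMultiplicative.

Lemma sum_multiples (V : nmodType) (k N : nat) (G : nat -> V) : (0 < k)%N ->
  \sum_(1 <= n < N | (k %| n)%N) G n = \sum_(1 <= m < N | (k * m < N)%N) G (k * m)%N.
Proof.
move=> k0; rewrite -[LHS]big_filter -[RHS]big_filter -[RHS](big_map (muln k) xpredT G).
apply: perm_big; apply: uniq_perm.
- by rewrite filter_uniq ?iota_uniq.
- rewrite map_inj_uniq ?filter_uniq ?iota_uniq // => x y /eqP.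
  by rewrite eqn_pmul2l // => /eqP.
move=> n; rewrite mem_filter mem_index_iota; apply/idP/mapP.
  move=> /andP[/dvdnP[m ->] /andP[n1 nN]]; exists m; rewrite 1?mulnC //.
  rewrite mem_filter mem_index_iota mulnC nN /=.
  have m0 : (0 < m)%N by move: n1; rewrite muln_gt0 => /andP[].
  rewrite m0 /=; apply: leq_ltn_trans nN; exact: leq_pmulr.
move=> [m]; rewrite mem_filter mem_index_iota => /andP[kmN /andP[m1 mN]] ->.
by rewrite dvdn_mulr //= kmN muln_gt0 k0 m1.
Qed.

(** * Elementary inequalities for finite sums *)

Section FiniteSums.
Variable R : realType.
Implicit Types (x y : R).

Lemma le_of_sqr x y : 0 <= y -> x ^+ 2 <= y ^+ 2 -> x <= y.
Proof. by move=> y0 xy; rewrite leNgt; apply/negP => yx; nra. Qed.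

Lemma cauchy_schwarz (I : Type) (r : seq I) (P : pred I) (u v : I -> R) :
  (\sum_(i <- r | P i) u i * v i) ^+ 2 <=
  (\sum_(i <- r | P i) u i ^+ 2) * (\sum_(i <- r | P i) v i ^+ 2).
Proof.
rewrite -!(big_filter _ P); elim: [seq i <- r | P i] => [|i s IH].
  by rewrite !big_nil expr0n mulr0.
rewrite !big_cons; move: IH.
have U0 : 0 <= \sum_(j <- s) u j ^+ 2 by apply: sumr_ge0 => j _; exact: sqr_ge0.
have V0 : 0 <= \sum_(j <- s) v j ^+ 2 by apply: sumr_ge0 => j _; exact: sqr_ge0.
move: (\sum_(j <- s) u j ^+ 2) (\sum_(j <- s) v j ^+ 2) (\sum_(j <- s) u j * v j) U0 V0.
move=> U V A U0 V0 IH; move: (u i) (v i) => a b.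
have key : 2 * A * (a * b) <= U * b ^+ 2 + V * a ^+ 2.
  apply: le_of_sqr; first by rewrite addr_ge0 // mulr_ge0 // sqr_ge0.
  have h : (2 * A * (a * b)) ^+ 2 <= 4 * (U * V) * (a * b) ^+ 2.
    by rewrite !exprMn -!exprMn; have := sqr_ge0 (a * b); nra.
  apply: (le_trans h); rewrite -subr_ge0.
  suff -> : (U * b ^+ 2 + V * a ^+ 2) ^+ 2 - 4 * (U * V) * (a * b) ^+ 2 =
    (U * b ^+ 2 - V * a ^+ 2) ^+ 2 by exact: sqr_ge0.
  by ring.
rewrite -subr_ge0; rewrite -subr_ge0 in key; rewrite -subr_ge0 in IH.
have -> : (a ^+ 2 + U) * (b ^+ 2 + V) - (a * b + A) ^+ 2 =
  (U * b ^+ 2 + V * a ^+ 2 - 2 * A * (a * b)) + (U * V - A ^+ 2) by ring.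
exact: addr_ge0.
Qed.

Lemma sqr_weighted_sum (I : Type) (r : seq I) (c d : I -> R) :
  (\sum_(i <- r) c i * d i) ^+ 2 <= (\sum_(i <- r) `|c i|) * (\sum_(i <- r) `|c i| * d i ^+ 2).
Proof.
have := @cauchy_schwarz _ r xpredT (fun i => Num.sqrt `|c i|) (fun i => Num.sg (c i) * Num.sqrt `|c i| * d i).
congr (_ <= _).
  congr (_ ^+ 2); apply: eq_bigr => i _.
  set s := Num.sqrt _; have hs : s * s = `|c i| by rewrite -expr2 sqr_sqrtr.
  by rewrite [in RHS](numEsg (c i)) -hs; ring.
congr (_ * _); apply: eq_bigr => i _; first by rewrite sqr_sqrtr.
rewrite !exprMn sqr_sqrtr // sqr_sg; case: eqVneq => [->|_]; last by rewrite mul1r.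
by rewrite normr0 !mul0r.
Qed.

Lemma inv_sqr_step (x : R) : 1 <= x -> (x ^+ 2)^-1 <= 2 / x - 2 / (x + 1).
Proof.
move=> x1; rewrite -subr_ge0.
have -> : 2 / x - 2 / (x + 1) - (x ^+ 2)^-1 = (x - 1) / (x ^+ 2 * (x + 1)).
  by field; rewrite !gt_eqF //; lra.
by rewrite divr_ge0 ?subr_ge0 // mulr_ge0 ?sqr_ge0 //; lra.
Qed.

Lemma sum_inv_sqr_tail (X N : nat) : (0 < X)%N ->
  \sum_(X <= n < N) (n%:R ^+ 2)^-1 <= 2 / X%:R :> R.
Proof.
move=> X0.
have [NX|XN] := leqP N X; first by rewrite big_geq // divr_ge0 // ler0n.
suff h : \sum_(X <= n < N) (n%:R ^+ 2)^-1 <= 2 / X%:R - 2 / N%:R :> R.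
  by apply: (le_trans h); rewrite gerBl divr_ge0 // ler0n.
elim: N XN => // N IH; rewrite ltnS leq_eqVlt => /orP[/eqP XN|XN].
  rewrite -XN big_nat1 -[X.+1%:R]natr1 => {N XN IH}.
  have : 1 <= X%:R :> R by rewrite ler1n.
  by move: (X%:R : R) => x x1; apply: inv_sqr_step.
rewrite big_nat_recr ?(ltnW XN) //=; apply: (le_trans (lerD (IH XN) (lexx _))).
have : 1 <= N%:R :> R by rewrite ler1n; apply: leq_ltn_trans XN.
rewrite -[N.+1%:R]natr1; move: (N%:R : R) => x /inv_sqr_step; lra.
Qed.

End FiniteSums.

(** * Cyclic sequences for the dilations *)

Section Modulus.
Variable R : realType.
Local Notation C := R[i].
Implicit Types (z w : C) (x : R).

(** The modulus as an element of [R], where it can be compared with real bounds and serve as an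
    argument of [ln]. *)
Definition nm z : R := Num.sqrt (complex.Re z ^+ 2 + complex.Im z ^+ 2).

Lemma normC_nm z : `|z| = (nm z)%:C%C. Proof. exact: normc_def. Qed.

Lemma nm_ge0 z : 0 <= nm z. Proof. exact: sqrtr_ge0. Qed.

Lemma nmM z w : nm (z * w) = nm z * nm w.
Proof. by apply: complexI; rewrite -!normC_nm normrM !normC_nm -rmorphM. Qed.

Lemma nmD z w : nm (z + w) <= nm z + nm w.
Proof. by rewrite -lecR rmorphD /= -!normC_nm ler_normD. Qed.

Lemma nmN z : nm (- z) = nm z.
Proof. by apply: complexI; rewrite -!normC_nm normrN. Qed.

Lemma nmB z w : nm (z - w) <= nm z + nm w.
Proof. by rewrite -(nmN w) nmD. Qed.

Lemma nmBC z w : nm (z - w) = nm (w - z).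
Proof. by rewrite -nmN opprB. Qed.

Lemma nm_subl z w : nm z - nm w <= nm (z - w).
Proof. by rewrite lerBlDr; apply: le_trans (nmD _ _); rewrite subrK. Qed.

Lemma nm_real x : nm x%:C%C = `|x|.
Proof. by rewrite /nm /= expr0n /= addr0 sqrtr_sqr. Qed.

Lemma nm0 : nm 0 = 0. Proof. by rewrite (_ : 0 = 0%:C%C) // nm_real normr0. Qed.
Lemma nm1 : nm 1 = 1. Proof. by rewrite (_ : 1 = 1%:C%C) // nm_real normr1. Qed.

Lemma nmX z n : nm (z ^+ n) = nm z ^+ n.
Proof. by elim: n => [|n IH]; rewrite ?expr0 ?nm1 // !exprS nmM IH. Qed.

Lemma nm_eq0 z : (nm z == 0) = (z == 0).
Proof.
by rewrite -[RHS]normr_eq0 normC_nm; apply/eqP/eqP => [->|[]].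
Qed.

Lemma nm_gt0 z : (0 < nm z) = (z != 0).
Proof. by rewrite lt_neqAle nm_ge0 andbT eq_sym nm_eq0. Qed.

Lemma nmV z : nm z^-1 = (nm z)^-1.
Proof.
have [->|z0] := eqVneq z 0; first by rewrite invr0 nm0 invr0.
have h : nm z != 0 by rewrite nm_eq0.
by apply: (mulfI h); rewrite -nmM !divff // nm1.
Qed.

Lemma nm_sum (I : Type) (r : seq I) (P : pred I) (F : I -> C) :
  nm (\sum_(i <- r | P i) F i) <= \sum_(i <- r | P i) nm (F i).
Proof.
elim/big_rec2: _ => [|i x z _ h]; first by rewrite nm0.
by apply: (le_trans (nmD _ _)); rewrite lerD2l.
Qed.

Lemma nm_prod (I : Type) (r : seq I) (P : pred I) (F : I -> C) :
  nm (\prod_(i <- r | P i) F i) = \prod_(i <- r | P i) nm (F i).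
Proof. by elim/big_rec2: _ => [|i x z _ <-]; rewrite ?nm1 ?nmM. Qed.

Lemma nm_sqr z : nm z ^+ 2 = complex.Re z ^+ 2 + complex.Im z ^+ 2.
Proof. by rewrite sqr_sqrtr // addr_ge0 // sqr_ge0. Qed.

Lemma ReD z w : complex.Re (z + w) = complex.Re z + complex.Re w.
Proof. by case: z w => [a b] [c d]. Qed.

Lemma Re_sum (I : Type) (r : seq I) (P : pred I) (F : I -> C) :
  complex.Re (\sum_(i <- r | P i) F i) = \sum_(i <- r | P i) complex.Re (F i).
Proof. by elim/big_rec2: _ => // i x z _ <-; rewrite ReD. Qed.

Lemma Re_le_nm z : `|complex.Re z| <= nm z.
Proof. by rewrite -sqrtr_sqr /nm ler_wsqrtr // lerDl sqr_ge0. Qed.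

Lemma ReZ x z : complex.Re (x%:C%C * z) = x * complex.Re z.
Proof. by case: z => a b /=; rewrite mul0r subr0. Qed.

Lemma nm_natr n : nm n%:R = n%:R :> R.
Proof. by rewrite -(rmorph_nat (real_complex R)) nm_real ger0_norm. Qed.

End Modulus.

(** * Dilates, Dirichlet convolution and bounded evaluations *)

Section DirichletModule.
Variable R : realType.
Implicit Types (b u v w : nat -> R) (L : seq (R * nat)).

(* Sequences are indexed from 1, the value at 0 being irrelevant. [comb L b] is
   the Dirichlet convolution of [b] with the finite sequence coded by [L], and
   [cl b u] says that [u] lies in the l^2-closure of the span of the dilates
   of [b]. *)
Definition dil (k : nat) b (n : nat) : R := if (k %| n)%N then b (n %/ k)%N else 0.
Definition comb L b (n : nat) : R := \sum_(x <- L) x.1 * dil x.2 b n.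
Definition wf L : bool := all (fun x => (0 < x.2)%N) L.
Definition n2 (N : nat) u : R := \sum_(1 <= n < N) u n ^+ 2.
Definition n1 L : R := \sum_(x <- L) `|x.1|.

Lemma n2_ge0 N u : 0 <= n2 N u.
Proof. by apply: sumr_ge0 => n _; exact: sqr_ge0. Qed.

Lemma n1_ge0 L : 0 <= n1 L. Proof. by apply: sumr_ge0. Qed.

Lemma eq_n2 N u v : (forall n, (0 < n)%N -> u n = v n) -> n2 N u = n2 N v.
Proof. by move=> uv; apply: eq_big_nat => n /andP[n0 _]; rewrite uv. Qed.

Lemma n2_dil k N b : (0 < k)%N -> n2 N (dil k b) <= n2 N b.
Proof.
move=> k0; rewrite /n2 (bigID (fun n => (k %| n)%N)) /= [X in _ + X]big1 ?addr0.
  rewrite sum_multiples // big_mkcond /=; apply: ler_sum => m _.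
  case: ifP => _; last exact: sqr_ge0.
  by rewrite /dil dvdn_mulr // mulKn.
by move=> n /negbTE h; rewrite /dil h expr0n.
Qed.

(** Young's inequality: dilations do not increase the l2 norm, so convolution is bounded by the l1
    norm of its finite factor. *)
Lemma n2_comb L N b : wf L -> n2 N (comb L b) <= n1 L ^+ 2 * n2 N b.
Proof.
move=> wL.
apply: (@le_trans _ _ (\sum_(1 <= n < N) n1 L * \sum_(x <- L) `|x.1| * dil x.2 b n ^+ 2)).
  by apply: ler_sum => n _; exact: sqr_weighted_sum.
rewrite -mulr_sumr exchange_big /= expr2 -mulrA ler_wpM2l ?n1_ge0 //.
rewrite /n1 mulr_suml big_seq [leRHS]big_seq; apply: ler_sum => x xL.
by rewrite -mulr_sumr ler_wpM2l // n2_dil // (allP wL).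
Qed.

Lemma n2D N u v : n2 N (fun n => u n + v n) <= 2 * n2 N u + 2 * n2 N v.
Proof.
rewrite /n2 !mulr_sumr -big_split /=; apply: ler_sum => n _.
by have := sqr_ge0 (u n - v n); nra.
Qed.

Lemma n2Z N c u : n2 N (fun n => c * u n) = c ^+ 2 * n2 N u.
Proof. by rewrite /n2 mulr_sumr; apply: eq_bigr => n _; rewrite exprMn. Qed.

Lemma dil_dil k j b n : (0 < j)%N -> dil k (dil j b) n = dil (k * j) b n.
Proof.
move=> j0; rewrite /dil; case: (boolP (k %| n)%N) => [/dvdnP[m ->]|kn].
  have [->|k0] := posnP k; first by rewrite muln0 mul0n dvd0n eqxx !divn0 div0n dvdn0.
  by rewrite mulnK // (mulnC m k) dvdn_pmul2l // divnMl.
by case: ifP => // h; move: kn; rewrite (dvdn_trans _ h) // dvdn_mulr.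
Qed.

Lemma combB L u v n : comb L (fun n => u n - v n) n = comb L u n - comb L v n.
Proof.
rewrite /comb -sumrB /=; apply: eq_bigr => x _; rewrite -mulrBr; congr (_ * _).
by rewrite /dil; case: ifP => // _; rewrite subr0.
Qed.

Lemma comb_cat L L' b n : comb (L ++ L') b n = comb L b n + comb L' b n.
Proof. by rewrite /comb big_cat. Qed.

Definition shift (c : R) (k : nat) L := [seq (c * x.1, (k * x.2)%N) | x <- L].

Lemma comb_shift c k L b n : wf L -> comb (shift c k L) b n = c * dil k (comb L b) n.
Proof.
move=> wL; rewrite /comb /shift big_map /=.
rewrite /dil; case: ifP => kn; last first.
  rewrite mulr0 big1 // => x _; case: ifP => h; last by rewrite mulr0.
  by move: kn; rewrite (dvdn_trans _ h) // dvdn_mulr.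
rewrite mulr_sumr big_seq [RHS]big_seq; apply: eq_bigr => x xL.
rewrite -mulrA; congr (_ * (_ * _)).
by have := @dil_dil k x.2 b n ((allP wL) _ xL); rewrite /dil kn => ->.
Qed.

Lemma wf_shift c k L : (0 < k)%N -> wf L -> wf (shift c k L).
Proof.
move=> k0 /allP wL; apply/allP => _ /mapP[x xL ->] /=.
by rewrite muln_gt0 k0 wL.
Qed.

Definition cl b u := forall eps : R, 0 < eps ->
  exists L, wf L /\ forall N, n2 N (fun n => comb L b n - u n) <= eps.

Lemma cl_eq b u v : (forall n, (0 < n)%N -> u n = v n) -> cl b u -> cl b v.
Proof.
move=> uv bu e e0; have [L [wL h]] := bu e e0; exists L; split=> // N.
by rewrite (le_trans _ (h N)) // le_eqVlt; apply/orP; left; apply/eqP/eq_n2 => n n0; rewrite uv.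
Qed.

Lemma cl_refl b : cl b b.
Proof.
move=> e e0; exists [:: (1, 1%N)]; split=> // N.
rewrite (@eq_n2 _ _ (fun=> 0)) => [|n _].
  by rewrite /n2 big1 ?ltW // => i _; rewrite expr0n.
by rewrite /comb big_seq1 /= /dil dvd1n divn1 mul1r subrr.
Qed.

Lemma cl_lim b u : (forall eps, 0 < eps -> exists2 v, cl b v &
  forall N, n2 N (fun n => v n - u n) <= eps) -> cl b u.
Proof.
move=> h e e0; have e40 : 0 < e / 4 by rewrite divr_gt0.
have [v bv vu] := h _ e40; have [L [wL bL]] := bv _ e40.
exists L; split=> // N.
rewrite (@eq_n2 _ _ (fun n => (comb L b n - v n) + (v n - u n))) => [|n _]; last by rewrite addrA subrK.
apply: (le_trans (n2D _ _ _)).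
by have := bL N; have := vu N; lra.
Qed.

Lemma cl_shift b u c k : (0 < k)%N -> cl b u -> cl b (fun n => c * dil k u n).
Proof.
move=> k0 bu e e0; have c0 : 0 < c ^+ 2 + 1 by rewrite ltr_wpDl ?sqr_ge0.
have [L [wL h]] := bu (e / (c ^+ 2 + 1)) (divr_gt0 e0 c0).
exists (shift c k L); split; first exact: wf_shift.
move=> N; rewrite (@eq_n2 _ _ (fun n => c * dil k (fun m => comb L b m - u m) n)) => [|n _]; last first.
  rewrite comb_shift // -mulrBr; congr (_ * _); rewrite /dil.
  by case: ifP; rewrite ?subr0.
rewrite n2Z; have := h N; have := n2_dil N (fun m => comb L b m - u m) k0.
rewrite ler_pdivlMr //; have := n2_ge0 N (fun m => comb L b m - u m); have := sqr_ge0 c.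
set A := n2 N (fun _ => _ - _); set B := n2 N (dil _ _) => c20 A0 BA h1.
apply: le_trans h1; rewrite mulrC; apply: ler_pM => //; last by rewrite lerDl.
exact: n2_ge0.
Qed.

Lemma cl_add b u v : cl b u -> cl b v -> cl b (fun n => u n + v n).
Proof.
move=> bu bv e e0; have e40 : 0 < e / 4 by rewrite divr_gt0.
have [L [wL hL]] := bu _ e40; have [M [wM hM]] := bv _ e40.
exists (L ++ M); split; first by rewrite /wf all_cat; apply/andP.
move=> N; rewrite (@eq_n2 _ _ (fun n => (comb L b n - u n) + (comb M b n - v n))) => [|n _].
  by apply: (le_trans (n2D _ _ _)); have := hL N; have := hM N; lra.
by rewrite comb_cat addrACA -opprD.
Qed.

Lemma cl_comb b u L : wf L -> cl b u -> cl b (comb L u).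
Proof.
move=> wL bu; elim: L wL => [|x L IH] => [_ e e0|/= /andP[x0 wL]].
  exists [::]; split=> // N; rewrite /n2 big1 ?ltW // => n _.
  by rewrite /comb !big_nil subrr expr0n.
apply: (@cl_eq _ (fun n => x.1 * dil x.2 u n + comb L u n)).
  by move=> n _; rewrite /comb big_cons.
by apply: cl_add; [exact: cl_shift | exact: IH].
Qed.

(** The closed span of the dilates is stable under dilation, so cyclicity can be proved through
    intermediate sequences. *)
Lemma cl_trans b u v : cl b u -> cl u v -> cl b v.
Proof.
move=> bu uv; apply: cl_lim => e e0; have [L [wL h]] := uv e e0.
by exists (comb L u) => //; exact: cl_comb.
Qed.

(** The unit of Dirichlet convolution. Its dilates are the standard basis vectors, so [cl b delta1]
    expresses that [b] is cyclic. *)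
Definition delta1 (n : nat) : R := (n == 1%N)%:R.

Lemma cl_finite b X : cl delta1 (fun n => if (n < X)%N then b n else 0).
Proof.
elim: X => [|X IH].
  apply: (@cl_eq _ (comb [::] delta1)) => [n _|]; first by rewrite /comb big_nil.
  exact/cl_comb/cl_refl.
have [->|X0] := posnP X.
  apply: (@cl_eq _ (comb [::] delta1)) => [n n0|]; first by rewrite /comb big_nil ltnS leqNgt n0.
  exact/cl_comb/cl_refl.
apply: (@cl_eq _ (fun n => (if (n < X)%N then b n else 0) + b X * dil X delta1 n)).
  move=> n n0; rewrite ltnS [(n <= X)%N]leq_eqVlt /dil /delta1.
  have [->|nX] := eqVneq n X; first by rewrite ltnn dvdnn divnn X0 mulr1 add0r.
  have -> : (if (X %| n)%N then ((n %/ X)%N == 1%N)%:R else 0) = 0 :> R.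
    case: ifP => // h; case: eqP => // h1.
    by move: nX; rewrite -(divnK h) h1 mul1n eqxx.
  by rewrite mulr0 addr0.
by apply: cl_add => //; apply: cl_shift => //; exact: cl_refl.
Qed.

Definition tail0 b := forall eps : R, 0 < eps ->
  exists X0, forall X N, (X0 <= X)%N -> \sum_(X <= n < N) b n ^+ 2 <= eps.

Lemma tail0_bounded (f : nat -> R) (c : R) : (forall n, `|f n| <= c) -> tail0 (fun n => f n / n%:R).
Proof.
move=> fc e e0; have c0 : 0 <= c by exact: le_trans (fc 0%N).
exists (Num.truncn (2 * c ^+ 2 / e)).+1 => X N hX.
have X0 : (0 < X)%N by exact: leq_trans hX.
apply: (@le_trans _ _ (c ^+ 2 * (2 / X%:R))).
  apply: le_trans (ler_wpM2l (sqr_ge0 c) (sum_inv_sqr_tail _ N X0)).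
  rewrite mulr_sumr; apply: ler_sum => n _.
  rewrite exprMn exprVn ler_wpM2r ?invr_ge0 ?sqr_ge0 //.
  by rewrite -[leLHS]ger0_norm ?sqr_ge0 // normrX lerXn2r ?nnegrE.
rewrite mulrA ler_pdivrMr ?ltr0n // -ler_pdivrMl //.
have : 2 * c ^+ 2 / e < X%:R.
  by apply: lt_le_trans (truncnS_gt _) _; rewrite ler_nat.
by move=> /ltW; rewrite mulrC (mulrC (c ^+ 2)) .
Qed.

Lemma cl_delta1 b u : cl b delta1 -> tail0 u -> cl b u.
Proof.
move=> bd tu; apply: cl_lim => e e0; have [X0 hX] := tu e e0.
exists (fun n => if (n < X0.+1)%N then u n else 0); first exact: cl_trans bd (cl_finite _ _).
move=> N; rewrite /n2; have [NX|XN] := leqP N X0.+1.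
  rewrite big_nat_cond big1 ?ltW // => n /andP[/andP[_ nN] _].
  by rewrite (leq_trans nN) // subrr expr0n.
rewrite (big_cat_nat (n := X0.+1)) ?(ltnW XN) //= [X in X + _]big_nat_cond big1 ?add0r.
  apply: le_trans (hX X0.+1 N (leqnSn _)).
  apply: ler_sum_nat => n /andP[nX _].
  by rewrite ltnNge nX /= sub0r sqrrN.
by move=> n /andP[/andP[_ nX] _]; rewrite nX subrr expr0n.
Qed.

Section Evaluation.
Local Notation C := R[i].

Definition ev (psi : nat -> C) (X : nat) b : C := \sum_(1 <= n < X) (b n)%:C%C * psi n.
Definition trunc (X : nat) b (n : nat) : R := if (n < X)%N then b n else 0.
Definition evl (psi : nat -> C) L : C := \sum_(x <- L) (x.1)%:C%C * psi x.2.
(* For such [psi], evaluation at [psi] is an l^2-bounded functional that turns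
   Dirichlet convolutions into products. *)
Definition adm (psi : nat -> C) (Psi : R) :=
  [/\ cmultiplicative psi, forall n, (0 < n)%N -> nm (psi n) <= 1 &
      forall N, \sum_(1 <= n < N) nm (psi n) ^+ 2 <= Psi].

Lemma evD psi X u v : ev psi X (fun n => u n + v n) = ev psi X u + ev psi X v.
Proof. by rewrite /ev -big_split /=; apply: eq_bigr => n _; rewrite rmorphD mulrDl. Qed.

Lemma evB psi X u v : ev psi X (fun n => u n - v n) = ev psi X u - ev psi X v.
Proof. by rewrite /ev -sumrB /=; apply: eq_bigr => n _; rewrite rmorphB mulrBl. Qed.

Lemma eq_ev psi X u v : (forall n, (0 < n < X)%N -> u n = v n) -> ev psi X u = ev psi X v.
Proof. by move=> uv; apply: eq_big_nat => n h; rewrite uv. Qed.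

Lemma ev_delta1 psi X : (1 < X)%N -> cmultiplicative psi -> ev psi X delta1 = 1.
Proof.
move=> X1 [p1 _]; rewrite /ev (big_cat_nat (n := 2)) //= big_nat1 /delta1 eqxx p1 mulr1.
rewrite big_nat_cond big1 ?addr0 // => n /andP[/andP[n2 _] _].
by case: eqP => [E|_]; [rewrite E in n2 | rewrite mul0r].
Qed.

Lemma ev_le psi X u Psi : adm psi Psi -> nm (ev psi X u) ^+ 2 <= n2 X u * Psi.
Proof.
move=> [_ _ hP].
apply: (@le_trans _ _ ((\sum_(1 <= n < X) `|u n| * nm (psi n)) ^+ 2)).
  rewrite lerXn2r ?nnegrE ?nm_ge0 //.
    by apply: sumr_ge0 => n _; rewrite mulr_ge0 ?nm_ge0.
  by apply: (le_trans (nm_sum _ _ _)); apply: ler_sum => n _; rewrite nmM nm_real.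
apply: (le_trans (cauchy_schwarz _ _ _ _)); apply: ler_pM => //.
- by apply: sumr_ge0 => n _; exact: sqr_ge0.
- by apply: sumr_ge0 => n _; exact: sqr_ge0.
by rewrite /n2; apply: ler_sum => n _; rewrite real_normK ?num_real.
Qed.

Lemma ev_comb_trunc psi L M X b : cmultiplicative psi -> wf L ->
  (forall x, x \in L -> (x.2 * X <= M)%N) ->
  ev psi M (comb L (trunc X b)) = evl psi L * ev psi X b.
Proof.
move=> [p1 pM] wL hM; rewrite /evl mulr_suml.
transitivity (\sum_(1 <= n < M) \sum_(x <- L) (x.1)%:C%C * ((dil x.2 (trunc X b) n)%:C%C * psi n)).
  apply: eq_bigr => n _; rewrite /comb rmorph_sum mulr_suml; apply: eq_bigr => x _.
  by rewrite rmorphM mulrA.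
rewrite exchange_big /= big_seq [RHS]big_seq; apply: eq_bigr => x xL.
have k0 : (0 < x.2)%N := allP wL _ xL; have kX := hM x xL.
rewrite -mulr_sumr -mulrA; congr (_ * _).
rewrite (bigID (fun n => (x.2 %| n)%N)) /= [X in _ + X]big1 ?addr0; last first.
  by move=> n /negbTE h; rewrite /dil h rmorph0 mul0r.
rewrite sum_multiples // /ev mulr_sumr.
have XM : (X <= M)%N by apply: leq_trans kX; exact: leq_pmull.
rewrite [LHS](_ : _ = \sum_(1 <= m < M) (if (m < X)%N then psi x.2 * ((b m)%:C%C * psi m) else 0)).
  case: (posnP X) => [->|X0]; first by rewrite big1 // [RHS]big_geq.
  rewrite (big_cat_nat (n := X)) //= [X in _ + X]big_nat_cond [X in _ + X]big1 ?addr0.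
    by apply: eq_big_nat => m /andP[_ ->].
  by move=> m /andP[/andP[h _] _]; rewrite ltnNge h.
rewrite big_mkcond; apply: eq_big_nat => m /andP[m0 _].
rewrite /dil dvdn_mulr // mulKn // /trunc; case: (ltnP m X) => mX.
  by rewrite (leq_trans _ kX) ?ltn_pmul2l // pM // mulrCA.
by rewrite rmorph0 mul0r if_same.
Qed.

(** [X0] depends on [psi] only through [Psi]: a whole disc of evaluations will be handled with one
    truncation. [M] has to exceed [X] times every dilation index of [L], hence the order of the
    quantifiers. *)
Lemma ev_comb_approx L b (eps Psi : R) : wf L -> tail0 b -> 0 < eps -> 0 < Psi ->
  exists X0, forall X, (X0 <= X)%N -> exists M0, forall M, (M0 <= M)%N ->
  forall psi, adm psi Psi -> nm (ev psi M (comb L b) - evl psi L * ev psi X b) <= eps.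
Proof.
move=> wL tb e0 P0; have c0 : 0 < n1 L ^+ 2 + 1 by rewrite ltr_wpDl ?sqr_ge0.
(* A tail [d] of this size satisfies [n1 L ^+ 2 * d * Psi <= eps ^+ 2]; the [+ 1] covers the case
   [n1 L = 0]. *)
have d0 : 0 < eps ^+ 2 / Psi / (n1 L ^+ 2 + 1) by rewrite !divr_gt0 // exprn_gt0.
have [X0 hX] := tb _ d0; exists X0.+1 => X XX; exists (\max_(x <- L) x.2 * X)%N => M hM psi apsi.
have hM' x : x \in L -> (x.2 * X <= M)%N.
  move=> xL; apply: leq_trans hM; exact: (@leq_bigmax_seq _ _ xpredT (fun x : R * nat => x.2 * X)%N).
have [cpsi _ _] := apsi; rewrite -(ev_comb_trunc b cpsi wL hM') -evB.
rewrite (@eq_ev _ _ _ (comb L (fun n => b n - trunc X b n))); last by move=> n _; rewrite combB.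
apply: le_of_sqr; first exact: ltW.
apply: (le_trans (ev_le _ _ apsi)).
apply: (@le_trans _ _ (n1 L ^+ 2 * (eps ^+ 2 / Psi / (n1 L ^+ 2 + 1)) * Psi)).
  rewrite ler_wpM2r ?(ltW P0) //; apply: (le_trans (n2_comb _ _ wL)).
  rewrite ler_wpM2l ?sqr_ge0 // /n2.
  have [MX|XM] := leqP M X.
    rewrite big_nat_cond big1 ?ltW // => n /andP[/andP[_ nN] _].
    by rewrite /trunc (leq_trans nN) // subrr expr0n.
  rewrite (big_cat_nat (n := X)) ?(ltnW XM) ?(leq_trans _ XX) //= [X in X + _]big_nat_cond big1 ?add0r.
    apply: le_trans (hX X M (ltnW XX)).
    by apply: ler_sum_nat => n /andP[nX _]; rewrite /trunc ltnNge nX /= subr0.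
  by move=> n /andP[/andP[_ nX] _]; rewrite /trunc nX subrr expr0n.
rewrite -subr_ge0.
have -> : eps ^+ 2 - n1 L ^+ 2 * (eps ^+ 2 / Psi / (n1 L ^+ 2 + 1)) * Psi = eps ^+ 2 / (n1 L ^+ 2 + 1).
  by field; rewrite !gt_eqF.
by rewrite divr_ge0 ?sqr_ge0 // ltW.
Qed.

Lemma evl_le psi L Psi : wf L -> adm psi Psi -> nm (evl psi L) <= n1 L.
Proof.
move=> /allP wL [_ p1 _]; apply: (le_trans (nm_sum _ _ _)); rewrite /n1 big_seq [leRHS]big_seq.
apply: ler_sum => x xL; rewrite nmM nm_real ler_piMr // p1 //; exact: (wL x xL).
Qed.

(** If [comb L b] is close to [delta1], its value, nearly [evl psi L * ev psi X b], is close to 1.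
    Two errors of 1/4 leave a product of modulus at least 1/2, and [evl psi L] is at most [n1 L]. *)
Lemma cyclic_nonvanishing b (Psi : R) : cl b delta1 -> tail0 b -> 0 < Psi ->
  exists2 d : R, 0 < d & exists X0, forall X, (X0 <= X)%N ->
  forall psi, adm psi Psi -> d <= nm (ev psi X b).
Proof.
move=> cb tb P0; have e0 : 0 < (16 * Psi)^-1 by rewrite invr_gt0 mulr_gt0.
have [L [wL hL]] := cb _ e0.
have q0 : 0 < 4^-1 :> R by rewrite invr_gt0.
have [X0 hX] := ev_comb_approx wL tb q0 P0.
have n10 := n1_ge0 L.
exists ((2 * (n1 L + 1))^-1); first by rewrite invr_gt0 mulr_gt0 // ltr_wpDl.
exists X0 => X XX psi apsi; have [M0 hM] := hX X XX.
have {hM} := hM (maxn M0 2) (leq_maxl _ _) psi apsi.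
set M := maxn M0 2; have M1 : (1 < M)%N by exact: leq_maxr.
have [cpsi _ _] := apsi.
have h1 : nm (ev psi M (comb L b) - 1) <= 4^-1.
  rewrite -(ev_delta1 M1 cpsi) -evB; apply: le_of_sqr; first by rewrite invr_ge0.
  apply: (le_trans (ev_le _ _ apsi)); apply: (@le_trans _ _ ((16 * Psi)^-1 * Psi)).
    by rewrite ler_wpM2r ?(ltW P0) // hL.
  by rewrite invfM mulfVK ?gt_eqF //; lra.
move=> h2; have h3 : 2^-1 <= nm (evl psi L * ev psi X b).
  have := nm_subl 1 (evl psi L * ev psi X b); rewrite nm1.
  move: h1 h2; set A := ev psi M _; set B := evl _ _ * _ => h1 h2.
  have := nmD (1 - A) (A - B).
  have -> : 1 - A + (A - B) = 1 - B by rewrite addrA subrK.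
  by rewrite (nmBC 1 A); move: h1 h2; lra.
rewrite nmM in h3; have h4 := evl_le wL apsi.
rewrite invfM ler_pdivrMr ?ltr_wpDl // (le_trans h3) // mulrC ler_wpM2l ?nm_ge0 //.
by rewrite (le_trans h4) // lerDl.
Qed.

End Evaluation.

End DirichletModule.

(** * Newton sums of zero-free polynomials *)

Section RootsOfUnity.
Variable R : realType.
Local Notation C := R[i].

Definition expi (x : R) : C := (cos x +i* sin x)%C.

Lemma expiD x y : expi (x + y) = expi x * expi y.
Proof. by rewrite /expi cosD sinD; apply/eqP; rewrite eq_complex /= eqxx addrC mulrC [sin x * _]mulrC eqxx. Qed.

Lemma expi0 : expi 0 = 1. Proof. by rewrite /expi cos0 sin0. Qed.

Lemma expiX x n : expi x ^+ n = expi (x * n%:R).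
Proof.
elim: n => [|n IH]; first by rewrite expr0 mulr0 expi0.
by rewrite exprS IH -expiD -natr1 mulrDr mulr1 addrC.
Qed.

Lemma nm_expi x : nm (expi x) = 1.
Proof. by rewrite /nm /= cos2Dsin2 sqrtr1. Qed.

Lemma expi_2pi : expi (2 * pi) = 1.
Proof.
have E : 2 * pi = 0 + pi *+ 2 :> R by rewrite add0r mulr_natl.
by rewrite E /expi cosD2pi sinD2pi cos0 sin0.
Qed.

Lemma expi_neq1 (x : R) : 0 < x < pi *+ 2 -> expi x != 1.
Proof.
move=> /andP[x0 x1]; apply/eqP => E.
have : 0 < sin (x / 2).
  by apply: sin_gt0_pi; rewrite divr_gt0 //= ltr_pdivrMr // mulr_natr.
have : cos x = 1 by have [] := E.
have {1}-> : x = (x / 2) *+ 2 by rewrite -mulr_natr divfK.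
rewrite cos_mulr2n; have := cos2Dsin2 (x / 2).
by move: (cos _) (sin _) => c s; nra.
Qed.

Definition rou (M : nat) : C := expi (2 * pi / M%:R).

Lemma rouX_M M : (0 < M)%N -> rou M ^+ M = 1.
Proof. by move=> M0; rewrite /rou expiX divfK ?expi_2pi // pnatr_eq0 -lt0n. Qed.

Lemma rouX_eq1 M k : (0 < M)%N -> (rou M ^+ k == 1) = (M %| k)%N.
Proof.
move=> M0; rewrite [in LHS](divn_eq k M) exprD mulnC exprM rouX_M // expr1n mul1r.
rewrite /dvdn; have [->|k0] := eqVneq (k %% M)%N 0%N; first by rewrite expr0 eqxx.
apply/negbTE; rewrite /rou expiX; apply: expi_neq1.
have M0' : 0 < M%:R :> R by rewrite ltr0n.
have p0 := pi_gt0 R; have k0' : 0 < (k %% M)%:R :> R by rewrite ltr0n lt0n.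
rewrite mulrAC mulr_gt0 ?invr_gt0 ?mulr_gt0 //= ltr_pdivrMr // -[pi *+ 2]mulr_natl.
by rewrite ltr_pM2l ?mulr_gt0 // ltr_nat ltn_pmod.
Qed.

Lemma nm_rouX M k : nm (rou M ^+ k) = 1.
Proof. by rewrite nmX nm_expi expr1n. Qed.

Lemma sum_rou M k : (0 < M)%N ->
  \sum_(0 <= j < M) rou M ^+ (k * j) = if (M %| k)%N then M%:R else 0.
Proof.
move=> M0; rewrite -rouX_eq1 //; case: eqP => [E|/eqP E].
  under eq_bigr do rewrite exprM E expr1n.
  by rewrite sumr_const_nat subn0.
apply/eqP; have h : rou M ^+ k - 1 != 0 by rewrite subr_eq0.
rewrite -(mulrI_eq0 _ (mulfI h)) big_mkord.
under eq_bigr do rewrite exprM.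
by rewrite -subrX1 -exprM mulnC exprM rouX_M // expr1n subrr.
Qed.

Lemma conj_rouX M k l : (0 < M)%N -> (M %| k + l)%N -> (rou M ^+ k)^*%C = rou M ^+ l.
Proof.
move=> M0 Mkl; have : rou M ^+ k * rou M ^+ l = 1.
  by apply/eqP; rewrite -exprD rouX_eq1.
have h : (rou M ^+ k)^*%C * rou M ^+ k = 1.
  by rewrite mulrC -sqr_normc normC_nm nm_rouX expr1n.
by move=> E; rewrite -[LHS]mulr1 -E mulrA h mul1r.
Qed.

End RootsOfUnity.

(** * Power sums of inverse roots and the Borel-Caratheodory inequality *)

Section BorelCaratheodory.
Variable R : realType.
Local Notation C := R[i].

Lemma expr_small (r e : R) : 0 <= r -> r < 1 -> 0 < e ->
  exists N, forall n, (N <= n)%N -> r ^+ n <= e.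
Proof.
move=> r0 r1 e0; have r1' : `|r| < 1 by rewrite ger0_norm.
have /cvgrPdist_le /(_ e e0) [N _ h] := cvg_expr r1'.
exists N => n Nn; have := h n Nn.
by rewrite sub0r normrN ger0_norm // exprn_ge0.
Qed.

Lemma Re_div (x y : C) : complex.Re (x / y) =
  (complex.Re x * complex.Re y + complex.Im x * complex.Im y) / nm y ^+ 2.
Proof. by case: x y => [a b] [c d]; rewrite nm_sqr /=; ring. Qed.

(** Mean value theorem on [[0, 1]] for [ln |1 - t z|] plus the partial sum at [t z]: the geometric
    sum collapses the derivative to the real part of [- z (t z)^D / (1 - t z)]. Only the real
    logarithm of the modulus occurs. *)
Lemma ln_series (z : C) (r : R) D : nm z <= r -> r < 1 ->
  `| ln (nm (1 - z)) + \sum_(0 <= i < D) complex.Re (z ^+ i.+1) / i.+1%:R | <=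
  r ^+ D.+1 / (1 - r).
Proof.
move=> zr r1; have z1 : nm z < 1 by exact: le_lt_trans r1.
pose u := complex.Re z; pose w := complex.Im z; pose n := u ^+ 2 + w ^+ 2.
have zE : z = (u +i* w)%C by rewrite /u /w; case: (z).
pose q : {poly R} := 1 - (2 * u)%:P * 'X + n%:P * 'X ^+ 2.
pose s : {poly R} := \sum_(0 <= i < D) (complex.Re (z ^+ i.+1) / i.+1%:R)%:P * 'X ^+ i.+1.
have qE t : q.[t] = nm (1 - t%:C%C * z) ^+ 2.
  by rewrite nm_sqr /q !hornerE zE /= /n; ring.
have nz1 (t : R) : 0 <= t <= 1 -> nm (t%:C%C * z) <= r.
  move=> /andP[t0 t1]; rewrite nmM nm_real ger0_norm //; apply: le_trans zr.
  by rewrite ler_piMl ?nm_ge0.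
have q0 (t : R) : 0 <= t <= 1 -> 0 < q.[t].
  move=> t01; rewrite qE exprn_gt0 //; have := nm_subl 1 (t%:C%C * z).
  by have := nz1 t t01; rewrite nm1; lra.
have dq t : q^`().[t] = - (2 * u) + 2 * n * t.
  by rewrite /q derivD derivB !deriv_mulC derivC derivX derivXn !hornerE /=; ring.
have ds t : s^`().[t] = \sum_(0 <= i < D) complex.Re (z * (t%:C%C * z) ^+ i).
  rewrite /s (raddf_sum (@deriv R)) /= horner_sum; apply: eq_bigr => i _.
  rewrite deriv_mulC derivXn !hornerE hornerMn hornerXn /= exprMn -rmorphXn mulrCA -exprS ReZ.
  by rewrite -[t ^+ i *+ _]mulr_natr mulrCA divfK ?pnatr_eq0.
pose f := (fun t : R => 2^-1 * ln q.[t] + s.[t]).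
pose df := (fun t : R => 2^-1 * (q.[t]^-1 * q^`().[t]) + s^`().[t]).
have fd (t : R) : 0 <= t <= 1 -> is_derive t 1 f (df t).
  move=> t01; apply: (@is_deriveD _ _ _ (fun t => 2^-1 * ln q.[t]) (horner s)).
  apply: (@is_deriveZ _ _ _ (fun t => ln q.[t]) 2^-1).
  apply: (@is_derive1_comp _ (@ln R) (horner q)).
  exact/is_derive1_ln/q0.
have [c] : exists2 c, c \in `]0, 1[ & f 1 - f 0 = df c * (1 - 0).
  apply: MVT => // [t|].
    by rewrite in_itv /= => /andP[t0 t1]; apply: fd; rewrite !ltW.
  by apply: derivable_within_continuous => t; rewrite in_itv /= => t01; have := fd t t01 => -[].
rewrite in_itv /= subr0 mulr1 => /andP[c0 c1] fE.
have c01 : 0 <= c <= 1 by rewrite !ltW.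
have f1 : f 1 = ln (nm (1 - z)) + \sum_(0 <= i < D) complex.Re (z ^+ i.+1) / i.+1%:R.
  rewrite /f qE rmorph1 mul1r lnXn; last first.
    by have := nm_subl 1 z; rewrite nm1; lra.
  rewrite -(mulr_natl (ln _) 2) mulKf //; congr (_ + _).
  by rewrite /s horner_sum; apply: eq_bigr => i _; rewrite !hornerE expr1n mulr1.
have f0 : f 0 = 0.
  rewrite /f qE rmorph0 mul0r subr0 nm1 expr1n ln1 mulr0 add0r /s horner_sum big1 // => i _.
  by rewrite !hornerE expr0n mulr0.
move: fE; rewrite f0 subr0 f1 => ->.
pose T := c%:C%C * z.
have T1 : 1 - T != 0.
  rewrite -nm_gt0; have := nm_subl 1 T; have := nz1 c c01; rewrite nm1 /T; lra.
have -> : df c = complex.Re (- z * T ^+ D / (1 - T)).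
  rewrite /df ds.
  have -> : - z * T ^+ D / (1 - T) = - z / (1 - T) + \sum_(0 <= i < D) z * T ^+ i.
    rewrite big_mkord -mulr_sumr; apply: (mulIf T1); rewrite mulrDl !mulfVK //.
    have := subrX1 T D; rewrite -[X in _ = X -> _]opprK -mulNr opprB => E.
    by rewrite -mulrA [_ * (1 - T)]mulrC -[X in z * X]opprK -E; ring.
  rewrite ReD Re_sum; congr (_ + _).
  rewrite Re_div dq qE -/T mulrCA mulrC; congr (_ / _).
  have -> : complex.Re (1 - T) = 1 - c * u by rewrite /T zE /=; ring.
  have -> : complex.Im (1 - T) = - (c * w) by rewrite /T zE /=; ring.
  have -> : complex.Re (- z) = - u by rewrite zE.
  have -> : complex.Im (- z) = - w by rewrite zE.
  by rewrite /n; field.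
apply: (le_trans (Re_le_nm _)); rewrite !nmM nmN nmV nmX.
have := nm_subl 1 T; have := nz1 c c01; rewrite nm1 -/T => h1 h2.
rewrite ler_pM ?mulr_ge0 ?invr_ge0 ?exprn_ge0 ?nm_ge0 //.
  by rewrite exprS ler_pM ?exprn_ge0 ?nm_ge0 // lerXn2r ?nnegrE ?nm_ge0 // (le_trans (nm_ge0 z)).
by rewrite lef_pV2 ?posrE ?nm_gt0 //; lra.
Qed.

Lemma ln_prod_seq (I : eqType) (s : seq I) (F : I -> R) :
  (forall i, i \in s -> 0 < F i) ->
  ln (\prod_(i <- s) F i) = \sum_(i <- s) ln (F i) /\ 0 < \prod_(i <- s) F i.
Proof.
elim: s => [|i s IH] F0; first by rewrite !big_nil ln1.
have [|E P0] := IH; first by move=> j js; apply: F0; rewrite inE js orbT.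
have Fi : 0 < F i by apply: F0; rewrite mem_head.
by rewrite !big_cons lnM ?posrE // E mulr_gt0.
Qed.

Lemma ReMRe (a b : C) :
  complex.Re a * complex.Re b = 2^-1 * (complex.Re (a * b) + complex.Re (a * b^*%C)).
Proof. by case: a b => [a1 a2] [b1 b2] /=; field. Qed.

Lemma ndvd_shift (M i n : nat) : (0 < n)%N -> (n < M)%N -> (i < M)%N -> i.+1 != n ->
  (M %| i.+1 + (M - n))%N = false.
Proof.
move=> n0 nM iM ni; apply/negP => /dvdnP[q h].
case: q h => [|[|q]] h; rewrite ?mul0n ?mul1n in h; [lia| |].
  by move/eqP: ni; lia.
have : (2 * M <= q.+2 * M)%N by rewrite leq_mul2r orbT.
by rewrite -h; lia.
Qed.

(* The weights [1 + Re (v w^(n k))] are nonnegative, and averaging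
   [ln K - ln |p|] against them over the [M]-th roots of unity isolates the
   [n]-th Taylor coefficient of [ln p]. *)
Lemma borel_caratheodory (xs : seq C) (r K : R) (n : nat) :
  r < 1 -> (forall x, x \in xs -> nm x <= r) -> (0 < n)%N ->
  (forall y, nm y = 1 -> nm (\prod_(x <- xs) (1 - x * y)) <= K) ->
  nm (\sum_(x <- xs) x ^+ n) <= 2 * n%:R * ln K.
Proof.
move=> r1 xr n0 pK.
have [xs0|xs0] := eqVneq xs [::].
  rewrite xs0 big_nil nm0 mulr_ge0 ?mulr_ge0 ?ler0n // ln_ge0 //.
  by have := pK 1 (nm1 _); rewrite xs0 big_nil nm1.
have r0 : 0 <= r.
  by case: xs xs0 xr {pK} => // x s _ /(_ x); rewrite mem_head => /(_ isT); apply: le_trans (nm_ge0 _).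
have nz x y : x \in xs -> nm y = 1 -> 0 < nm (1 - x * y).
  move=> /xr xr' y1; have := nm_subl 1 (x * y); rewrite nmM y1 nm1 mulr1; lra.
have K0 : 0 < K.
  apply: lt_le_trans (pK 1 (nm1 _)); rewrite nm_prod big_seq.
  by apply: prodr_gt0 => x xxs; apply: nz => //; exact: nm1.
rewrite -subr_ge0; apply/ler_addgt0Pr => e e0; rewrite -lerBlDr sub0r.
pose c := \sum_(x <- xs) x ^+ n.
have s1 : 0 < (size xs)%:R + 1 :> R by rewrite ltr_wpDl.
pose e1 := e / (2 * n%:R).
have n0' : 0 < n%:R :> R by rewrite ltr0n.
have e10 : 0 < e1 by rewrite divr_gt0 // mulr_gt0.
have d0 : 0 < e1 * (1 - r) / ((size xs)%:R + 1) by rewrite divr_gt0 // mulr_gt0 // subr_gt0.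
have [N hN] := expr_small r0 r1 d0.
(* [M] exceeds all exponents [i.+1 + n] with [i < D], so averaging over the [M]-th roots of unity
   annihilates every product of frequencies except that of [i.+1 = n] with its conjugate. *)
pose D := maxn N n; pose M := (D + n).+1.
have M0 : (0 < M)%N by [].
have nD : (n <= D)%N by exact: leq_maxr.
have eta : (size xs)%:R * (r ^+ D.+1 / (1 - r)) <= e1.
  have h := hN D.+1 (leqW (leq_maxl N n)).
  rewrite mulrA ler_pdivrMr ?subr_gt0 //.
  rewrite ler_pdivlMr // in h; apply: le_trans h; rewrite mulrC ler_wpM2l ?exprn_ge0 //.
  by rewrite lerDl.
pose w := rou R M.
pose P k := \sum_(0 <= i < D) complex.Re ((\sum_(x <- xs) x ^+ i.+1) * w ^+ (k * i.+1)) / i.+1%:R.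
have lnp k : - P k - e1 <= ln K.
  have y1 : nm (w ^+ k) = 1 by exact: nm_rouX.
  have lnK : ln (nm (\prod_(x <- xs) (1 - x * w ^+ k))) <= ln K.
    rewrite ler_ln ?posrE ?pK // nm_prod big_seq.
    by apply: prodr_gt0 => x xxs; apply: nz.
  apply: le_trans lnK; rewrite nm_prod.
  have [|-> _] := @ln_prod_seq _ xs (fun x => nm (1 - x * w ^+ k)).
    by move=> x xxs; apply: nz.
  have -> : P k = \sum_(x <- xs) \sum_(0 <= i < D) complex.Re ((x * w ^+ k) ^+ i.+1) / i.+1%:R.
    rewrite exchange_big /=; apply: eq_bigr => i _.
    rewrite mulr_suml Re_sum mulr_suml; apply: eq_bigr => x _.
    by rewrite exprMn -exprM.
  set B := \sum_(x <- xs) \sum_(0 <= i < D) _; set A := \sum_(x <- xs) _.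
  suff : `|A + B| <= e1 by rewrite ler_norml => /andP[h _]; lra.
  rewrite /A /B -big_split /=.
  apply: (le_trans (ler_norm_sum _ _ _)); apply: le_trans eta.
  rewrite -sum1_size natr_sum mulr_suml big_seq [leRHS]big_seq; apply: ler_sum => x xxs.
  by rewrite mul1r; apply: ln_series => //; rewrite nmM y1 mulr1; exact: xr.
(* The direction opposite to [c]. For [c = 0] the convention [0^-1 = 0] gives [u = 0], which serves
   as well. *)
pose u := - c * ((nm c)^-1)%:C%C.
have u1 : nm u <= 1.
  rewrite /u nmM nmN nm_real ger0_norm ?invr_ge0 ?nm_ge0 //.
  have [->|c0] := eqVneq (nm c) 0; first by rewrite mul0r.
  by rewrite divff.
have cu : complex.Re (c * u^*%C) = - nm c.
  have -> : c * u^*%C = - (c * c^*%C) * ((nm c)^-1)%:C%C.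
    rewrite /u; move: (nm c)^-1 => y; case: (c) => c1 c2.
    by apply/eqP; rewrite eq_complex /=; apply/andP; split; apply/eqP; ring.
  rewrite -sqr_normc normC_nm mulrC -rmorphXn -rmorphN ReZ /=.
  have [->|c0] := eqVneq (nm c) 0; first by rewrite invr0 mul0r oppr0.
  by field.
pose W k := 1 + complex.Re (u * w ^+ (k * n)).
have W0 k : 0 <= W k.
  rewrite /W -lerBlDl sub0r; have := Re_le_nm (u * w ^+ (k * n)).
  rewrite nmM nm_rouX mulr1 ler_norml => /andP[h _].
  by apply: le_trans h; rewrite lerN2.
have sw z i : (0 < i < M)%N -> \sum_(0 <= k < M) complex.Re (z * w ^+ (k * i)) = 0.
  move=> /andP[i0 iM]; rewrite -Re_sum -mulr_sumr.
  under eq_bigr do rewrite mulnC.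
  by rewrite sum_rou // gtnNdvd // mulr0.
have nM : (n < M)%N by rewrite /M ltnS leq_addl.
have sW : \sum_(0 <= k < M) W k = M%:R.
  by rewrite /W big_split /= sw ?n0 // addr0 sumr_const_nat subn0.
have sP : \sum_(0 <= k < M) P k = 0.
  rewrite /P exchange_big /= big_nat_cond big1 // => i /andP[/andP[_ iD] _].
  rewrite -mulr_suml sw ?mul0r //= /M ltnS; apply: (leq_trans _ (leq_addr _ _)); exact: iD.
have sPW : \sum_(0 <= k < M) P k * complex.Re (u * w ^+ (k * n)) = - (M%:R * nm c / (2 * n%:R)).
  rewrite /P; under eq_bigr do rewrite mulr_suml.
  rewrite exchange_big /=.
  have E i : (i < D)%N -> \sum_(0 <= k < M) complex.Re ((\sum_(x <- xs) x ^+ i.+1) * w ^+ (k * i.+1)) / i.+1%:R *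
      complex.Re (u * w ^+ (k * n)) = if i.+1 == n then - (M%:R * nm c / (2 * n%:R)) else 0.
    move=> iD; set pp := \sum_(x <- xs) _.
    under eq_bigr do rewrite mulrAC ReMRe.
    rewrite -mulr_suml -mulr_sumr big_split /=.
    have -> : \sum_(0 <= k < M) complex.Re (pp * w ^+ (k * i.+1) * (u * w ^+ (k * n))) = 0.
      rewrite -[RHS](sw (pp * u) (i.+1 + n)%N); first by apply: eq_bigr => k _; rewrite mulrACA -exprD mulnDr.
      by rewrite addn_gt0 /= /M ltnS leq_add2r.
    have -> : \sum_(0 <= k < M) complex.Re (pp * w ^+ (k * i.+1) * (u * w ^+ (k * n))^*%C) =
       complex.Re (pp * u^*%C * (if (M %| i.+1 + (M - n))%N then M%:R else 0)).
      rewrite -sum_rou // mulr_sumr Re_sum; apply: eq_bigr => k _.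
      rewrite rmorphM /= (@conj_rouX _ M (k * n) (k * (M - n))) //; last first.
        by rewrite -mulnDr subnKC ?(ltnW nM) // dvdn_mull.
      by rewrite mulrACA -exprD -mulnDr mulnC.
    have [E|/eqP E] := eqVneq i.+1 n.
      rewrite E subnKC ?(ltnW nM) // dvdnn /pp E -/c.
      rewrite (_ : complex.Re (c * u^*%C * M%:R) = M%:R * - nm c); last first.
        by rewrite -cu -ReZ rmorph_nat mulrC.
      by field; rewrite pnatr_eq0 -lt0n.
    have -> : (M %| i.+1 + (M - n))%N = false.
      have iM : (i < M)%N by rewrite /M ltnS (leq_trans (ltnW iD)) // leq_addr.
      by apply: ndvd_shift => //; apply/eqP.
    by rewrite mulr0 /= addr0 mulr0 mul0r.
  have nD' : (n.-1 < D)%N by rewrite prednK.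
  rewrite (bigD1_seq n.-1) ?mem_index_iota ?iota_uniq //= (E _ nD') prednK // eqxx.
  rewrite big_nat_cond big1 ?addr0 // => i /andP[/andP[_ iD] ni].
  by rewrite E //; case: eqP => // h; move: ni; rewrite -h eqxx.
have : 0 <= \sum_(0 <= k < M) (ln K + e1 + P k) * W k.
  by apply: sumr_ge0 => k _; rewrite mulr_ge0 // -[_ + P k]opprK oppr_ge0; have := lnp k; lra.
have -> : \sum_(0 <= k < M) (ln K + e1 + P k) * W k =
  (ln K + e1) * M%:R - M%:R * nm c / (2 * n%:R).
  under eq_bigr do rewrite mulrDl.
  rewrite big_split /= -mulr_sumr sW; congr (_ + _); rewrite /W.
  under eq_bigr do rewrite mulrDr mulr1.
  by rewrite big_split /= sP add0r sPW.
have M0' : 0 < M%:R :> R by rewrite ltr0n.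
have -> : (ln K + e1) * M%:R - M%:R * nm c / (2 * n%:R) =
  M%:R / (2 * n%:R) * (2 * n%:R * ln K + e - nm c).
  by rewrite /e1; field; rewrite gt_eqF.
rewrite pmulr_rge0 ?divr_gt0 ?mulr_gt0 // -/c; lra.
Qed.

End BorelCaratheodory.

Section Newton.
Variable R : realType.
Local Notation C := R[i].

(** Newton's identities, the coefficient form of the logarithmic derivative of [p]. A further root
    changes the coefficients by a single shift, whence the induction on the list. *)
Lemma newton_prod (F : fieldType) (xs : seq F) (k : nat) :
  let p := \prod_(x <- xs) (1 - x%:P * 'X) in
  k.+1%:R * p`_k.+1 = - \sum_(0 <= i < k.+1) (\sum_(x <- xs) x ^+ i.+1) * p`_(k - i).
Proof.
elim: xs k => [|x xs IH] k /=.
  by rewrite big_nil coef1 mulr0 big1 ?oppr0 // => i _; rewrite big_nil mul0r.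
rewrite big_cons; set q := \prod_(y <- xs) _ in IH *.
have c0 : ((1 - x%:P * 'X) * q)`_0 = q`_0.
  by rewrite mulrBl mul1r coefB -mulrA coefCM coefXM /= mulr0 subr0.
have cS j : ((1 - x%:P * 'X) * q)`_j.+1 = q`_j.+1 - x * q`_j.
  by rewrite mulrBl mul1r coefB -mulrA coefCM coefXM.
set p := (1 - x%:P * 'X) * q in c0 cS *.
have B j : \sum_(0 <= i < j.+1) x ^+ i.+1 * p`_(j - i) = x * q`_j.
  elim: j => [|j IHj]; first by rewrite big_nat1 expr1 c0.
  rewrite big_nat_recl // expr1 subn0 cS.
  have -> : \sum_(0 <= i < j.+1) x ^+ i.+2 * p`_(j.+1 - i.+1) = x * (x * q`_j).
    by rewrite -IHj mulr_sumr; apply: eq_bigr => i _; rewrite subSS exprS mulrA.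
  by rewrite mulrBr subrK.
have A : \sum_(0 <= i < k.+1) (\sum_(y <- xs) y ^+ i.+1) * p`_(k - i) =
   - (k.+1%:R * q`_k.+1) + x * (k%:R * q`_k).
  rewrite IH opprK; case: k => [|k].
    by rewrite !big_nat1 c0 mul0r mulr0 addr0.
  rewrite big_nat_recr //= subnn c0 [in RHS]big_nat_recr //= subnn.
  rewrite IH mulrN addrAC; congr (_ + _).
  rewrite mulr_sumr -sumrB; apply: eq_big_nat => i /andP[_ ik].
  by rewrite subSn // cS mulrBr (mulrCA x).
under eq_bigr do rewrite big_cons mulrDl.
by rewrite big_split /= B A cS -natr1; ring.
Qed.

Lemma factor_unit_const (F : closedFieldType) (P : {poly F}) : P`_0 != 0 ->
  exists xs : seq F, [/\ P = (P`_0)%:P * \prod_(x <- xs) (1 - x%:P * 'X),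
    forall x, x \in xs -> x != 0 /\ root P x^-1 & (size xs < size P)%N].
Proof.
move=> P0; have Pn0 : P != 0 by apply: contraNneq P0 => ->; rewrite coef0.
have [rs rsE] := closed_field_poly_normal P.
have rr r : r \in rs -> root P r.
  by move=> rin; rewrite rsE rootZ ?lead_coef_eq0 // root_prod_XsubC.
have rs0 r : r \in rs -> r != 0.
  by move=> /rr; apply: contraTneq => ->; rewrite rootE horner_coef0.
exists [seq r^-1 | r <- rs]; split.
- have : forall s : seq F, all (fun r => r != 0) s ->
    exists2 c, c != 0 & \prod_(r <- s) ('X - r%:P) = c%:P * \prod_(x <- [seq r^-1 | r <- s]) (1 - x%:P * 'X).
    elim=> [|r s IH] /=; first by exists 1; rewrite ?oner_eq0 // !big_nil mulr1.
    move=> /andP[r0 /IH[c c0 E]]; exists (- r * c); first by rewrite mulf_neq0 // oppr_eq0.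
    rewrite !big_cons E polyCM mulrACA; congr (_ * _) => //.
    by rewrite mulrBr mulr1 mulrA -polyCM mulNr divff // !polyCN polyC1 mulN1r opprK addrC.
  move=> /(_ rs); case; first by apply/allP => r; exact: rs0.
  move=> c c0 E; have PE : P = (lead_coef P * c)%:P * \prod_(x <- [seq r^-1 | r <- rs]) (1 - x%:P * 'X).
    by rewrite {1}rsE E -mul_polyC mulrA polyCM.
  rewrite {1}PE; congr (_%:P * _).
  rewrite [in RHS]PE coefCM -horner_coef0 horner_prod big1 ?mulr1 // => x _.
  by rewrite !hornerE ?mulr0 ?subr0.
- by move=> x /mapP[r rin ->]; rewrite invr_eq0 invrK rs0 // rr.
rewrite size_map rsE size_scale ?lead_coef_eq0 // size_prod_XsubC //.
Qed.

(** The [pi_ i] are the power sums of the inverse roots. Scaled by [r0] these lie in the open unit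
    disc, and being finitely many they stay below one [r < 1], as [borel_caratheodory] requires. *)
Lemma newton_bound (P : {poly C}) (r0 K : R) : 0 < r0 -> P`_0 != 0 ->
  (forall y, nm y <= r0 -> P.[y] != 0) ->
  (forall y, nm y = r0 -> nm P.[y] <= K * nm P`_0) ->
  exists pi_ : nat -> C,
    (forall k, k.+1%:R * P`_k.+1 = - \sum_(0 <= i < k.+1) pi_ i * P`_(k - i)) /\
    (forall i, nm (pi_ i) * r0 ^+ i.+1 <= 2 * i.+1%:R * ln K).
Proof.
move=> r00 P0 Pz PK; have [xs [PE xsP _]] := factor_unit_const P0.
exists (fun i => \sum_(x <- xs) x ^+ i.+1); split=> [k|i].
  have := newton_prod xs k; set Q := \prod_(x <- xs) _ in PE *.
  move=> /= E; rewrite PE !coefCM mulrCA E mulrN mulr_sumr; congr (- _).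
  by apply: eq_bigr => i _; rewrite coefCM mulrCA.
have xr x : x \in xs -> nm x * r0 < 1.
  move=> /xsP[x0 rx]; rewrite ltNge; apply/negP => h.
  have : nm x^-1 <= r0 by rewrite nmV -div1r ler_pdivrMr ?nm_gt0 // mulrC.
  by move=> /Pz /negP; apply.
have [r [r1 xsr]] : exists r, r < 1 /\ forall x, x \in xs -> nm x * r0 <= r.
  elim: xs {PE xsP} xr => [|x s IH] xr; first by exists 0.
  have [|r [r1 hr]] := IH; first by move=> y ys; apply: xr; rewrite inE ys orbT.
  exists (Num.max (nm x * r0) r); split; first by rewrite gt_max r1 xr ?mem_head.
  move=> y; rewrite inE le_max => /orP[/eqP ->|/hr ->]; by rewrite ?lexx ?orbT.
pose ys := [seq x * r0%:C%C | x <- xs].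
have nr0 : nm r0%:C%C = r0 by rewrite nm_real ger0_norm // ltW.
have -> : nm (\sum_(x <- xs) x ^+ i.+1) * r0 ^+ i.+1 = nm (\sum_(y <- ys) y ^+ i.+1).
  rewrite /ys big_map -[in LHS]nr0 -nmX -nmM mulr_suml.
  by congr nm; apply: eq_bigr => x _; rewrite exprMn.
apply: (borel_caratheodory (r := r)) => //.
  by move=> _ /mapP[x xxs ->]; rewrite nmM nr0 xsr.
move=> y y1; have P0' : 0 < nm P`_0 by rewrite nm_gt0.
rewrite -(ler_pM2r P0') mulrC -nmM.
have -> : P`_0 * \prod_(x <- ys) (1 - x * y) = P.[r0%:C%C * y].
  rewrite [in RHS]PE hornerM hornerC horner_prod /ys big_map; congr (_ * _).
  by apply: eq_bigr => x _; rewrite !hornerE /= ?mulrA.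
by apply: PK; rewrite nmM nr0 y1 mulr1.
Qed.

End Newton.

(** * Evaluation on a block of primes in one residue class *)

Lemma sum_leq_nat k l : (l <= k)%N -> (\sum_(1 <= i < k.+1) (i <= l))%N = l.
Proof.
move=> lk; rewrite (big_cat_nat (n := l.+1)) //=.
rewrite [X in (_ + X)%N]big_nat_cond [X in (_ + X)%N]big1 ?addn0; last first.
  by move=> i /andP[/andP[h _] _]; rewrite leqNgt h.
rewrite big_nat_cond (eq_bigr (fun=> 1%N)) -?big_nat_cond ?sum_nat_const_nat ?subn1 ?muln1 //.
by move=> i /andP[/andP[_ h] _]; rewrite -ltnS h.
Qed.

Lemma sum_multiples_div (V : nmodType) (d X : nat) (G : nat -> V) : (0 < d)%N ->
  \sum_(1 <= n < X.+1 | (d %| n)%N) G n = \sum_(1 <= m < (X %/ d).+1) G (d * m)%N.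
Proof.
move=> d0; rewrite sum_multiples // [RHS](big_nat_widen _ _ X.+1) ?ltnS ?leq_div //.
by apply: eq_bigl => m; rewrite !ltnS leq_divRL // mulnC.
Qed.

Section SeriesLimit.
Variable R : realType.

Lemma series_limit (a : nat -> R) (K : R) :
  (forall n, (0 < n)%N -> `|a n| <= K / n%:R ^+ 2) ->
  exists c, forall X, (0 < X)%N -> `|\sum_(1 <= n < X) a n - c| <= 2 * K / X%:R.
Proof.
move=> aK; have K0 : 0 <= K.
  by have := aK 1%N isT; rewrite expr1n divr1; apply: le_trans.
pose s X := \sum_(1 <= n < X) a n.
have step X Y : (0 < X)%N -> (X <= Y)%N -> `|s Y - s X| <= 2 * K / X%:R - 2 * K / Y%:R.
  move=> X0; elim: Y => [|Y IH]; first by rewrite leqNgt X0.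
  rewrite leq_eqVlt => /orP[/eqP <-|]; first by rewrite !subrr normr0.
  rewrite ltnS => XY; have Y0 : (0 < Y)%N := leq_trans X0 XY.
  have -> : s Y.+1 - s X = (s Y - s X) + a Y by rewrite /s big_nat_recr //= addrAC.
  apply: (le_trans (ler_normD _ _)); have := IH XY; have := aK Y Y0.
  have : 1 <= Y%:R :> R by rewrite ler1n.
  rewrite -(natr1 Y); move: (Y%:R : R) => y /inv_sqr_step h h1 h2.
  have := ler_wpM2l K0 h; move: h1 h2; rewrite mulrBr !(mulrC 2 K) -!mulrA; lra.
pose E := [set z | exists2 X, (0 < X)%N & z = s X - 2 * K / X%:R]%classic.
have ubE Y : (0 < Y)%N -> ubound E (s Y + 2 * K / Y%:R).
  move=> Y0 _ [X X0 ->].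
  have pX : 0 <= 2 * K / X%:R by rewrite divr_ge0 ?mulr_ge0.
  have pY : 0 <= 2 * K / Y%:R by rewrite divr_ge0 ?mulr_ge0.
  case/orP: (leq_total X Y) => h.
    by have := step X Y X0 h; rewrite ler_norml => /andP[h1 _]; lra.
  by have := step Y X Y0 h; rewrite ler_norml => /andP[_ h1]; lra.
have nE : (E !=set0)%classic by exists (s 1%N - 2 * K / 1%:R); exists 1%N.
exists (sup E) => X X0; rewrite ler_norml lerBlDr lerBrDr -/(s X).
have h1 : sup E <= s X + 2 * K / X%:R by apply: ge_sup => //; exact: ubE.
have h2 : s X - 2 * K / X%:R <= sup E.
  apply: ub_le_sup; last by exists X.
  by exists (s X + 2 * K / X%:R); exact: ubE.
by apply/andP; split; lra.
Qed.

Lemma series_limit_uniq (a : nat -> R) (K c c' : R) :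
  (forall X, (0 < X)%N -> `|\sum_(1 <= n < X) a n - c| <= K / X%:R) ->
  (forall X, (0 < X)%N -> `|\sum_(1 <= n < X) a n - c'| <= K / X%:R) -> c = c'.
Proof.
move=> hc hc'; apply/eqP; rewrite -subr_eq0 -normr_le0; apply/ler_addgt0Pr => e e0.
rewrite add0r.
pose X := (Num.truncn (2 * K / e)).+1.
have X0 : (0 < X)%N by [].
have := hc X X0; have := hc' X X0; set s := \sum_(_ <= _ < _) _ => h1 h2.
have -> : c - c' = (s - c') - (s - c) by ring.
apply: (le_trans (ler_normB _ _)); apply: (le_trans (lerD h1 h2)).
rewrite (_ : K / X%:R + K / X%:R = 2 * K / X%:R); last by ring.
rewrite ler_pdivrMr ?ltr0n // -ler_pdivrMl //.
by rewrite mulrC ltW // truncnS_gt.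
Qed.

End SeriesLimit.

Section PeelPrimes.
Variable R : realType.

Lemma sum_peel (th : nat -> R) (B : seq nat) N :
  cmultiplicative th -> (forall n, (0 < n)%N -> 0 <= th n) ->
  (forall p, p \in B -> prime p /\ th p < 1) ->
  \sum_(1 <= n < N) th n <= (\prod_(p <- B) (1 - th p)^-1) *
    \sum_(1 <= n < N | all (fun p => ~~ (p %| n)%N) B) th n.
Proof.
move=> [_ thM] th0; elim: B => [|p B IH] hB.
  by rewrite big_nil mul1r; under [leRHS]eq_bigl do [].
have hB' r : r \in B -> prime r /\ th r < 1 by move=> rB; apply: hB; rewrite inE rB orbT.
apply: (le_trans (IH hB')); rewrite big_cons mulrC [leRHS]mulrAC ler_wpM2r //.
  rewrite big_seq prodr_ge0 // => r /hB'[_ r1]; rewrite invr_ge0 subr_ge0 ltW //.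
have [pp p1] := hB p (mem_head _ _).
rewrite mulrC ler_pdivlMr ?subr_gt0 // mulrBr mulr1 lerBlDr.
rewrite [leLHS](bigID (fun n => (p %| n)%N)) /= addrC lerD //.
  by rewrite le_eqVlt; apply/orP; left; apply/eqP; apply: eq_bigl => n; rewrite andbC.
under eq_bigl do rewrite andbC.
rewrite big_mkcondr sum_multiples ?prime_gt0 // [leLHS]big_mkcond mulr_suml [leRHS]big_mkcond /=.
apply: ler_sum_nat => n /andP[n0 _].
have hn : 0 <= if all (fun r => ~~ (r %| n)%N) B then th n * th p else 0.
  by case: ifP => // _; apply: mulr_ge0; apply: th0 => //; exact: prime_gt0.
case: ifP => // _; case: ifP => // /allP h.
have -> : all (fun r => ~~ (r %| n)%N) B.
  by apply/allP => r rB; apply: contra (h r rB) => ?; rewrite dvdn_mull.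
by rewrite thM ?(prime_gt0 pp) // mulrC.
Qed.

Lemma cmult_le (u v : nat -> R) n : cmultiplicative u -> cmultiplicative v ->
  (forall p, prime p -> 0 <= u p /\ u p <= v p) -> (0 < n)%N -> 0 <= u n /\ u n <= v n.
Proof.
move=> [u1 uM] [v1 vM] uv; elim/ltn_ind: n => n IH n0.
have [n1|n1] := leqP n 1; first by rewrite (_ : n = 1%N) ?u1 ?v1 //; lia.
have pp := pdiv_prime n1; have dp := pdiv_dvd n; have pd0 := prime_gt0 pp.
have q1 : (0 < n %/ pdiv n)%N by rewrite divn_gt0 // dvdn_leq.
have [|h1 h2] := IH (n %/ pdiv n)%N _ q1; first by rewrite ltn_Pdiv ?prime_gt1.
have [h3 h4] := uv _ pp.
by rewrite -(divnK dp) uM // vM // mulr_ge0 // ler_pM.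
Qed.

End PeelPrimes.

Section Block.
Variables (R : realType) (q g s N : nat) (B : seq nat) (C : R).
Local Notation CC := R[i].
Hypotheses (q0 : (0 < q)%N) (s0 : (0 < s)%N) (N0 : (0 < N)%N) (C0 : 0 <= C).
Hypothesis uB : uniq B.
Hypothesis BP : forall p, p \in B -> [/\ prime p, (N < p)%N & p = g %[mod q]].
Definition bsum : R := \sum_(p <- B) p%:R^-1.
Local Notation S := bsum.
Hypothesis S1 : 1 <= S.

Definition vB (n : nat) : nat := tadd (fun p => (p \in B) : nat) n.
(** Primes of [B] receive the common value [S^-1], so that the weights [p^-1 * S^-1] sum to 1 over
    [B]. Other primes receive [p^-s], which turns the sum over [vB n = 0] into a piece of a
    Dirichlet series at [s + 1]. *)
Definition psi1 (n : nat) : R := cmul (fun p => if p \in B then S^-1 else (p%:R ^+ s)^-1) n.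

Definition periodic (f : nat -> R) := forall m n, m = n %[mod q] -> f m = f n.
Definition bounded (f : nat -> R) := forall n, `|f n| <= C.

(** The coefficient of [y ^ k] once every prime of [B] carries an extra factor [y]. *)
Definition Asum (f : nat -> R) (k X : nat) : R :=
  \sum_(1 <= n < X.+1 | vB n == k) f n / n%:R * psi1 n.

Lemma S0 : 0 < S. Proof. exact: lt_le_trans S1. Qed.

Lemma psi1_ge0 n : 0 <= psi1 n.
Proof.
apply: prodr_ge0 => p _; rewrite exprn_ge0 //.
by case: ifP => _; rewrite invr_ge0 ?exprn_ge0 // ltW // S0.
Qed.

Lemma cmult_psi1 : cmultiplicative psi1. Proof. exact: cmulP. Qed.

Lemma cmult_pow (k : nat) : cmultiplicative (fun n => (n%:R ^+ k)^-1 : R).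
Proof. by split=> [|m n _ _]; rewrite ?expr1n ?invr1 // natrM exprMn invfM. Qed.

Lemma vB0 n : (0 < n)%N -> (vB n == 0%N) = all (fun p => ~~ (p %| n)%N) B.
Proof.
move=> n0; apply/idP/allP => [/eqP v0 p pB|h].
  apply/negP => pn; have [pp _ _] := BP pB; have p0 := prime_gt0 pp.
  have q1 : (0 < n %/ p)%N by rewrite divn_gt0 // dvdn_leq.
  move: v0; rewrite /vB -(divnK pn) taddM //.
  by rewrite [X in (_ + X)%N](tadd_prime _ pp) pB addn1.
rewrite /vB /tadd big_nat_cond big1 // => p /andP[/andP[_ pn] _].
case: (boolP (p \in B)) => pB; last by rewrite muln0.
have [pp _ _] := BP pB; have := h p pB.
by rewrite lognE pp n0 /= => /negbTE ->.
Qed.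

Lemma psi1_coprime n : (0 < n)%N -> vB n == 0%N -> psi1 n = (n%:R ^+ s)^-1.
Proof.
move=> n0; rewrite vB0 // => /allP h.
apply: (cmult_eq cmult_psi1 (cmult_pow s)) => // p pp pn.
by rewrite /psi1 cmul_prime //; case: ifP => // /h; rewrite pn.
Qed.

Lemma vB_logn n : (0 < n)%N -> vB n = (\sum_(p <- B) logn p n)%N.
Proof.
move=> n0; pose M := (n + \max_(p <- B) p).+1.
rewrite /vB (@tadd_widen _ n M) ?ltnS ?leq_addr //.
transitivity (\sum_(p <- [seq p <- index_iota 0 M | p \in B]) logn p n)%N.
  rewrite big_filter [RHS]big_mkcond; apply: eq_bigr => p _.
  by case: ifP; rewrite ?muln1 ?muln0.
apply: perm_big; apply: uniq_perm; rewrite ?filter_uniq ?iota_uniq // => p.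
rewrite mem_filter mem_index_iota; case: (boolP (p \in B)) => //= pB.
rewrite ltnS (leq_trans _ (leq_addl _ _)) //.
exact: (@leq_bigmax_seq _ _ xpredT (fun x : nat => x)).
Qed.

Lemma vB_mul p i m : p \in B -> (0 < m)%N -> vB (p ^ i * m) = (i + vB m)%N.
Proof.
move=> pB m0; have [pp _ _] := BP pB; have p0 := prime_gt0 pp.
have pi0 j : (0 < p ^ j)%N by rewrite expn_gt0 p0.
rewrite /vB taddM //; congr addn.
elim: i => [|i IH]; first by rewrite expn0 tadd1.
by rewrite expnS taddM // IH (tadd_prime _ pp) pB.
Qed.

Lemma psi1_mul p i m : p \in B -> (0 < m)%N -> psi1 (p ^ i * m)%N = S^-1 ^+ i * psi1 m.
Proof.
move=> pB m0; have [pp _ _] := BP pB; have [_ pM] := cmult_psi1.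
have p0 := prime_gt0 pp.
rewrite pM ?expn_gt0 ?p0 // (cmultX i cmult_psi1 p0).
by rewrite /psi1 (cmul_prime _ pp) pB.
Qed.

(** Count [k = vB n] as the number of pairs [(p, i)] with [1 <= i] and [p ^ i] dividing [n], then
    write [n = p ^ i * m]. By periodicity [f] sees [g ^ i] in place of [p ^ i]. *)
Lemma Asum_rec f k X : periodic f ->
  k%:R * Asum f k X = \sum_(1 <= i < k.+1) \sum_(p <- B)
    (p%:R^-1 * S^-1) ^+ i * Asum (fun m => f (g ^ i * m)%N) (k - i) (X %/ p ^ i).
Proof.
move=> pf; pose t n := f n / n%:R * psi1 n.
have vE n : (0 < n)%N -> vB n = k ->
  k%:R = \sum_(1 <= i < k.+1) \sum_(p <- B) ((p ^ i %| n)%N : nat)%:R :> R.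
  move=> n0 vk; rewrite exchange_big /= -{1}vk (vB_logn n0) natr_sum.
  rewrite big_seq [RHS]big_seq; apply: eq_bigr => p pB; have [pp _ _] := BP pB.
  rewrite -natr_sum; congr _%:R; rewrite -[LHS](@sum_leq_nat k).
    by apply: eq_bigr => i _; rewrite pfactor_dvdn.
  rewrite -vk (vB_logn n0) (bigD1_seq p) //=; exact: leq_addr.
transitivity (\sum_(1 <= n < X.+1 | vB n == k) (\sum_(1 <= i < k.+1) \sum_(p <- B) ((p ^ i %| n)%N : nat)%:R) * t n).
  rewrite /Asum mulr_sumr big_nat_cond [RHS]big_nat_cond; apply: eq_bigr => n.
  by move=> /andP[/andP[n0 _] /eqP vk]; rewrite -(vE n n0 vk).
under eq_bigr do rewrite mulr_suml.
rewrite exchange_big /=; apply: eq_big_nat => i /andP[i1 ik].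
under eq_bigr do rewrite mulr_suml.
rewrite exchange_big /= big_seq [RHS]big_seq; apply: eq_bigr => p pB.
have [pp _ pg] := BP pB; have p0 := prime_gt0 pp.
transitivity (\sum_(1 <= n < X.+1 | (p ^ i %| n)%N) if vB n == k then t n else 0).
  rewrite big_mkcond [RHS]big_mkcond; apply: eq_bigr => n _.
  by case: ifP => _; case: ifP => _; rewrite /= ?mul1r ?mul0r.
rewrite sum_multiples_div ?expn_gt0 ?p0 // /Asum mulr_sumr [RHS]big_mkcond.
apply: eq_big_nat => m /andP[m0 _]; rewrite vB_mul // -(eqn_add2l i (vB m)) subnKC //.
case: ifP => // _; rewrite /t psi1_mul // natrM natrX.
have -> : f (p ^ i * m)%N = f (g ^ i * m)%N.
  by apply: pf; rewrite -modnMml -modnXm pg modnXm modnMml.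
rewrite exprMn !exprVn invfM; ring.
Qed.

End Block.

Section BlockEstimates.
Variables (R : realType) (q g s N : nat) (B : seq nat) (C : R).
Local Notation CC := R[i].
Hypotheses (q0 : (0 < q)%N) (s0 : (0 < s)%N) (N0 : (0 < N)%N) (C0 : 0 <= C).
Hypothesis uB : uniq B.
Hypothesis BP : forall p, p \in B -> [/\ prime p, (N < p)%N & p = g %[mod q]].
Local Notation S := (bsum R B).
Hypothesis S1 : 1 <= S.
Local Notation vB := (vB B).
Local Notation psi1 := (psi1 R s B).
Local Notation Asum := (@Asum R s B).

Let S0' : 0 < S := S0 S1.
Let p0 p : p \in B -> (0 < p)%N. Proof. by case/BP => /prime_gt0. Qed.

Lemma sum_weights : \sum_(p <- B) p%:R^-1 * S^-1 = 1 :> R.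
Proof. by rewrite -mulr_suml divff // gt_eqF. Qed.

Lemma weight_le p : p \in B -> 0 <= p%:R^-1 * S^-1 :> R /\ p%:R^-1 * S^-1 <= N%:R^-1 :> R.
Proof.
move=> pB; have [pp Np _] := BP pB; have p1 := p0 pB.
split; first by rewrite mulr_ge0 // ?invr_ge0 // ltW.
rewrite -[leRHS]mulr1 ler_pM ?invr_ge0 ?ler0n ?(ltW S0') //.
  by rewrite lef_pV2 ?posrE ?ltr0n // ler_nat ltnW.
by rewrite invf_le1.
Qed.

Lemma N1 : N%:R^-1 <= 1 :> R. Proof. by rewrite invf_le1 ?ltr0n ?ler1n. Qed.

Lemma weight_pow p i : p \in B -> (0 < i)%N ->
  (p%:R^-1 * S^-1) ^+ i <= p%:R^-1 * S^-1 :> R.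
Proof.
move=> pB; case: i => // i _; have [w0 w1] := weight_le pB.
by rewrite exprS ler_piMr // exprn_ile1 // (le_trans w1 N1).
Qed.

Lemma coprime_sum_le X : \sum_(1 <= n < X | vB n == 0%N) n%:R^-1 * psi1 n <= 2 :> R.
Proof.
apply: (@le_trans _ _ (\sum_(1 <= n < X) (n%:R ^+ 2)^-1)); last first.
  by have := @sum_inv_sqr_tail R 1 X isT; rewrite divr1.
rewrite big_mkcond; apply: ler_sum_nat => n /andP[n0 _].
case: ifP => v; last by rewrite invr_ge0 exprn_ge0.
rewrite (psi1_coprime R s BP) // -invfM -exprS lef_pV2 ?posrE ?exprn_gt0 ?ltr0n //.
by rewrite ler_weXn2l ?ler1n.
Qed.

(** Induction through [Asum_rec]: each of the [k] inner sums is an average of total weight at most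
    1. The bound depends neither on [k] nor on the block. *)
Lemma Tsum_le k X : Asum (fun=> 1) k X <= 2.
Proof.
elim/ltn_ind: k X => -[_ X|k IH X].
  rewrite /Asum; apply: le_trans (coprime_sum_le X.+1).
  by rewrite le_eqVlt; apply/orP; left; apply/eqP; apply: eq_bigr => n _; rewrite mul1r.
have k0 : 0 < k.+1%:R :> R by rewrite ltr0n.
rewrite -(ler_pM2l k0) (Asum_rec s uB BP) //.
apply: (@le_trans _ _ (\sum_(1 <= i < k.+2) 2)); last first.
  by rewrite sumr_const_nat subn1 /= -[leLHS]mulr_natl.
apply: ler_sum_nat => i /andP[i1 ik].
apply: (@le_trans _ _ (\sum_(p <- B) p%:R^-1 * S^-1 * 2)); last first.
  by rewrite -mulr_suml sum_weights mul1r.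
rewrite big_seq [leRHS]big_seq; apply: ler_sum => p pB.
have [w0 w1] := weight_le pB.
apply: ler_pM => //; first exact: exprn_ge0.
- apply: sumr_ge0 => n _; rewrite mul1r mulr_ge0 ?invr_ge0 ?ler0n //; exact: psi1_ge0.
- exact: weight_pow.
by apply: IH; lia.
Qed.

Lemma Asum_le f k X : bounded C f -> `|Asum f k X| <= C * 2.
Proof.
move=> fC; apply: (le_trans (ler_norm_sum _ _ _)).
apply: le_trans (ler_wpM2l C0 (Tsum_le k X)); rewrite /Asum mulr_sumr.
apply: ler_sum => n _; have h : 0 <= psi1 n := psi1_ge0 s S1 n.
rewrite mul1r !normrM (ger0_norm h) mulrA ler_wpM2r //.
by rewrite [`|_^-1|]ger0_norm ?invr_ge0 // ler_wpM2r ?invr_ge0.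
Qed.

Lemma Asum_limit f c k : periodic q f -> bounded C f ->
  (forall X, (0 < X)%N -> `|\sum_(1 <= n < X) f (g ^ k * n)%N / n%:R ^+ s.+1 - c| <= 2 * C / X%:R) ->
  exists X0, forall X, (X0 <= X)%N ->
    `|k`!%:R * Asum f k X - c| <= (k`!%:R * (4 * k.+1%:R)) * (C / N%:R).
Proof.
elim: k f => [|k IH] f pf fC hc.
  exists N => X NX; rewrite fact0 mul1r mul1r mulr1.
  have := hc X.+1 isT; rewrite expn0; under eq_bigr do rewrite mul1n.
  have E : \sum_(1 <= n < X.+1) f n / n%:R ^+ s.+1 - Asum f 0 X =
    \sum_(N <= n < X.+1 | vB n != 0%N) f n / n%:R ^+ s.+1.
    rewrite (bigID (fun n => vB n == 0%N)) /= /Asum.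
    rewrite (_ : \sum_(1 <= n < X.+1 | vB n == 0%N) f n / n%:R ^+ s.+1 =
      \sum_(1 <= n < X.+1 | vB n == 0%N) f n / n%:R * psi1 n); last first.
      rewrite big_nat_cond [RHS]big_nat_cond; apply: eq_bigr => n /andP[/andP[n0 _] v].
      by rewrite (psi1_coprime R s BP) // -mulrA -invfM -exprS.
    rewrite addrAC subrr add0r (big_cat_nat (n := N)) ?(leq_trans NX) //=.
    rewrite [X in X + _]big_nat_cond big1 ?add0r // => n /andP[/andP[n0 nN] v].
    move: v; rewrite (vB0 BP) //.
    case/allPn => p pB; rewrite negbK => /dvdn_leq h.
    have [_ Np _] := BP pB.
    by have := h n0; move: nN Np; lia.
  have h1 : `|\sum_(1 <= n < X.+1) f n / n%:R ^+ s.+1 - Asum f 0 X| <= C * (2 / N%:R).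
    rewrite E; apply: (le_trans (ler_norm_sum _ _ _)).
    apply: le_trans (ler_wpM2l C0 (sum_inv_sqr_tail R X.+1 N0)).
    rewrite mulr_sumr big_mkcond; apply: ler_sum_nat => n /andP[Nn _].
    have n0 : (0 < n)%N := leq_trans N0 Nn.
    case: ifP => _; last by rewrite mulr_ge0 ?invr_ge0 ?exprn_ge0.
    rewrite normrM ler_pM // ger0_norm ?invr_ge0 ?exprn_ge0 //.
    by rewrite lef_pV2 ?posrE ?exprn_gt0 ?ltr0n // ler_weXn2l ?ler1n.
  have h3 : 2 * C / X.+1%:R <= 2 * C / N%:R.
    by rewrite ler_wpM2l ?mulr_ge0 // lef_pV2 ?posrE ?ltr0n // ler_nat ltnW.
  move: h1 h3; set u := \sum_(1 <= n < X.+1) _; set v := Asum f 0 X => h1 h3 h2.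
  have -> : v - c = (u - c) - (u - v) by ring.
  apply: (le_trans (ler_normB _ _)); apply: (le_trans (lerD h2 h1)).
  rewrite (_ : C * (2 / N%:R) = 2 * (C / N%:R)); last by ring.
  move: h3; rewrite (_ : 2 * C / N%:R = 2 * (C / N%:R)); last by ring.
  by move: (2 * C / X.+1%:R) (C / N%:R) => a b; lra.
have pf' : periodic q (fun m => f (g * m)%N).
  by move=> m n mn; apply: pf; rewrite -modnMmr mn modnMmr.
have fC' : bounded C (fun m => f (g * m)%N) by move=> m; exact: fC.
have [|X0 hX] := IH (fun m => f (g * m)%N) pf' fC'.
  move=> X X0; have := hc X X0; congr (`|_ - _| <= _).
  by apply: eq_bigr => n _; rewrite expnS mulnA.
pose Pm := (\max_(p <- B) p)%N.
exists (X0 * Pm)%N => X hXX.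
have k0 : (0 < k.+1)%N by [].
have -> : (k.+1)`!%:R * Asum f k.+1 X - c =
  \sum_(p <- B) p%:R^-1 * S^-1 * (k`!%:R * Asum (fun m => f (g * m)%N) k (X %/ p) - c) +
  k`!%:R * \sum_(2 <= i < k.+2) \sum_(p <- B)
    (p%:R^-1 * S^-1) ^+ i * Asum (fun m => f (g ^ i * m)%N) (k.+1 - i) (X %/ p ^ i).
  rewrite factS natrM -mulrA mulrCA (Asum_rec s uB BP) // big_ltn // mulrDr addrAC.
  congr (_ + _); under [RHS]eq_bigr do rewrite mulrBr.
  rewrite sumrB -mulr_suml sum_weights mul1r; congr (_ - _).
  rewrite mulr_sumr; apply: eq_bigr => p _; rewrite mulrCA expr1 expn1 subn1 /= mulrA.
  by rewrite expn1.
have T1 : `|\sum_(p <- B) p%:R^-1 * S^-1 * (k`!%:R * Asum (fun m => f (g * m)%N) k (X %/ p) - c)| <=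
   (k`!%:R * (4 * k.+1%:R)) * (C / N%:R).
  apply: (le_trans (ler_norm_sum _ _ _)).
  rewrite -[leRHS]mul1r -[X in _ <= X * _]sum_weights mulr_suml big_seq [leRHS]big_seq; apply: ler_sum => p pB.
  have [w0 _] := weight_le pB; rewrite normrM (ger0_norm w0) ler_wpM2l // hX //.
  rewrite leq_divRL ?p0 //; apply: leq_trans hXX; rewrite leq_mul2l.
  by rewrite (@leq_bigmax_seq _ _ xpredT (fun x : nat => x)) ?orbT.
have T2 : `|\sum_(2 <= i < k.+2) \sum_(p <- B)
    (p%:R^-1 * S^-1) ^+ i * Asum (fun m => f (g ^ i * m)%N) (k.+1 - i) (X %/ p ^ i)| <=
    k%:R * (2 * (C / N%:R)).
  apply: (le_trans (ler_norm_sum _ _ _)).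
  apply: (@le_trans _ _ (\sum_(2 <= i < k.+2) (2 * (C / N%:R)))); last first.
    by rewrite sumr_const_nat -[leLHS]mulr_natl !subSS subn0.
  apply: ler_sum_nat => i /andP[i2 _]; apply: (le_trans (ler_norm_sum _ _ _)).
  rewrite -[leRHS]mul1r -[X in _ <= X * _]sum_weights mulr_suml big_seq [leRHS]big_seq; apply: ler_sum => p pB.
  have [w0 w1] := weight_le pB; rewrite normrM ger0_norm ?exprn_ge0 //.
  have hA : `|Asum (fun m => f (g ^ i * m)%N) (k.+1 - i) (X %/ p ^ i)| <= C * 2.
    by apply: Asum_le => m; exact: fC.
  have i1 : (0 < i.-1)%N by rewrite -subn1 subn_gt0.
  rewrite -[X in _ ^+ X * _](prednK (ltnW i2)) exprS -mulrA.
  apply: ler_wpM2l => //.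
  have -> : 2 * (C / N%:R) = N%:R^-1 * (C * 2) by ring.
  apply: ler_pM => //; first exact: exprn_ge0.
  exact: le_trans (weight_pow pB i1) w1.
apply: (le_trans (ler_normD _ _)); rewrite normrM ger0_norm //.
have kf : 0 <= k`!%:R :> R by exact: ler0n.
have T3 := ler_wpM2l kf T2.
apply: (le_trans (lerD T1 T3)).
have CN : 0 <= C / N%:R by rewrite divr_ge0.
rewrite factS natrM -!(natr1 k.+1) -!(natr1 k); have : 0 <= k%:R :> R by [].
move: (k%:R : R) (k`!%:R : R) (C / N%:R) kf CN => x y z y0 z0 x0.
have : 0 <= y * z by rewrite mulr_ge0.
have : 0 <= x * (y * z) by rewrite !mulr_ge0.
have : 0 <= x * x * (y * z) by rewrite !mulr_ge0.
nra.
Qed.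

Definition psi (y : CC) (n : nat) : CC := y ^+ vB n * (psi1 n)%:C%C.

Lemma cmult_psi y : cmultiplicative (psi y).
Proof.
apply: cmultM; first exact: cmult_expr.
apply: (cmult_comp (h := real_complex R)); [exact: rmorph1 | exact: rmorphM | exact: cmult_psi1].
Qed.

Lemma nm_psi y n : nm (psi y n) = nm y ^+ vB n * psi1 n.
Proof. by rewrite nmM nmX nm_real ger0_norm // psi1_ge0. Qed.

Lemma cmult_nm (u : nat -> CC) : cmultiplicative u -> cmultiplicative (fun n => nm (u n)).
Proof. by move=> [u1 uM]; split=> [|m n m0 n0]; rewrite ?u1 ?nm1 ?uM ?nmM. Qed.

Lemma nm_psi_prime y p : nm y <= S / 2 -> prime p -> nm (psi y p) <= 2^-1.
Proof.
move=> yS pp; rewrite nm_psi /vB (tadd_prime _ pp) /psi1 (cmul_prime _ pp).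
case: ifP => _ /=; first by rewrite expr1 ler_pdivrMr // mulrC.
rewrite expr0 mul1r lef_pV2 ?posrE ?exprn_gt0 ?ltr0n ?prime_gt0 //.
have p2 : 2 <= p%:R :> R by rewrite ler_nat prime_gt1.
by apply: (le_trans p2); rewrite -[leLHS]expr1 ler_weXn2l // (le_trans _ p2) // ler1n.
Qed.

Lemma prod_inv_le (x : nat -> R) : (forall p, p \in B -> 0 <= x p <= 2^-1) ->
  0 <= \prod_(p <- B) (1 - x p)^-1 <= expR (2 * \sum_(p <- B) x p).
Proof.
move=> hx; rewrite mulr_sumr expR_sum big_seq [X in _ <= _ <= X]big_seq.
apply/andP; split.
  apply: prodr_ge0 => p /hx /andP[x0 x1].
  by rewrite invr_ge0 subr_ge0 (le_trans x1) // invf_le1 // ler1n.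
apply: ler_prod => p /hx /andP[x0 x1]; have h1 : 0 < 1 - x p.
  by rewrite subr_gt0 (le_lt_trans x1) // invf_lt1 // ltr1n.
rewrite invr_ge0 (ltW h1) /= -div1r ler_pdivrMr //.
have e1 := expR_ge1Dx (2 * x p).
apply: (@le_trans _ _ ((1 + 2 * x p) * (1 - x p))); last by rewrite ler_wpM2r // ltW.
have : x p * 2 <= 1 by rewrite -ler_pdivlMr // mul1r.
by nra.
Qed.

Lemma sum_coprime (F : nat -> R) M :
  \sum_(1 <= n < M | all (fun p => ~~ (p %| n)%N) B) F n =
  \sum_(1 <= n < M | vB n == 0%N) F n.
Proof.
rewrite big_nat_cond [RHS]big_nat_cond; apply: eq_bigl => n.
by case: (ltnP 0 n) => //= n0; rewrite (vB0 BP n0).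
Qed.

Lemma adm_psi y : nm y <= S / 2 -> adm (psi y) (expR (size B)%:R * 2).
Proof.
move=> yS; have cp := cmult_psi y; have cnp := cmult_nm cp.
have np p : prime p -> nm (psi y p) <= 2^-1 by exact: nm_psi_prime.
have np2 p : prime p -> nm (psi y p) ^+ 2 <= 2^-1.
  by move=> /np h; rewrite expr2 (le_trans _ h) // ler_piMl ?nm_ge0 // (le_trans h) // invf_le1 // ler1n.
split=> // [n n0|M].
  have c1 : cmultiplicative (fun=> 1 : R) by split=> // *; rewrite mulr1.
  have [//|_ ->//] := cmult_le cnp c1 _ n0 => p pp; split; first exact: nm_ge0.
  by rewrite (le_trans (np p pp)) // invf_le1 // ler1n.
have c2 : cmultiplicative (fun n => nm (psi y n) ^+ 2).
  by have := cmultM cnp cnp; under eq_fun do rewrite -expr2.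
have hB p : p \in B -> 0 <= nm (psi y p) ^+ 2 <= 2^-1.
  by move=> /BP[pp _ _]; rewrite sqr_ge0 np2.
apply: (le_trans (@sum_peel _ _ B M c2 _ _)) => [n _|p pB|].
- exact: sqr_ge0.
- have [pp _ _] := BP pB; split=> //; apply: (le_lt_trans (np2 p pp)).
  by rewrite invf_lt1 // ltr1n.
have /andP[P0 P1] := prod_inv_le hB.
apply: ler_pM => //.
- by apply: sumr_ge0 => n _; exact: sqr_ge0.
- apply: (le_trans P1); rewrite ler_expR -sum1_size natr_sum mulr_sumr big_seq [leRHS]big_seq.
  by apply: ler_sum => p pB; have [pp _ _] := BP pB; rewrite -ler_pdivlMl // mulr1 np2.
rewrite sum_coprime; apply: le_trans (coprime_sum_le M).
rewrite big_nat_cond [leRHS]big_nat_cond; apply: ler_sum => n /andP[/andP[n0 _] v].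
rewrite nm_psi (eqP v) expr0 mul1r (psi1_coprime R s BP n0 v) expr2 ler_wpM2r ?invr_ge0 ?exprn_ge0 //.
rewrite lef_pV2 ?posrE ?exprn_gt0 ?ltr0n //.
by rewrite -[leLHS]expr1 ler_weXn2l // ler1n.
Qed.

(** Unlike the bound of [adm_psi], this one involves [B] only through [S]. Its logarithm is linear
    in [S], which the powers [(S / 2) ^+ i.+1] with [i >= 1] outgrow. *)
Lemma ev_psi_le f X y : bounded C f -> nm y <= S / 2 ->
  nm (ev (psi y) X (fun n => f n / n%:R)) <= C * (expR S * 2).
Proof.
move=> fC yS; have cnp := cmult_nm (cmult_psi y).
pose th n := nm (psi y n) / n%:R.
have cth : cmultiplicative th.
  by have := cmultM cnp (cmult_pow R 1); under eq_fun do rewrite expr1.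
apply: (@le_trans _ _ (\sum_(1 <= n < X) C * th n)).
  apply: (le_trans (nm_sum _ _ _)); apply: ler_sum => n _.
  rewrite nmM nm_real normrM [`|_^-1|]ger0_norm ?invr_ge0 // mulrAC -mulrA /th.
  by rewrite ler_wpM2r ?divr_ge0 ?nm_ge0.
rewrite -mulr_sumr ler_wpM2l //.
have hB p : p \in B -> 0 <= th p <= 2^-1 /\ 2 * th p <= p%:R^-1.
  move=> pB; have [pp _ _] := BP pB; have p1 : 1 <= p%:R :> R by rewrite ler1n prime_gt0.
  have h := nm_psi_prime yS pp; have pv : p%:R^-1 <= 1 :> R by rewrite invf_le1 // (lt_le_trans _ p1).
  have pv0 : 0 <= p%:R^-1 :> R by rewrite invr_ge0.
  rewrite /th; have := nm_ge0 (psi y p); move: pv pv0 h.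
  have : 2 * 2^-1 = 1 :> R by rewrite divff.
  move: (2^-1 : R) (p%:R^-1 : R) (nm _) => h2 a b e2 a1 a0 bh b0.
  by split; [apply/andP; split; nra | nra].
apply: (le_trans (@sum_peel _ _ B X cth _ _)) => [n _|p pB|].
- by rewrite /th divr_ge0 ?nm_ge0.
- have [pp _ _] := BP pB; split=> //; have [/andP[_ h] _] := hB p pB; apply: (le_lt_trans h).
  by rewrite invf_lt1 // ltr1n.
have /andP[P0 P1] := prod_inv_le (fun p pB => (hB p pB).1).
apply: ler_pM => //.
- by apply: sumr_ge0 => n _; rewrite /th divr_ge0 ?nm_ge0.
- apply: (le_trans P1); rewrite ler_expR mulr_sumr /bsum big_seq [leRHS]big_seq.
  by apply: ler_sum => p pB; have [_] := hB p pB.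
rewrite sum_coprime; apply: le_trans (coprime_sum_le X).
apply: ler_sum => n v.
by rewrite /th nm_psi (eqP v) expr0 mul1r mulrC.
Qed.

Definition Bpoly f X : {poly CC} :=
  \sum_(1 <= n < X) (f n / n%:R * psi1 n)%:C%C%:P * 'X ^+ vB n.

Lemma Bpoly_horner f X y : (Bpoly f X).[y] = ev (psi y) X (fun n => f n / n%:R).
Proof.
rewrite /Bpoly horner_sum; apply: eq_bigr => n _.
by rewrite hornerCM hornerXn /psi !rmorphM /=; ring.
Qed.

Lemma Bpoly_coef f X k : (Bpoly f X.+1)`_k = (Asum f k X)%:C%C.
Proof.
rewrite /Bpoly coef_sum /Asum rmorph_sum /= [RHS]big_mkcond; apply: eq_bigr => n _.
by rewrite coefCM coefXn eq_sym; case: eqP => _; rewrite ?mulr1 ?mulr0.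
Qed.

(** Newton's identity for [Bpoly], which cyclicity keeps free of zeros on the disc of radius
    [S / 2]. The first power sum is minus the ratio of [Asum f 1 X] to [Asum f 0 X] and gives the
    main term; the higher ones are bounded by [newton_bound]. *)
Lemma block_recurrence f : bounded C f -> cl (fun n => f n / n%:R) (@delta1 R) ->
  exists X0, forall X, (X0 <= X)%N -> Asum f 0 X != 0 /\
  forall k, `|k.+1%:R * Asum f k.+1 X * Asum f 0 X - Asum f 1 X * Asum f k X| <=
    C * 2 * (C * 2) * \sum_(1 <= i < k.+1)
      (2 * i.+1%:R * (S + ln (2 * C / `|Asum f 0 X|)) / (S / 2) ^+ i.+1).
Proof.
move=> fC cb.
have P0 : 0 < expR (size B)%:R * 2 :> R by rewrite mulr_gt0 ?expR_gt0.
have [d d0 [X0 hX]] := cyclic_nonvanishing cb (tail0_bounded fC) P0.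
exists X0 => X XX; have XX1 : (X0 <= X.+1)%N by exact: leqW.
have nz y : nm y <= S / 2 -> (Bpoly f X.+1).[y] != 0.
  move=> yS; rewrite Bpoly_horner -nm_gt0; apply: (lt_le_trans d0).
  by apply: hX => //; exact: adm_psi.
have S20 : 0 < S / 2 by rewrite divr_gt0.
have A0 : (Bpoly f X.+1)`_0 != 0 by rewrite -horner_coef0 nz // nm0 ltW.
have A0' : Asum f 0 X != 0.
  by move: A0; rewrite Bpoly_coef -nm_eq0 nm_real normr_eq0.
have nA : 0 < `|Asum f 0 X| by rewrite normr_gt0.
split=> // k.
have [|pi_ [rec bd]] := @newton_bound _ (Bpoly f X.+1) (S / 2) (C * (expR S * 2) / `|Asum f 0 X|) S20 A0 nz.
  move=> y yS; rewrite Bpoly_horner Bpoly_coef nm_real divfK ?gt_eqF //.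
  by apply: ev_psi_le => //; rewrite yS.
have C0' : 0 < C.
  have := Asum_le 0 X fC; rewrite -(ler_pdivrMr _ _ (ltr0n _ 2)).
  by apply: lt_le_trans; rewrite divr_gt0.
have lnE : ln (C * (expR S * 2) / `|Asum f 0 X|) = S + ln (2 * C / `|Asum f 0 X|).
  rewrite -[S in RHS]expRK -lnM ?posrE ?expR_gt0 ?divr_gt0 ?mulr_gt0 //.
  by congr ln; ring.
have rec0 := rec 0%N; rewrite big_nat1 subnn mul1r in rec0.
have := rec k; rewrite big_nat_recl // subn0 => recE.
set T := \sum_(0 <= i < k) _ in recE.
have E : (k.+1%:R * Asum f k.+1 X * Asum f 0 X - Asum f 1 X * Asum f k X)%:C%C =
  - (T * (Asum f 0 X)%:C%C).
  rewrite !Bpoly_coef in rec0 recE.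
  by rewrite rmorphB !rmorphM /= (rmorph_nat (real_complex R)) recE rec0; ring.
rewrite -[leLHS]nm_real E nmN nmM nm_real.
have As := Asum_le 0 X fC.
rewrite -mulrA mulrC; apply: ler_pM => //; first exact: nm_ge0.
apply: (le_trans (nm_sum _ _ _)).
rewrite mulr_sumr [leRHS](big_addn 0 _ 1) subn1 /=.
apply: ler_sum => i _; rewrite nmM mulrC Bpoly_coef nm_real addn1.
apply: ler_pM => //; first exact: nm_ge0.
  exact: Asum_le.
by rewrite ler_pdivlMr ?exprn_gt0 // -lnE.
Qed.

End BlockEstimates.

(** * Periodic cyclic sequences transform by a sign under units *)

Section ClassSign.
Variables (R : realType).

Lemma mul_eq_of_approx (x y z w eta0 : R) : 0 < eta0 ->
  (forall eta, 0 < eta -> eta <= eta0 -> exists a b d e,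
    [/\ `|a - x| <= eta, `|b - y| <= eta, `|d - z| <= eta, `|e - w| <= eta &
        `|a * b - d * e| <= eta]) -> x * y = z * w.
Proof.
move=> eta00 h; apply/eqP; rewrite -subr_eq0 -normr_le0; apply/ler_addgt0Pr => e e0.
rewrite add0r; pose M := 3 + `|x| + `|y| + `|z| + `|w|.
have M0 : 0 < M by rewrite /M -!addrA ltr_wpDr // !addr_ge0.
pose eta := Num.min (Num.min eta0 1) (e / M).
have eta_gt0 : 0 < eta by rewrite !lt_min eta00 ltr01 divr_gt0.
have eta_le0 : eta <= eta0 by rewrite !ge_min lexx.
have eta_le1 : eta <= 1 by rewrite !ge_min lexx orbT.
have eta_leM : eta * M <= e by rewrite -ler_pdivlMr // ge_min lexx orbT.
have [a [b [d [c [ha hb hd hc hab]]]]] := h eta eta_gt0 eta_le0.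
have b1 : `|b| <= `|y| + 1.
  by rewrite -[b](subrK y) (le_trans (ler_normD _ _)) // addrC lerD2l (le_trans hb).
have d1 : `|d| <= `|z| + 1.
  by rewrite -[d](subrK z) (le_trans (ler_normD _ _)) // addrC lerD2l (le_trans hd).
have -> : x * y - z * w = (a * b - d * c) - ((a - x) * b + x * (b - y)) + (d * (c - w) + (d - z) * w) by ring.
apply: (le_trans (ler_normD _ _)); apply: (le_trans (lerD (ler_normB _ _) (ler_normD _ _))).
apply: (@le_trans _ _ (eta + (eta * (`|y| + 1) + `|x| * eta) + ((`|z| + 1) * eta + eta * `|w|))).
  rewrite !lerD // ?(le_trans (ler_normD _ _)) // ?lerD // normrM ler_pM //.
by apply: le_trans eta_leM; rewrite /M; lra.
Qed.

Lemma sum_pow_tail (d : nat -> R) (K : R) n X s :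
  (forall n, `|d n| <= K) ->
  `|\sum_(n.+1 <= i < X) d i / i%:R ^+ s.+2| <= K * ((n.+1%:R ^+ s)^-1 * 2).
Proof.
move=> dK; have K0 : 0 <= K by apply: le_trans (dK 0%N).
apply: (le_trans (ler_norm_sum _ _ _)).
apply: (@le_trans _ _ (K * ((n.+1%:R ^+ s)^-1 * \sum_(n.+1 <= i < X) (i%:R ^+ 2)^-1))).
  rewrite mulr_sumr mulr_sumr; apply: ler_sum_nat => i /andP[ni _].
  have i0 : 0 < i%:R :> R by rewrite ltr0n (leq_trans _ ni).
  have i2 : 0 < i%:R ^+ s.+2 :> R by rewrite exprn_gt0.
  rewrite normrM; apply: ler_pM => //.
  rewrite ger0_norm ?invr_ge0 ?(ltW i2) // -invfM lef_pV2 ?posrE //; last first.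
    by rewrite mulr_gt0 // exprn_gt0 // ltr0n.
  rewrite -[in leRHS](addn2 s) exprD; apply: ler_wpM2r; first exact: exprn_ge0.
  by rewrite lerXn2r ?nnegrE // ler_nat.
apply: ler_wpM2l => //; apply: ler_wpM2l; first by rewrite invr_ge0 exprn_ge0.
apply: (le_trans (sum_inv_sqr_tail R X (ltn0Sn n))).
by rewrite ler_piMr // invf_le1 // ler1n.
Qed.

(** For large exponents the first nonzero term dominates: the tail behind index [n] is smaller by a
    power of [n / (n + 1)]. *)
Lemma dirichlet_uniq (d : nat -> R) (K : R) (s0 : nat) :
  (forall n, `|d n| <= K) ->
  (forall s X, (s0 <= s)%N -> (0 < X)%N -> `|\sum_(1 <= n < X) d n / n%:R ^+ s.+1| <= 2 * K / X%:R) ->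
  forall n, (0 < n)%N -> d n = 0.
Proof.
move=> dK hs; elim/ltn_ind => n IH n0; apply/eqP; rewrite -normr_le0; apply/ler_addgt0Pr => e e0.
rewrite add0r; have K0 : 0 <= K by apply: le_trans (dK 0%N).
have n0' : 0 < n%:R :> R by rewrite ltr0n.
pose r : R := n%:R / n.+1%:R.
have r0 : 0 <= r by rewrite divr_ge0.
have r1 : r < 1 by rewrite ltr_pdivrMr ?ltr0n // mul1r ltr_nat.
have E0 : 0 < e / (4 * (K + 1) * n%:R ^+ 2).
  by rewrite divr_gt0 // !mulr_gt0 ?exprn_gt0 // ltr_wpDl.
have [N hN] := expr_small r0 r1 E0.
pose s := (s0 + N).+1.
apply/ler_addgt0Pr => e' e'0.
pose X := (n.+2 + Num.truncn (2 * K * n%:R ^+ s.+1 / e')).+1%N.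
have X0 : (0 < X)%N by [].
have sS : (s0 <= s)%N by rewrite /s leqW // leq_addr.
have := hs s X sS X0; have nX : (n < X)%N by rewrite /X; lia.
rewrite (big_cat_nat (n := n)) ?(ltnW nX) //= [X in X + _]big_nat_cond big1 ?add0r; last first.
  by move=> i /andP[/andP[i0 iN] _]; rewrite IH // mul0r.
rewrite big_ltn // => h1.
have pn : 0 < n%:R ^+ s.+1 :> R by rewrite exprn_gt0.
have h2 := @sum_pow_tail d K n X s.-1 dK; rewrite [s.-1.+1](_ : _ = s) // in h2.
have h3 : `|d n| / n%:R ^+ s.+1 <= 2 * K / X%:R + K * ((n.+1%:R ^+ s.-1)^-1 * 2).
  rewrite -[n%:R ^+ s.+1]gtr0_norm // -normf_div.
  move: h1 h2; set u := d n / _; set v := \sum_(_ <= _ < _) _ => h1 h2.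
  have -> : u = (u + v) - v by rewrite addrK.
  by apply: (le_trans (ler_normB _ _)); exact: lerD.
rewrite ler_pdivrMr // mulrDl in h3; apply: (le_trans h3).
rewrite addrC lerD //.
  have -> : K * ((n.+1%:R ^+ s.-1)^-1 * 2) * n%:R ^+ s.+1 = 2 * K * n%:R ^+ 2 * r ^+ s.-1.
    rewrite -[in LHS](addn2 s.-1) exprD.
    by rewrite /r exprMn exprVn; ring.
  have := hN s.-1 _; rewrite /s /= => /(_ (leq_addl _ _)) h.
  have a0 : 0 <= 2 * K * n%:R ^+ 2 by rewrite !mulr_ge0 // exprn_ge0.
  apply: (le_trans (ler_wpM2l a0 h)); rewrite -subr_ge0.
  have -> : e - 2 * K * n%:R ^+ 2 * (e / (4 * (K + 1) * n%:R ^+ 2)) = e * (K + 2) / (2 * (K + 1)).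
    by field; rewrite !gt_eqF // ?ltr_wpDl //; lra.
  by rewrite divr_ge0 ?mulr_ge0 ?addr_ge0 // ltW.
rewrite mulrAC ler_pdivrMr ?ltr0n // -ler_pdivrMl // mulrC ltW //.
apply: (lt_le_trans (truncnS_gt _)); by rewrite ler_nat /X ltnS leq_addl.
Qed.

Lemma sum_tail_first (d : nat -> R) (K c : R) s :
  (forall n, `|d n| <= K) -> (0 < s)%N ->
  (forall X, (0 < X)%N -> `|\sum_(1 <= n < X) d n / n%:R ^+ s.+1 - c| <= 2 * K / X%:R) ->
  `|c - d 1%N| <= 8 * K / 2 ^+ s.
Proof.
move=> dK s1 hc; have K0 : 0 <= K by apply: le_trans (dK 0%N).
apply/ler_addgt0Pr => e e0.
pose X := (2 + Num.truncn (2 * K / e)).+1%N.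
have := hc X isT; rewrite big_ltn // expr1n divr1 => h1.
have h2 := @sum_pow_tail d K 1 X s.-1 dK; rewrite (prednK s1) in h2.
move: h1 h2; set u := \sum_(_ <= _ < _) _ => h1 h2.
have -> : c - d 1%N = u - (d 1%N + u - c) by ring.
apply: (le_trans (ler_normB _ _)); apply: (le_trans (lerD h2 h1)); rewrite lerD //.
  have -> : 8 * K / 2 ^+ s = K * ((2 ^+ s.-1)^-1 * 4).
    by rewrite -{1}(prednK s1) exprS; field; rewrite expf_neq0.
  by rewrite ler_wpM2l // ler_wpM2l ?invr_ge0 ?exprn_ge0 // ler_nat.
rewrite ler_pdivrMr ?ltr0n // -ler_pdivrMl // mulrC ltW //.
apply: (lt_le_trans (truncnS_gt _)); by rewrite ler_nat /X ltnS leq_addl.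
Qed.

Lemma exists_ge5 a b c d e :
  exists n, [/\ (a <= n)%N, (b <= n)%N, (c <= n)%N, (d <= n)%N & (e <= n)%N].
Proof. by exists (a + b + c + d + e)%N; split; lia. Qed.

Variables (q g : nat) (f : nat -> R) (C : R).
Hypotheses (q0 : (0 < q)%N) (cg : coprime g q).
Hypothesis pf : forall m n, m = n %[mod q] -> f m = f n.
Hypothesis fC : forall n, `|f n| <= C.
Hypothesis cf : cl (fun n => f n / n%:R) (@delta1 R).
Hypothesis big : forall N (S : R), exists ps : seq nat,
    [/\ uniq ps, forall p, p \in ps -> [/\ prime p, (N < p)%N & p = g %[mod q]] &
     S <= \sum_(p <- ps) p%:R^-1].

Let C0 : 0 <= C. Proof. exact: le_trans (fC 0%N). Qed.

(** Choosing [N] and then [S] large in [block_recurrence] removes every power sum but the first.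
    This is the coefficient form of the limit being an exponential. *)
Lemma limit_recurrence s (c : nat -> R) : (0 < s)%N ->
  (forall k X, (0 < X)%N -> `|\sum_(1 <= n < X) f (g ^ k * n)%N / n%:R ^+ s.+1 - c k| <= 2 * C / X%:R) ->
  c 0%N != 0 -> forall k, c k.+1 * c 0%N = c 1%N * c k.
Proof.
move=> s0 hc c0 k; have nc0 : 0 < `|c 0%N| by rewrite normr_gt0.
apply: (@mul_eq_of_approx _ _ _ _ (`|c 0%N| / 2)); first by rewrite divr_gt0.
move=> eta eta0 etac.
pose W : R := (k.+1)`!%:R * (4 * k.+2%:R).
pose N := (Num.truncn (W * C / eta)).+1.
have N0 : (0 < N)%N by [].
have WN : W * (C / N%:R) <= eta.
  rewrite mulrA ler_pdivrMr ?ltr0n // -ler_pdivrMl // mulrC ltW //; exact: truncnS_gt.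
pose kap := ln (4 * C / `|c 0%N|).
(* The summands ensure in turn that [1 <= S / 2], that the logarithm is at most [S] (using that
   [Asum s B f 0 X] has at least half the modulus of [c 0]), and that the error is at most [eta]
   after multiplication by [k!]. *)
pose S0 := 2 + `|kap| + 64 * C ^+ 2 * (k.+1%:R * k%:R) * k`!%:R / eta.
have [B [uB BP SB]] := big N S0.
have S0_ge : 0 <= 64 * C ^+ 2 * (k.+1%:R * k%:R) * k`!%:R / eta.
  by rewrite divr_ge0 ?(ltW eta0) // !mulr_ge0 // sqr_ge0.
set S := \sum_(p <- B) p%:R^-1 in SB.
have S2 : 2 <= S by apply: le_trans SB; rewrite /S0 -addrA lerDl addr_ge0.
have S1 : 1 <= S by apply: le_trans S2; rewrite ler1n.
have Sk : kap <= S.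
  apply: le_trans SB; rewrite /S0; have := ler_norm kap; move: S0_ge.
  by set z := _ / eta => z0; lra.
have Ss : 64 * C ^+ 2 * (k.+1%:R * k%:R) * k`!%:R / eta <= S.
  apply: le_trans SB; rewrite /S0 lerDr addr_ge0 //.
have Al j : exists X0, forall X, (X0 <= X)%N ->
    `|j`!%:R * Asum s B f j X - c j| <= (j`!%:R * (4 * j.+1%:R)) * (C / N%:R).
  by apply: (@Asum_limit R q g s N B C) => //; exact: hc.
have [X0 h0] := Al 0%N; have [X1 h1] := Al 1%N; have [Xk hk] := Al k; have [Xk1 hk1] := Al k.+1.
have [Xr hr] := block_recurrence q0 s0 N0 C0 uB BP S1 fC cf.
have [X [x0 x1 xk xk1 xr]] := exists_ge5 X0 X1 Xk Xk1 Xr.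
have wj j : (j <= k.+1)%N -> (j`!%:R * (4 * j.+1%:R)) * (C / N%:R) <= eta.
  move=> jk; apply: le_trans WN; rewrite ler_wpM2r ?divr_ge0 // /W.
  rewrite ler_pM ?mulr_ge0 // ?ler_nat ?leq_fact //.
  by rewrite ler_wpM2l // ler_nat.
have {}h0 := le_trans (h0 X x0) (wj 0%N isT).
have {}h1 := le_trans (h1 X x1) (wj 1%N isT).
have {}hk := le_trans (hk X xk) (wj k (leqnSn k)).
have {}hk1 := le_trans (hk1 X xk1) (wj k.+1 (leqnn _)).
have [A0 rec] := hr X xr; rewrite mul1r in h0; rewrite mul1r in h1.
exists ((k.+1)`!%:R * Asum s B f k.+1 X), (Asum s B f 0 X), (Asum s B f 1 X), (k`!%:R * Asum s B f k X).
split=> //.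
have -> : (k.+1)`!%:R * Asum s B f k.+1 X * Asum s B f 0 X - Asum s B f 1 X * (k`!%:R * Asum s B f k X) =
  k`!%:R * (k.+1%:R * Asum s B f k.+1 X * Asum s B f 0 X - Asum s B f 1 X * Asum s B f k X).
  by rewrite factS natrM; ring.
have kf : 0 < k`!%:R :> R by rewrite ltr0n fact_gt0.
rewrite normrM gtr0_norm // -ler_pdivlMl //; apply: (le_trans (rec k)).
have nA : `|c 0%N| / 2 <= `|Asum s B f 0 X|.
  have := ler_distD (Asum s B f 0 X) (c 0%N) 0; rewrite !subr0 distrC.
  by move: h0 etac; set u := `|_ - _|; set v := `|Asum _ _ _ _ _| => h0 etac h; lra.
have C0' : 0 < C.
  rewrite lt_neqAle C0 andbT; apply/eqP => CE.
  have f0 n : f n = 0 by apply/eqP; rewrite -normr_le0 CE.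
  by move: A0; rewrite /Asum big1 ?eqxx // => n _; rewrite f0 !mul0r.
have nA0 : 0 < `|Asum s B f 0 X| by rewrite normr_gt0.
have lnA : ln (2 * C / `|Asum s B f 0 X|) <= S.
  apply: le_trans Sk; rewrite /kap ler_ln ?posrE ?divr_gt0 ?mulr_gt0 //.
  rewrite ler_pdivrMr // mulrAC ler_pdivlMr //.
  have := ler_wpM2l (ltW C0') nA; move: (`|c 0%N|) (`|Asum _ _ _ _ _|) => u v; nra.
have term i : (1 <= i < k.+1)%N -> 2 * i.+1%:R * (bsum R B + ln (2 * C / `|Asum s B f 0 X|)) / (bsum R B / 2) ^+ i.+1 <=
    16 * k.+1%:R / S.
  move=> /andP[i1 ik]; rewrite /bsum -/S.
  have S20 : 1 <= S / 2 by rewrite ler_pdivlMr // mul1r.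
  have p1 : (S / 2) ^+ 2 <= (S / 2) ^+ i.+1 by rewrite ler_weXn2l.
  have S3 : 0 < S by apply: lt_le_trans S1.
  have p0 : 0 < (S / 2) ^+ 2 by rewrite exprn_gt0 // divr_gt0.
  rewrite ler_pdivrMr ?(lt_le_trans p0) //.
  apply: (@le_trans _ _ (2 * k.+1%:R * (S + S))).
    apply: (@le_trans _ _ (2 * i.+1%:R * (S + S))).
      by rewrite ler_wpM2l ?mulr_ge0 // lerD2l.
    by rewrite ler_wpM2r ?addr_ge0 ?(ltW S3) // ler_wpM2l // ler_nat.
  have -> : 2 * k.+1%:R * (S + S) = 16 * k.+1%:R / S * (S / 2) ^+ 2.
    by field; rewrite gt_eqF.
  by rewrite ler_wpM2l // divr_ge0 ?mulr_ge0 // ltW.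
apply: (@le_trans _ _ (C * 2 * (C * 2) * \sum_(1 <= i < k.+1) (16 * k.+1%:R / S))).
  by rewrite ler_wpM2l ?mulr_ge0 //; apply: ler_sum_nat.
rewrite sumr_const_nat subn1 /= -[(_ / S) *+ k]mulr_natr.
have S3 : 0 < S by apply: lt_le_trans S1.
have -> : C * 2 * (C * 2) * (16 * k.+1%:R / S * k%:R) =
  (64 * C ^+ 2 * (k.+1%:R * k%:R) * k`!%:R / eta) / S * (k`!%:R^-1 * eta).
  by field; rewrite !gt_eqF.
rewrite -[leRHS]mul1r ler_wpM2r ?mulr_ge0 ?invr_ge0 ?(ltW eta0) //.
by rewrite ler_pdivrMr // mul1r.
Qed.

End ClassSign.

Section ClassMultiplier.
Variables (R : realType) (q g : nat) (f : nat -> R) (C : R).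
Hypotheses (q0 : (0 < q)%N) (cg : coprime g q).
Hypothesis pf : forall m n, m = n %[mod q] -> f m = f n.
Hypothesis fC : forall n, `|f n| <= C.
Hypothesis cf : cl (fun n => f n / n%:R) (@delta1 R).
Hypothesis big : forall N (S : R), exists ps : seq nat,
    [/\ uniq ps, forall p, p \in ps -> [/\ prime p, (N < p)%N & p = g %[mod q]] &
     S <= \sum_(p <- ps) p%:R^-1].

(** Evaluation at the completely multiplicative function that vanishes at every prime picks out the
    first coefficient. *)
Lemma cyclic_coef1 : f 1%N != 0.
Proof.
pose psi n : R[i] := ((n == 1%N)%:R : R)%:C%C.
have cpsi : cmultiplicative psi.
  split=> [|m n m0 n0]; rewrite /psi ?eqxx ?rmorph1 // -rmorphM -natrM mulnb.
  by congr (_%:R)%:C%C; congr nat_of_bool; rewrite muln_eq1.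
have npsi n : nm (psi n) = (n == 1%N)%:R by rewrite /psi nm_real ger0_norm.
have apsi : adm psi 1.
  split=> // [n _|N]; first by rewrite npsi lern1 leq_b1.
  have [N1|N1] := leqP N 1; first by rewrite big_geq.
  rewrite big_ltn // npsi eqxx expr1n big_nat_cond big1 ?addr0 // => i /andP[/andP[i1 _] _].
  by rewrite npsi gtn_eqF // expr0n.
have [d d0 [X0 /(_ (X0 + 2)%N (leq_addr _ _) psi apsi) h]] := cyclic_nonvanishing cf (tail0_bounded fC) ltr01.
apply/eqP => f1; move: h; rewrite leNgt => /negP; apply.
rewrite /ev big_ltn ?addn2 // f1 mul0r rmorph0 mul0r add0r big_nat_cond big1 ?nm0 // => i.
by move=> /andP[/andP[i1 _] _]; rewrite /psi gtn_eqF // rmorph0 mulr0.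
Qed.

Let d_bound (k : nat) n : `|f (g ^ k * n)%N| <= C. Proof. exact: fC. Qed.
Let C0 : 0 <= C. Proof. exact: le_trans (fC 0%N). Qed.

Lemma pow_sum_bound (d : nat -> R) (K : R) s : (0 < s)%N -> (forall n, `|d n| <= K) ->
  exists c, forall X, (0 < X)%N -> `|\sum_(1 <= n < X) d n / n%:R ^+ s.+1 - c| <= 2 * K / X%:R.
Proof.
move=> s0 dK; apply: series_limit => n n0.
have n1 : 0 < n%:R :> R by rewrite ltr0n.
rewrite normrM ler_pM // ger0_norm ?invr_ge0 ?exprn_ge0 //.
by rewrite lef_pV2 ?posrE ?exprn_gt0 // ler_weXn2l // ler1n.
Qed.

(** For each large exponent [c (s, k)] is geometric in [k] and returns to its initial value at
    [k = totient q], so the real ratio is 1 or -1. As [s] grows [c (s, k)] tends to [f (g ^ k)], and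
    [f 1] is nonzero, so the sign is eventually constant; uniqueness of Dirichlet coefficients then
    gives the pointwise relation. *)
Lemma class_multiplier : exists w : R, w ^+ 2 = 1 /\ forall m, (0 < m)%N -> f (g * m)%N = w * f m.
Proof.
have f1 := cyclic_coef1; have nf1 : 0 < `|f 1%N| by rewrite normr_gt0.
have /choice[c hc] : forall sk : nat * nat, exists c, forall X, (0 < X)%N ->
    `|\sum_(1 <= n < X) f (g ^ sk.2 * n)%N / n%:R ^+ sk.1.+2 - c| <= 2 * C / X%:R.
  by move=> [s k]; apply: pow_sum_bound.
have hc' s k X : (0 < X)%N ->
    `|\sum_(1 <= n < X) f (g ^ k * n)%N / n%:R ^+ s.+2 - c (s, k)| <= 2 * C / X%:R.
  exact: (hc (s, k)).
pose e := `|f 1%N| / 4; have e0 : 0 < e by rewrite divr_gt0.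
have [s0 hs0] : exists s0, forall s k, (s0 <= s)%N -> `|c (s, k) - f (g ^ k)%N| <= e.
  have h0 : 0 <= 2^-1 :> R by rewrite invr_ge0.
  have h1 : 2^-1 < 1 :> R by rewrite invf_lt1 // ltr1n.
  have h2 : 0 < e / (8 * C + 1) by rewrite divr_gt0 // ltr_wpDl // mulr_ge0.
  have [N hN] := expr_small h0 h1 h2.
  exists N => s k Ns; have := @sum_tail_first R (fun n => f (g ^ k * n)%N) C (c (s, k)) s.+1 (d_bound k) isT (hc' s k).
  rewrite muln1 => h; apply: (le_trans h).
  have := hN s.+1 (leqW Ns); rewrite exprVn ler_pdivlMr ?ltr_wpDl ?mulr_ge0 // => h3.
  apply: le_trans h3; rewrite mulrC ler_wpM2l ?invr_ge0 ?exprn_ge0 //.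
  by rewrite lerDl.
have c0n s : (s0 <= s)%N -> c (s, 0%N) != 0.
  move=> ss; apply/eqP => E; have := hs0 s 0%N ss; rewrite E expn0 sub0r normrN /e.
  by rewrite leNgt => /negP; apply; rewrite ltr_pdivrMr // ltr_pMr // ltr1n.
have rec s k : (s0 <= s)%N -> c (s, k.+1) * c (s, 0%N) = c (s, 1%N) * c (s, k).
  move=> ss; have := @limit_recurrence R q g f C q0 pf fC cf big s.+1 (fun k => c (s, k)) isT.
  by apply; [move=> j X; exact: hc' | exact: c0n].
have pow s k : (s0 <= s)%N -> c (s, k) = (c (s, 1%N) / c (s, 0%N)) ^+ k * c (s, 0%N).
  move=> ss; have h := c0n s ss; elim: k => [|k IH]; first by rewrite expr0 mul1r.
  apply: (mulIf h); rewrite rec // {1}IH exprS; field.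
  exact: h.
have sgn s : (s0 <= s)%N -> c (s, 1%N) = c (s, 0%N) \/ c (s, 1%N) = - c (s, 0%N).
  move=> ss; have h := c0n s ss.
  have t0 : (0 < totient q)%N by rewrite totient_gt0.
  have E : c (s, totient q) = c (s, 0%N).
    apply: (@series_limit_uniq R (fun n => f (g ^ totient q * n)%N / n%:R ^+ s.+2) (2 * C)); first exact: hc'.
    move=> X X0; have := hc' s 0%N X X0; congr (`|_ - _| <= _).
    apply: eq_bigr => n _; congr (_ / _); apply: pf.
    by rewrite expn0 -modnMml -[in RHS]modnMml Euler_exp_totient.
  have : (c (s, 1%N) / c (s, 0%N)) ^+ totient q = 1.
    by apply: (mulIf h); rewrite -pow // E mul1r.
  move/eqP; rewrite -(prednK t0) => /eqP.
  set x := c (s, 1%N) / c (s, 0%N) => x1.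
  have : `|x| = 1.
    apply/eqP; rewrite -(@eqrXn2 _ (totient q).-1.+1 `|x| 1) //.
    by rewrite -normrX x1 normr1 expr1n.
  move=> nx; have {nx} : x = 1 \/ x = -1.
    have [x0|x0] := lerP 0 x; [left | right].
      by rewrite -nx ger0_norm.
    by rewrite -nx ltr0_norm // opprK.
  rewrite /x => -[|] hx; [left | right].
    by rewrite -[LHS](divfK h) hx mul1r.
  by rewrite -[LHS](divfK h) hx mulN1r.
(* With errors [e], a quarter of [|f 1|], the distance from [f g] to [f 1] is at most half of
   [|f 1|] for the sign 1, and larger for the sign -1. *)
pose w : R := if `|f g - f 1%N| <= `|f 1%N| / 2 then 1 else -1.
exists w; split; first by rewrite /w; case: ifP; rewrite ?expr1n // sqrrN expr1n.
have cw s : (s0 <= s)%N -> c (s, 1%N) = w * c (s, 0%N).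
  move=> ss; have h0 := hs0 s 0%N ss; have h1 := hs0 s 1%N ss.
  rewrite expn0 in h0; rewrite expn1 in h1.
  have eE : e = `|f 1%N| / 4 by [].
  case: (sgn s ss) => E; rewrite /w.
    case: ifP; first by rewrite mul1r.
    move=> /negP; case; rewrite E in h1.
    have -> : f g - f 1%N = (c (s, 0%N) - f 1%N) - (c (s, 0%N) - f g) by ring.
    apply: (le_trans (ler_normB _ _)); apply: (le_trans (lerD h0 h1)).
    by rewrite eE; lra.
  case: ifP; last by rewrite mulN1r.
  move=> h2; exfalso; rewrite E in h1.
  have : 2 * `|f 1%N| <= e + e + `|f 1%N| / 2.
    have -> : 2 * `|f 1%N| = `|(f g - f 1%N) + (- c (s, 0%N) - f g) + (c (s, 0%N) - f 1%N)|.
      have -> : (f g - f 1%N) + (- c (s, 0%N) - f g) + (c (s, 0%N) - f 1%N) = - (2 * f 1%N) by ring.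
      by rewrite normrN normrM ger0_norm.
    apply: (le_trans (ler_normD _ _)); rewrite addrC.
    apply: (le_trans (lerD h0 (ler_normD _ _))).
    by move: h1 h2; set x := `|_ - f g|; set y := `|f g - _|; lra.
  by rewrite eE; lra.
move=> m m0; apply/eqP; rewrite -subr_eq0; apply/eqP.
apply: (@dirichlet_uniq R (fun n => f (g * n)%N - w * f n) (2 * C) s0.+1) => // [n|s X ss X0].
  apply: (le_trans (ler_normB _ _)); rewrite normrM mulr_natl mulr2n lerD //.
  have -> : `|w| = 1 by rewrite /w; case: ifP; rewrite ?normrN normr1.
  by rewrite mul1r.
case: s ss => // s ss.
have h0 := hc' s 0%N X X0; have h1 := hc' s 1%N X X0; have E := cw s ss.
have -> : \sum_(1 <= n < X) (f (g * n)%N - w * f n) / n%:R ^+ s.+2 =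
  (\sum_(1 <= n < X) f (g ^ 1 * n)%N / n%:R ^+ s.+2 - c (s, 1%N)) -
  w * (\sum_(1 <= n < X) f (g ^ 0 * n)%N / n%:R ^+ s.+2 - c (s, 0%N)).
  rewrite E mulrBr opprB addrA subrK mulr_sumr -sumrB; apply: eq_bigr => n _.
  by rewrite expn1 expn0 mul1n mulrBl mulrA.
apply: (le_trans (ler_normB _ _)); rewrite normrM.
have -> : `|w| = 1 by rewrite /w; case: ifP; rewrite ?normrN normr1.
rewrite mul1r; apply: (le_trans (lerD h1 h0)).
by rewrite -mulrDl; rewrite ler_wpM2r ?invr_ge0 //; lra.
Qed.

End ClassMultiplier.

Section UnitMultiplier.
Variables (R : realType) (q : nat) (f : nat -> R).
Hypotheses (q0 : (0 < q)%N).
Hypothesis pf : forall m n, m = n %[mod q] -> f m = f n.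

Lemma periodic_bounded : exists C : R, forall n, `|f n| <= C.
Proof.
exists (\sum_(0 <= i < q) `|f i|) => n.
rewrite (bigD1_seq (n %% q)%N) ?mem_index_iota ?iota_uniq ?ltn_pmod //=.
by rewrite -(pf (modn_mod n q)) lerDl sumr_ge0.
Qed.

Hypothesis cf : cl (fun n => f n / n%:R) (@delta1 R).

Definition multiplier (n : nat) : Prop := exists w : R, w ^+ 2 = 1 /\ forall m, f (n * m)%N = w * f m.

(** Multipliers form a union of residue classes closed under products. If a unit were missing,
    [class_outside] would supply a missing class with enough primes for [class_multiplier]. *)
Lemma unit_multiplier n : coprime n q -> multiplier n.
Proof.
move=> cn; apply: contrapT => nH.
have [C fC] := periodic_bounded.
pose H := (fun n => `[< multiplier n >]).
have H1 : H 1%N by apply/asboolP; exists 1; split=> [|m]; rewrite ?expr1n ?mul1n ?mul1r.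
have HM m k : H m -> H k -> H (m * k)%N.
  move=> /asboolP[w [w2 hw]] /asboolP[v [v2 hv]]; apply/asboolP; exists (w * v).
  by split=> [|x]; [rewrite exprMn w2 v2 mulr1 | rewrite -mulnA hw hv mulrA].
have Hmod m k : m = k %[mod q] -> H m = H k.
  move=> mk; rewrite /H; congr asbool; rewrite /multiplier; apply: eq_exists => w.
  by congr (_ /\ _); apply: eq_forall => x; congr (_ = _); apply: pf; rewrite -modnMml mk modnMml.
have nHn : ~~ H n by apply/asboolPn.
have [c [cc /asboolPn nHc big]] := class_outside R q0 H1 HM Hmod cn nHn.
apply: nHc; have [w [w2 hw]] := class_multiplier q0 cc pf fC cf big.
exists w; split=> // m; have [->|m0] := posnP m; last exact: hw.
have E : f 0%N = f q by apply: pf; rewrite mod0n modnn.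
have -> : f (c * 0)%N = f (c * q)%N by apply: pf; rewrite muln0 mod0n modnMl.
by rewrite hw // E.
Qed.

End UnitMultiplier.

(** * Zero-free Dirichlet polynomials are cyclic *)

Section TorusParseval.
Variable R : realType.
Local Notation C := R[i].

Lemma digits_inj (b k : nat) (x y : nat -> nat) : (forall i, (x i < b)%N) -> (forall i, (y i < b)%N) ->
  (\sum_(0 <= i < k) x i * b ^ i = \sum_(0 <= i < k) y i * b ^ i)%N ->
  forall i, (i < k)%N -> x i = y i.
Proof.
elim: k x y => [|k IH] x y xb yb; first by [].
have b0 : (0 < b)%N by apply: leq_ltn_trans (xb 0%N).
have sh (z : nat -> nat) : (\sum_(0 <= i < k.+1) z i * b ^ i = z 0 + (\sum_(0 <= i < k) z i.+1 * b ^ i) * b)%N.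
  rewrite big_nat_recl // expn0 muln1; congr addn; rewrite big_distrl /=.
  by apply: eq_bigr => i _; rewrite expnSr mulnA.
rewrite !sh => E; have E0 : x 0%N = y 0%N.
  have : ((x 0 + (\sum_(0 <= i < k) x i.+1 * b ^ i) * b) %% b = (y 0 + (\sum_(0 <= i < k) y i.+1 * b ^ i) * b) %% b)%N by rewrite E.
  by rewrite !(addnC (_ 0%N)) !modnMDl !modn_small.
move: E; rewrite E0 => /addnI /eqP; rewrite eqn_pmul2r // => /eqP E.
have {}IH := IH (fun i => x i.+1) (fun i => y i.+1) (fun i => xb _) (fun i => yb _) E.
by case=> // i; rewrite ltnS => /IH.
Qed.

(* The powers [psi k] of the single character coded by the base [N] encoding
   [E] already satisfy Parseval's identity for sequences supported below [N]. *)
Lemma torus_bound (N : nat) (u : nat -> R) (K : R) : 0 <= K ->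
  (forall psi : nat -> C, cmultiplicative psi -> (forall n, nm (psi n) = 1) -> nm (ev psi N u) <= K) ->
  n2 N u <= K ^+ 2.
Proof.
move=> K0 hK; pose E n := tadd (fun p => N ^ p)%N n.
have Einj m n : (0 < m < N)%N -> (0 < n < N)%N -> E m = E n -> m = n.
  move=> /andP[m0 mN] /andP[n0 nN]; rewrite /E (tadd_widen _ mN) (tadd_widen _ nN) => h.
  have l p k : (0 < k < N)%N -> (logn p k < N)%N.
    by move=> /andP[k0 kN]; apply: ltn_trans kN; rewrite ltn_logl.
  apply: eqn_from_log => // p; have [pN|Np] := ltnP p N.
    have := @digits_inj N N (fun p => logn p m) (fun p => logn p n).
    by apply => // i; apply: l; apply/andP.
  by rewrite !logn_gt // (leq_trans _ Np).
pose M := (\sum_(0 <= n < N) E n).+1.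
have EM n : (n < N)%N -> (E n < M)%N.
  by move=> nN; rewrite /M ltnS (bigD1_seq n) ?mem_index_iota ?iota_uniq //= leq_addr.
pose w := rou R M; pose psi k n := w ^+ (k * E n).
have cpsi k : cmultiplicative (psi k).
  rewrite /psi /E; split=> [|m n m0 n0]; first by rewrite tadd1 muln0 expr0.
  by rewrite taddM // mulnDr exprD.
have npsi k n : nm (psi k n) = 1 by exact: nm_rouX.
have M0 : 0 < M%:R :> R by rewrite ltr0n.
rewrite -(ler_pM2l M0).
apply: (@le_trans _ _ (\sum_(0 <= k < M) nm (ev (psi k) N u) ^+ 2)); last first.
  rewrite mulr_natl -[X in _ *+ X]subn0 -sumr_const_nat; apply: ler_sum => k _.
  by rewrite lerXn2r ?nnegrE ?nm_ge0 // hK.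
rewrite le_eqVlt; apply/orP; left; apply/eqP.
apply: (@complexI R); rewrite rmorphM rmorph_nat [RHS]rmorph_sum /=.
have nE k : (nm (ev (psi k) N u) ^+ 2)%:C%C = \sum_(1 <= m < N) \sum_(1 <= n < N)
   (u m * u n)%:C%C * w ^+ (k * (E m + (M - E n))).
  rewrite rmorphXn /= -normC_nm sqr_normc /ev rmorph_sum big_distrlr /=.
  apply: eq_big_nat => m /andP[m0 mN]; apply: eq_big_nat => n /andP[n0 nN].
  have -> : ((u n)%:C%C * psi k n)^*%C = (u n)%:C%C * (psi k n)^*%C.
    by rewrite rmorphM /= oppr0.
  rewrite /psi (@conj_rouX _ M _ (k * (M - E n))%N) //; last first.
    by rewrite -mulnDr subnKC ?dvdn_mull // ltnW // EM.
  by rewrite mulrACA -rmorphM -exprD -mulnDr.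
rewrite (eq_bigr _ (fun k _ => nE k)) exchange_big /= /n2 rmorph_sum mulr_sumr.
apply: eq_big_nat => m /andP[m0 mN]; rewrite exchange_big /=.
rewrite (bigD1_seq m) ?mem_index_iota ?iota_uniq ?m0 //=.
have S n : (0 < n < N)%N -> \sum_(0 <= k < M) (u m * u n)%:C%C * w ^+ (k * (E m + (M - E n))) =
   (u m * u n)%:C%C * (if m == n then M%:R else 0).
  move=> /andP[n0 nN]; rewrite -mulr_sumr; congr (_ * _).
  under eq_bigr do rewrite mulnC.
  rewrite sum_rou //; have [<-|mn] := eqVneq m n; first by rewrite subnKC ?dvdnn // ltnW // EM.
  rewrite ifN //; apply/negP => /dvdnP[q hq].
  have := EM m mN; have := EM n nN; move=> h1 h2.
  have EE : E m = E n.
    case: q hq => [|[|q]] hq; [lia | lia |].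
    have : (2 * M <= q.+2 * M)%N by rewrite leq_mul2r orbT.
    by rewrite -hq; lia.
  by move/negP: mn; apply; apply/eqP; apply: Einj => //; apply/andP.
rewrite S ?m0 // eqxx big_nat_cond big1 ?addr0; last first.
  by move=> n /andP[h1 h2]; rewrite S // eq_sym (negbTE h2) mulr0.
by rewrite mulrC -expr2.
Qed.

End TorusParseval.

(** * From coefficientwise to norm approximation *)

Section BanachSaks.
Variable R : realType.
Variables (Q : nat -> R) (X0 : nat).
Hypothesis Qfin : forall n, (X0 <= n)%N -> Q n = 0.

Lemma comb_finite (L : seq (R * nat)) : wf L -> exists T, forall n, (T <= n)%N -> comb L Q n = 0.
Proof.
move=> /allP wL; exists (\max_(x <- L) x.2 * X0)%N => n Tn.
rewrite /comb big_seq big1 // => x xL; rewrite /dil; case: ifP => xn; last by rewrite mulr0.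
rewrite Qfin ?mulr0 // leq_divRL ?(wL x xL) // mulnC; apply: leq_trans Tn.
exact: (@leq_bigmax_seq _ _ xpredT (fun x : R * nat => x.2 * X0)%N).
Qed.

Lemma sum_le_finite (N T : nat) (F G : nat -> R) :
  (forall n, (0 < n < T)%N -> F n <= G n) -> (forall n, 0 <= G n) -> (forall n, (T <= n)%N -> F n = 0) ->
  \sum_(1 <= n < N) F n <= \sum_(1 <= n < T) G n.
Proof.
move=> FG G0 F0; rewrite (big_nat_widen _ _ _ _ _ (leq_maxl N T)) (big_nat_widen _ _ _ _ _ (leq_maxr N T)) /=.
rewrite big_mkcond [leRHS]big_mkcond; apply: ler_sum_nat => n /andP[n0 _].
have [nT|Tn] := ltnP n T; case: ifP => // _; first by rewrite FG ?n0.
by rewrite F0.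
Qed.

(* Banach-Saks: average successive approximations, each chosen so late that it
   is almost orthogonal to the sum of the previous ones. *)
Lemma cyclic_of_weak (K : R) : 0 <= K ->
  (forall T eta, 0 < eta -> exists L, [/\ wf L, forall N, n2 N (comb L Q) <= K &
    forall n, (0 < n < T)%N -> `|comb L Q n - delta1 R n| <= eta]) ->
  cl Q (@delta1 R).
Proof.
move=> K0 h; pose K1 := 2 * K + 2.
have K10 : 0 <= K1 by rewrite addr_ge0 ?mulr_ge0.
have n2d N : n2 N (@delta1 R) <= 1.
  rewrite /n2; have [N1|N1] := leqP N 1; first by rewrite big_geq.
  rewrite big_ltn // /delta1 eqxx expr1n big_nat_cond big1 ?addr0 // => i /andP[/andP[i1 _] _].
  by rewrite gtn_eqF // expr0n.
have n2L L N : n2 N (comb L Q) <= K -> n2 N (fun n => comb L Q n - delta1 R n) <= K1.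
  move=> hL; rewrite (@eq_n2 _ _ _ (fun n => comb L Q n + (-1) * delta1 R n)) => [|n _].
    apply: (le_trans (n2D _ _ _)); rewrite n2Z sqrrN expr1n mul1r /K1.
    by have := n2d N; lra.
  by rewrite mulN1r.
have claim m : exists L, wf L /\ forall N, n2 N (fun n => comb L Q n - m%:R * delta1 R n) <= m%:R * (K1 + 1).
  elim: m => [|m [L [wL hL]]].
    exists [::]; split=> // N; rewrite (@eq_n2 _ _ _ (fun=> 0)) => [|n _].
      by rewrite /n2 big1 ?mul0r // => i _; rewrite expr0n.
    by rewrite /comb big_nil mul0r subrr.
  have [T hT] := comb_finite wL; pose T1 := T.+2.
  pose u n := comb L Q n - m%:R * delta1 R n.
  have u0 n : (T1 <= n)%N -> u n = 0.
    move=> h1; rewrite /u hT ?sub0r; last by apply: leq_trans h1; rewrite /T1; lia.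
    by rewrite /delta1 gtn_eqF ?mulr0 ?oppr0 //; apply: leq_trans h1.
  pose A := \sum_(1 <= n < T1) `|u n|; have A0 : 0 <= A by apply: sumr_ge0.
  (* This tolerance makes twice the inner product of [u] and [u'] at most 1, so the squared norm
     grows by at most [K1 + 1] per step. *)
  have e0 : 0 < (2 * (A + 1))^-1 by rewrite invr_gt0 mulr_gt0 // ltr_wpDl.
  have [L' [wL' hL' cL']] := h T1 _ e0.
  exists (L ++ L'); split; first by rewrite /wf all_cat; apply/andP.
  move=> N; pose u' n := comb L' Q n - delta1 R n.
  rewrite (@eq_n2 _ _ _ (fun n => u n + u' n)) => [|n _]; last first.
    by rewrite comb_cat /u /u' -natr1 mulrDl mul1r opprD addrACA.
  have -> : n2 N (fun n => u n + u' n) = n2 N u + n2 N u' + 2 * \sum_(1 <= n < N) u n * u' n.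
    rewrite /n2 mulr_sumr -!big_split /=; apply: eq_bigr => n _; ring.
  have h2 : `|\sum_(1 <= n < N) u n * u' n| <= 2^-1.
    apply: (le_trans (ler_norm_sum _ _ _)).
    apply: (@le_trans _ _ (\sum_(1 <= n < T1) `|u n| * (2 * (A + 1))^-1)).
      apply: sum_le_finite => [n hn|n|n h1].
      - by rewrite normrM ler_wpM2l // cL'.
      - by rewrite mulr_ge0 // ltW.
      - by rewrite u0 // mul0r normr0.
    rewrite -mulr_suml -/A ler_pdivrMr ?mulr_gt0 ?ltr_wpDl // mulrA mulVf // mul1r.
    by rewrite lerDl.
  have := n2L L' N (hL' N); have := hL N; rewrite -/u -/u' => h3 h4.
  rewrite -natr1 mulrDl mul1r; have := ler_norm (\sum_(1 <= n < N) u n * u' n).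
  by move: h2 h3 h4; set a := n2 N u; set b := n2 N u'; set c := \sum_(_ <= _ < _) _; lra.
move=> e e0; pose m := (Num.truncn ((K1 + 1) / e)).+1.
have m0 : 0 < m%:R :> R by rewrite ltr0n.
have [L [wL hL]] := claim m.
exists (shift m%:R^-1 1 L); split; first exact: wf_shift.
move=> N; rewrite (@eq_n2 _ _ _ (fun n => m%:R^-1 * (comb L Q n - m%:R * delta1 R n))) => [|n _].
  rewrite n2Z; apply: (@le_trans _ _ (m%:R^-1 ^+ 2 * (m%:R * (K1 + 1)))).
    by rewrite ler_wpM2l ?sqr_ge0.
  rewrite expr2 -mulrA mulKf ?gt_eqF // ler_pdivrMl // -ler_pdivrMr //.
  by rewrite ltW // truncnS_gt.
rewrite comb_shift // mulrBr mulrA mulVf ?gt_eqF // mul1r; congr (_ * _ - _).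
by rewrite /dil dvd1n divn1.
Qed.

End BanachSaks.

(** * Dirichlet polynomials graded by the number of prime factors *)

Section DirichletLists.
Variable R : realType.
Local Notation C := R[i].
Implicit Types (L : seq (R * nat)) (psi : nat -> C).

(** The arithmetic function Omega: prime factors counted with multiplicity. *)
Definition Om (n : nat) : nat := tadd (fun=> 1%N) n.

Lemma Om1 : Om 1 = 0%N. Proof. exact: tadd1. Qed.

Lemma OmM m n : (0 < m)%N -> (0 < n)%N -> Om (m * n) = (Om m + Om n)%N.
Proof. exact: taddM. Qed.

Lemma Om_gt0 n : (1 < n)%N -> (0 < Om n)%N.
Proof. exact: tadd_const1_gt0. Qed.

Lemma Om_lt n : (0 < n)%N -> (Om n < n)%N.
Proof.
elim/ltn_ind: n => n IH n0; have [n1|n1] := leqP n 1.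
  by rewrite (_ : n = 1%N) ?Om1 //; case: n n0 n1 {IH} => [|[|n]].
have pp := pdiv_prime n1; have pn := pdiv_dvd n; have p1 := prime_gt1 pp.
have q0 : (0 < n %/ pdiv n)%N by rewrite divn_gt0 ?prime_gt0 // dvdn_leq.
have Op : Om (pdiv n) = 1%N by exact: tadd_prime.
have E : Om (n %/ pdiv n * pdiv n)%N = (Om (n %/ pdiv n) + 1)%N by rewrite OmM ?Op // prime_gt0.
rewrite divnK // in E.
have := IH _ (ltn_Pdiv p1 n0) q0; rewrite E; have := divnK pn.
have aux a b c m : (a * b = m -> c < a -> 0 < a -> 1 < b -> c + 1 < m)%N by clear; nia.
by move=> h1 h2; exact: aux h1 h2 q0 p1.
Qed.

Lemma Om_dvd d n : (0 < n)%N -> (d %| n)%N -> (Om d <= Om n)%N.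
Proof.
move=> n0 /dvdnP[k E]; move: n0; rewrite E muln_gt0 => /andP[k0 d0].
by rewrite OmM // leq_addl.
Qed.

Definition conv L L' := flatten [seq shift x.1 x.2 L' | x <- L].

Lemma wf_conv L L' : wf L -> wf L' -> wf (conv L L').
Proof.
move=> wL wL'; elim: L wL => [|x L IH] //= /andP[x0 wL].
by rewrite /conv /= /wf all_cat -!/(wf _) wf_shift //=; exact: IH.
Qed.

Lemma comb_conv L L' b n : wf L' -> comb (conv L L') b n = comb L (comb L' b) n.
Proof.
move=> wL'; elim: L => [|x L IH]; first by rewrite /comb !big_nil.
rewrite /conv /= comb_cat comb_shift // [RHS]/comb big_cons; congr (_ + _).
exact: IH.
Qed.

(** The restriction of a Dirichlet polynomial to the points [y ^+ Om n * psi n] on the disc through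
    [psi], as a polynomial in [y]. *)
Definition polyl psi L : {poly C} :=
  \sum_(x <- L) ((x.1)%:C%C * psi x.2)%:P * 'X ^+ Om x.2.

Lemma polyl_cat psi L L' : polyl psi (L ++ L') = polyl psi L + polyl psi L'.
Proof. exact: big_cat. Qed.

Lemma polyl_conv psi L L' : cmultiplicative psi -> wf L -> wf L' ->
  polyl psi (conv L L') = polyl psi L * polyl psi L'.
Proof.
move=> [_ pM] wL wL'; elim: L wL => [|x L IH] /=; first by rewrite /polyl !big_nil mul0r.
move=> /andP[x0 wL]; rewrite /conv /= polyl_cat IH // [X in _ = X * _]/polyl big_cons mulrDl.
congr (_ + _); rewrite /polyl /shift big_map mulr_sumr big_seq [RHS]big_seq.
apply: eq_bigr => y yL; have y0 : (0 < y.2)%N := allP wL' y yL.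
rewrite /= pM // OmM // rmorphM exprD !rmorphM /=.
have A6 (a b c d e f : {poly C}) : a * b * (c * d) * (e * f) = a * c * e * (b * d * f) by ring.
exact: A6.
Qed.

Lemma polyl_horner psi L (r : R) :
  (polyl psi L).[r%:C%C] = evl psi [seq (r ^+ Om x.2 * x.1, x.2) | x <- L].
Proof.
rewrite /polyl horner_sum /evl big_map; apply: eq_bigr => x _.
by rewrite hornerCM hornerXn /= rmorphM rmorphXn /= mulrC mulrA.
Qed.

Lemma polyl_coef psi L d :
  (polyl psi L)`_d = \sum_(x <- L | Om x.2 == d) (x.1)%:C%C * psi x.2.
Proof.
rewrite /polyl coef_sum [RHS]big_mkcond; apply: eq_bigr => x _.
by rewrite coefCM coefXn eq_sym; case: eqP => _; rewrite ?mulr1 ?mulr0.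
Qed.

Lemma polyl_norm psi L m : (forall n, nm (psi n) = 1) ->
  \sum_(0 <= j < m) nm (polyl psi L)`_j <= n1 L.
Proof.
move=> np; apply: (@le_trans _ _ (\sum_(0 <= j < m) \sum_(x <- L | Om x.2 == j) `|x.1|)).
  apply: ler_sum => j _; rewrite polyl_coef; apply: (le_trans (nm_sum _ _ _)).
  by apply: ler_sum => x _; rewrite nmM nm_real np mulr1.
under eq_bigr do rewrite big_mkcond.
rewrite exchange_big /=; apply: ler_sum => x _.
rewrite -big_mkcond /= (eq_bigl (fun j => j == Om x.2)) => [|j]; last by rewrite eq_sym.
by rewrite big_nat1_eq; case: ifP.
Qed.

(* [geo P D] is the partial sum of the Neumann series of [1 - P]. *)
Definition pw (P : seq (R * nat)) (k : nat) := iter k (conv^~ P) [:: (1, 1%N)].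
Definition geo (P : seq (R * nat)) (D : nat) := flatten [seq pw P k | k <- iota 0 D.+1].

Lemma wf_pw P k : wf P -> wf (pw P k).
Proof. by move=> wP; elim: k => //= k IH; exact: wf_conv. Qed.

Lemma geoS P D : geo P D.+1 = geo P D ++ pw P D.+1.
Proof. by rewrite /geo -addn1 iotaD map_cat flatten_cat /= cats0. Qed.

Lemma wf_geo P D : wf P -> wf (geo P D).
Proof.
move=> wP; elim: D => [|D IH] //.
by rewrite geoS /wf all_cat -!/(wf _) IH wf_pw.
Qed.

Lemma pw_Om P k x : wf P -> (forall x, x \in P -> (1 < x.2)%N) -> x \in pw P k -> (k <= Om x.2)%N.
Proof.
move=> wP P1; elim: k x => [|k IH] x //= /flattenP[_ /mapP[y yk ->] /mapP[z zP ->]] /=.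
have y0 : (0 < y.2)%N := allP (wf_pw k wP) _ yk.
rewrite OmM //; last by apply: ltnW; exact: P1.
by rewrite -addn1 leq_add ?IH // Om_gt0 // P1.
Qed.

Lemma geo_split P T D : (T <= D)%N -> exists2 L, geo P D = geo P T ++ L &
  wf P -> (forall x, x \in P -> (1 < x.2)%N) -> forall x, x \in L -> (T < Om x.2)%N.
Proof.
move=> TD; rewrite -(subnKC TD); elim: (D - T)%N => [|k [L E h]].
  by exists [::]; rewrite ?cats0 ?addn0.
exists (L ++ pw P (T + k).+1); first by rewrite addnS geoS E catA.
move=> wP P1 x; rewrite mem_cat => /orP[|xp]; first exact: h.
by apply: leq_trans (pw_Om wP P1 xp); rewrite ltnS leq_addr.
Qed.

Lemma geo_comb P (q : nat -> R) D n : wf P ->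
  (forall m, (0 < m)%N -> q m = delta1 R m - comb P (@delta1 R) m) -> (0 < n)%N ->
  comb (geo P D) q n = delta1 R n - comb (pw P D.+1) (@delta1 R) n.
Proof.
move=> wP hq n0.
have st k : comb (pw P k) q n = comb (pw P k) (@delta1 R) n - comb (pw P k.+1) (@delta1 R) n.
  rewrite [pw P k.+1]/= comb_conv // -combB; apply: eq_bigr => x _; congr (_ * _).
  rewrite /dil; case: ifP => // xn; rewrite hq // divn_gt0 ?(dvdn_leq n0) //.
  by apply: contraTT xn; rewrite -leqNgt leqn0 => /eqP ->; rewrite dvd0n -lt0n.
elim: D => [|D IH]; last by rewrite geoS comb_cat IH st addrA subrK.
rewrite [geo P 0]/= /geo /= (st 0%N) /=; congr (_ - _).
by rewrite /comb big_seq1 /= mul1r /dil dvd1n divn1.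
Qed.

Lemma polyl_geo psi P D : wf P -> cmultiplicative psi ->
  (1 - polyl psi P) * polyl psi (geo P D) = 1 - polyl psi P ^+ D.+1.
Proof.
move=> wP cp; have pk k : polyl psi (pw P k) = polyl psi P ^+ k.
  elim: k => [|k IH].
    by rewrite /polyl big_seq1 /= (proj1 cp) Om1 !(rmorph1, mulr1).
  by rewrite /= polyl_conv ?wf_pw // IH exprSr.
elim: D => [|D IH].
  by rewrite (_ : geo P 0 = pw P 0) // pk expr0 mulr1 expr1.
rewrite geoS polyl_cat mulrDr IH pk mulrBl mul1r -exprS; ring.
Qed.

Lemma coef_expr_small (p : {poly C}) k d : p`_0 = 0 -> (d < k)%N -> (p ^+ k)`_d = 0.
Proof.
move=> p0; elim: k d => [|k IH] d; first by [].
rewrite ltnS => dk; rewrite exprS coefM big1 // => -[[|j] jd] _ /=; first by rewrite p0 mul0r.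
by rewrite IH ?mulr0 //; rewrite ltnS in jd; apply: leq_trans dk; rewrite ltn_subrL (leq_trans _ jd).
Qed.

End DirichletLists.

Section InverseBounds.
Variable R : realType.
Local Notation C := R[i].

(** Dividing by [1 - x X] with [|x| <= 1] is convolution with a geometric series and costs
    [(1 - rho)^-1] in the norm [max |W_d| rho^d]. Only degrees up to [D] enter, so the estimate
    survives truncation. *)
Lemma coef_quotient_bound (xs : seq C) (W : {poly C}) (rho K : R) D :
  0 < rho -> rho < 1 -> (forall x, x \in xs -> nm x <= 1) ->
  (forall d, (d <= D)%N -> nm (W * \prod_(x <- xs) (1 - x%:P * 'X))`_d * rho ^+ d <= K) ->
  forall d, (d <= D)%N -> nm W`_d * rho ^+ d <= K / (1 - rho) ^+ size xs.
Proof.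
move=> r0 r1; elim: xs W => [|x xs IH] W h1 hW d dD.
  by rewrite expr0 divr1; have := hW d dD; rewrite big_nil mulr1.
have s0 : 0 < 1 - rho by rewrite subr_gt0.
have /IH h : forall d, (d <= D)%N -> nm (W * (1 - x%:P * 'X) * \prod_(x <- xs) (1 - x%:P * 'X))`_d * rho ^+ d <= K.
  by move=> e eD; have := hW e eD; rewrite big_cons mulrA.
have {}h := h (fun y ys => h1 y (mem_behead (ys : y \in behead (x :: xs)))).
rewrite /= exprSr invfM mulrA; set K' := K / _ in h *.
have K'0 : 0 <= K' by apply: le_trans (h 0%N isT); rewrite mulr_ge0 ?nm_ge0 // expr0.
have WE : W * (1 - x%:P * 'X) = W - x%:P * (W * 'X) by rewrite mulrBr mulr1 mulrCA.
elim: d dD => [|d IHd] dD.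
  apply: (@le_trans _ _ K'); last by rewrite ler_pdivlMr // ler_piMr // gerBl ltW.
  by have := h 0%N isT; rewrite WE coefB coefCM coefMX mulr0 subr0.
have := h d.+1 dD; rewrite WE coefB coefCM coefMX /=.
have hd := IHd (ltnW dD); have x1 := h1 x (mem_head _ _).
have h2 := nmD (W`_d.+1 - x * W`_d) (x * W`_d); rewrite subrK nmM in h2.
move=> h3.
have rd : 0 <= rho ^+ d by rewrite exprn_ge0 // ltW.
have h4 : nm x * nm W`_d * rho ^+ d.+1 <= rho * (K' / (1 - rho)).
  rewrite exprS mulrCA ler_wpM2l ?(ltW r0) //; apply: le_trans hd; rewrite ler_wpM2r //.
  by rewrite ler_piMl ?nm_ge0.
have -> : K' / (1 - rho) = K' + rho * (K' / (1 - rho)) by field; rewrite gt_eqF.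
by apply: le_trans (lerD h3 h4); rewrite -mulrDl ler_wpM2r // exprn_ge0 // ltW.
Qed.

(** Factor by factor [|1 - x| <= 2 |1 - r x|], because [|r x - x| <= 1 - r <= |1 - r x|]. The
    constant is independent of [r]. *)
Lemma prod_dilate_bound (xs : seq C) (r : R) : 0 <= r -> r < 1 -> (forall x, x \in xs -> nm x <= 1) ->
  nm (\prod_(x <- xs) (1 - x)) <= 2 ^+ size xs * nm (\prod_(x <- xs) (1 - x * r%:C%C)).
Proof.
move=> r0 r1; elim: xs => [|x xs IH] h; first by rewrite !big_nil expr0 mul1r.
rewrite !big_cons !nmM exprS mulrACA; apply: ler_pM; rewrite ?nm_ge0 //; last first.
  by apply: IH => y ys; apply: h; rewrite inE ys orbT.
have x1 := h x (mem_head _ _).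
have E : 1 - x = (1 - x * r%:C%C) - x * (1 - r)%:C%C by rewrite rmorphB /=; ring.
have h1 : nm (1 - x) <= nm (1 - x * r%:C%C) + nm (x * (1 - r)%:C%C) by rewrite E nmB.
have h2 := nm_subl 1 (x * r%:C%C); move: h1 h2.
rewrite nm1 !nmM !nm_real ger0_norm ?subr_ge0 ?(ltW r1) // ger0_norm //.
by have := nm_ge0 x; move: (nm (_ - _)) (nm x) (nm _) x1 => a b c; nra.
Qed.

End InverseBounds.

Section FiniteCyclic.
Variable R : realType.
Local Notation C := R[i].

Lemma n2_mono (u : nat -> R) M N : (M <= N)%N -> n2 M u <= n2 N u.
Proof.
move=> MN; rewrite /n2 (big_nat_widen _ _ _ _ _ MN) /= big_mkcond; apply: ler_sum => n _.
by case: ifP => // _; exact: sqr_ge0.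
Qed.

Lemma one_sub_expr_le (r : R) k : 0 <= r -> r <= 1 -> 1 - r ^+ k <= k%:R * (1 - r).
Proof.
move=> r0 r1; elim: k => [|k IH]; first by rewrite expr0 subrr mul0r.
rewrite exprS -[k.+1%:R]natr1 [X in _ <= X]mulrDl [X in _ <= _ + X]mul1r.
have : r ^+ k <= 1 by rewrite exprn_ile1.
by have := exprn_ge0 k r0; move: (r ^+ k) (k%:R * _) IH => a b; nra.
Qed.

Variables (q : nat -> R) (X0 : nat).
Hypothesis qfin : forall n, (X0 <= n)%N -> q n = 0.
Hypothesis q1 : q 1%N = 1.
Hypothesis qZ : forall psi : nat -> C, cmultiplicative psi ->
  (forall p, prime p -> nm (psi p) < 1) -> ev psi X0 q != 0.

Let P : seq (R * nat) := [seq (- q n, n) | n <- index_iota 2 X0].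

Let X1 : (1 < X0)%N.
Proof. by rewrite ltnNge; apply/negP => h; have /eqP := qfin h; rewrite q1 oner_eq0. Qed.

Let P1 x : x \in P -> (1 < x.2)%N.
Proof. by move=> /mapP[n]; rewrite mem_index_iota => /andP[h _] ->. Qed.

Let wP : wf P. Proof. by apply/allP => x /P1 /ltnW. Qed.

Let qP m : (0 < m)%N -> q m = delta1 R m - comb P (@delta1 R) m.
Proof.
move=> m0; have -> : comb P (@delta1 R) m = \sum_(2 <= n < X0 | n == m) - q n.
  rewrite /comb /P big_map [RHS]big_mkcond; apply: eq_big_nat => n /andP[n2 _] /=.
  rewrite /dil /delta1; have [->|nm] := eqVneq n m; first by rewrite dvdnn divnn m0 mulr1.
  case: ifP => h; last by rewrite mulr0.
  by case: eqP => h1; [move: nm; rewrite -(divnK h) h1 mul1n eqxx | rewrite mulr0].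
rewrite big_nat1_eq /delta1; have [->|m1] := eqVneq m 1%N; first by rewrite subr0.
have -> : (1 < m)%N by rewrite ltn_neqAle eq_sym m1.
by rewrite sub0r /=; case: ltnP => h; rewrite ?opprK // oppr0 qfin.
Qed.

(** Up to degree [D] in [Om] the partial sum [geo P D] has the coefficients of the true Dirichlet
    inverse; the incomplete higher ones are discarded. *)
Let F D := [seq x <- geo P D | (Om x.2 <= D)%N].
Let T D (r : R) := [seq (r ^+ Om x.2 * x.1, x.2) | x <- F D].

Let wT D r : wf (T D r).
Proof.
by apply/allP => _ /mapP[x xF ->] /=; move: xF; rewrite mem_filter => /andP[_ /(allP (wf_geo D wP))].
Qed.

Let evq psi (r : C) : cmultiplicative psi ->
  (1 - polyl psi P).[r] = ev (fun n => psi n * r ^+ Om n) X0 q.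
Proof.
move=> [p1 _]; rewrite /ev big_ltn // q1 p1 Om1 expr0 mulr1 mul1r hornerD hornerC hornerN.
rewrite /polyl horner_sum /P big_map -sumrN; congr (_ + _); apply: eq_bigr => n _.
by rewrite hornerCM hornerXn rmorphN mulNr mulNr opprK mulrA.
Qed.

Let ev_torus D r psi N : cmultiplicative psi -> (\max_(x <- T D r) x.2 * X0 <= N)%N ->
  ev psi N (comb (T D r) q) = (polyl psi (F D)).[r%:C%C] * (1 - polyl psi P).[1].
Proof.
move=> cp hN.
have -> : ev psi N (comb (T D r) q) = ev psi N (comb (T D r) (trunc X0 q)).
  apply: eq_ev => n _; apply: eq_bigr => x _; congr (_ * _); rewrite /dil /trunc.
  by case: ifP => // _; case: ltnP => // /qfin.
rewrite (ev_comb_trunc q cp) // => [|x xT].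
  rewrite polyl_horner evq //; congr (_ * _); apply: eq_bigr => n _.
  by rewrite expr1n mulr1.
by apply: leq_trans hN; exact: (@leq_bigmax_seq _ _ xpredT (fun x : R * nat => x.2 * X0)%N).
Qed.

Let B := n1 ((1, 1%N) :: P).

(* With [r = rho ^ 2], the truncated inverse [W] satisfies [W Q = 1 + O(rho ^ D)]
   at [r], and replacing [Q] at 1 by [Q] at [r] costs a factor 2 per root. *)
Let torus_estimate (rho : R) D psi : 0 < rho -> rho < 1 -> cmultiplicative psi -> (forall n, nm (psi n) = 1) ->
  nm ((polyl psi (F D)).[(rho ^+ 2)%:C%C] * (1 - polyl psi P).[1]) <=
  2 ^+ X0 * (1 + (X0.+1%:R * B / (1 - rho) ^+ X0) * rho ^+ D).
Proof.
move=> r0 r1 cp np; set W := polyl psi (F D); set Q := 1 - polyl psi P; set r := rho ^+ 2.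
have rr0 : 0 <= r by rewrite exprn_ge0 // ltW.
have rr1 : r < 1 by rewrite exprn_ilt1 // ltW.
have s0 : 0 < 1 - rho by rewrite subr_gt0.
have QE : Q = polyl psi ((1, 1%N) :: [seq (- x.1, x.2) | x <- P]).
  rewrite /Q /polyl big_cons /= (proj1 cp) Om1 !(rmorph1, mulr1); congr (_ + _).
  rewrite big_map -sumrN; apply: eq_bigr => x _ /=.
  by rewrite rmorphN mulNr polyCN mulNr.
have nQ m : \sum_(0 <= j < m) nm Q`_j <= B.
  rewrite QE; apply: (le_trans (polyl_norm _ _ np)).
  by rewrite /B /n1 !big_cons big_map /=; under eq_bigr do rewrite normrN.
have sQ : (size Q <= X0)%N.
  apply/leq_sizeP => j Xj; rewrite QE polyl_coef big_seq_cond big1 // => x /andP[xL /eqP E].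
  have : (Om x.2 < X0)%N; last by rewrite E ltnNge Xj.
  move: xL; rewrite inE => /predU1P[->|/mapP[y /mapP[n nI ->] ->]] /=.
    by rewrite Om1 ltnW.
  move: nI; rewrite mem_index_iota => /andP[h1 h2]; apply: ltn_trans h2.
  by rewrite Om_lt // ltnW.
have Q0 : Q`_0 = 1.
  rewrite -horner_coef0 evq // -[RHS](ev_delta1 X1 cp).
  apply: eq_big_nat => n /andP[n0 _]; rewrite /delta1; have [->|n1] := eqVneq n 1%N.
    by rewrite q1 Om1 expr0 mulr1.
  have : (0 < Om n)%N by rewrite Om_gt0 // ltn_neqAle eq_sym n1.
  by case: (Om n) => // k _; rewrite expr0n mulr0 mulr0 mul0r.
have Qn0 (y : C) : nm y < 1 -> Q.[y] != 0.
  move=> y1; rewrite evq //; apply: qZ.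
    by apply: cmultM => //; exact: cmult_expr.
  by move=> p pp; rewrite nmM np mul1r /Om (tadd_prime _ pp) expr1.
have [|xs [Qx hxs sx]] := @factor_unit_const C Q; first by rewrite Q0 oner_eq0.
rewrite Q0 polyC1 mul1r in Qx.
have xs1 x : x \in xs -> nm x <= 1.
  move=> /hxs[x0 /rootP rx]; rewrite leNgt; apply/negP => x1.
  have := Qn0 x^-1; rewrite rx eqxx nmV invf_lt1 ?nm_gt0 // => /(_ x1) //.
have QW d : (d <= D)%N -> (W * Q)`_d = (d == 0%N)%:R.
  move=> dD; have : (Q * polyl psi (geo P D))`_d = (d == 0%N)%:R.
    rewrite polyl_geo // coefB coef1 coef_expr_small ?subr0 //.
    by move: Q0; rewrite /Q coefB coef1 /= => /eqP; rewrite -subr_eq0 addrAC subrr add0r oppr_eq0 => /eqP.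
  move<-; rewrite mulrC !coefM; apply: eq_bigr => j _; congr (_ * _).
  rewrite !polyl_coef big_filter_cond; apply: eq_bigl => x.
  case: eqP => [->|]; last by rewrite andbF.
  by rewrite andbT; apply: leq_trans dD; rewrite leq_subr.
have hW d : (d <= D)%N -> nm W`_d * rho ^+ d <= ((1 - rho) ^+ X0)^-1.
  move=> dD; apply: (@le_trans _ _ (1 / (1 - rho) ^+ size xs)).
    apply: (@coef_quotient_bound _ xs W rho 1 D) => // e eD.
    rewrite -Qx QW // nm_natr; case: eqP => _; last by rewrite mul0r.
    by rewrite mul1r exprn_ile1 // ltW.
  rewrite mul1r lef_pV2 ?posrE ?exprn_gt0 // ler_wiXn2l ?(ltW s0) ?gerBl ?(ltW r0) //.
  by rewrite ltnW // (leq_trans sx).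
set K := ((1 - rho) ^+ X0)^-1 in hW *.
have K0 : 0 <= K by rewrite invr_ge0 exprn_ge0 // ltW.
have W0 d : (D < d)%N -> W`_d = 0.
  move=> Dd; rewrite polyl_coef big_filter_cond big1 // => x /andP[h /eqP E].
  by move: h; rewrite E leqNgt Dd.
have rD : 0 < rho ^+ D by rewrite exprn_gt0.
have WK d : nm W`_d <= K / rho ^+ D.
  have [dD|/W0 ->] := leqP d D; last by rewrite nm0 divr_ge0 // ltW.
  rewrite ler_pdivlMr //; apply: le_trans (hW d dD); rewrite ler_wpM2l ?nm_ge0 //.
  by rewrite ler_wiXn2l ?ltW.
have WQ d : nm (W * Q)`_d <= K / rho ^+ D * B.
  rewrite coefMr; apply: (le_trans (nm_sum _ _ _)).
  apply: (@le_trans _ _ (K / rho ^+ D * \sum_(0 <= j < d.+1) nm Q`_j)).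
    rewrite big_mkord mulr_sumr; apply: ler_sum => j _; rewrite nmM ler_wpM2r ?nm_ge0 //.
  by rewrite ler_wpM2l // divr_ge0 // ltW.
have sWQ : (size (W * Q)%R <= D.+1 + X0)%N.
  apply: (leq_trans (size_polyMleq _ _)).
  apply: (leq_trans (leq_pred _)); apply: leq_add sQ.
  by apply/leq_sizeP => j; exact: W0.
have tail : nm ((W * Q).[r%:C%C] - 1) <= X0.+1%:R * B * K * rho ^+ D.
  rewrite (horner_coef_wide _ sWQ) -(big_mkord xpredT (fun i => (W * Q)`_i * r%:C%C ^+ i)).
  rewrite (big_cat_nat (n := D.+1)) ?leq_addr //= big_ltn // QW // expr0 mulr1.
  rewrite [X in 1 + X]big_nat_cond [X in 1 + X]big1 ?addr0; last first.
    by move=> i /andP[/andP[i0 iD] _]; rewrite QW // gtn_eqF // mul0r.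
  rewrite addrAC subrr add0r; apply: (le_trans (nm_sum _ _ _)).
  apply: (@le_trans _ _ (\sum_(D.+1 <= i < D.+1 + X0) K * B * rho ^+ D)).
    apply: ler_sum_nat => i /andP[iD _]; rewrite nmM nmX nm_real ger0_norm //.
    apply: (@le_trans _ _ (K / rho ^+ D * B * r ^+ D)).
      apply: ler_pM; rewrite ?nm_ge0 ?exprn_ge0 ?(ltW r0) //.
      by apply: ler_wiXn2l; rewrite ?(ltW rr1) // ltnW.
    have -> : r ^+ D = rho ^+ D * rho ^+ D by rewrite /r -exprM mulnC exprM expr2.
    rewrite le_eqVlt; apply/orP; left; apply/eqP.
    by move: rD; move: (rho ^+ D) => y y0; field; rewrite gt_eqF.
  rewrite sumr_const_nat addKn -[leLHS]mulr_natl.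
  have B0 : 0 <= B by exact: n1_ge0.
  have : 0 <= K * B * rho ^+ D by rewrite !mulr_ge0 // ltW.
  have -> : X0.+1%:R * B * K * rho ^+ D = X0%:R * (K * B * rho ^+ D) + K * B * rho ^+ D.
    by rewrite -[X0.+1%:R]natr1; ring.
  by move=> h; rewrite lerDl.
rewrite nmM.
have hQ : nm Q.[1] <= 2 ^+ X0 * nm Q.[r%:C%C].
  have h (y : C) : Q.[y] = \prod_(x <- xs) (1 - x * y).
    rewrite Qx horner_prod; apply: eq_bigr => x _.
    by rewrite hornerD hornerN hornerC hornerCM hornerX.
  rewrite !h; under eq_bigr do rewrite mulr1.
  apply: (le_trans (prod_dilate_bound rr0 rr1 xs1)); rewrite ler_wpM2r ?nm_ge0 //.
  by rewrite ler_weXn2l ?ler1n // ltnW // (leq_trans sx).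
apply: (@le_trans _ _ (nm W.[r%:C%C] * (2 ^+ X0 * nm Q.[r%:C%C]))).
  by rewrite ler_wpM2l ?nm_ge0.
rewrite mulrCA ler_wpM2l ?exprn_ge0 // -nmM -hornerM.
have := nmD ((W * Q).[r%:C%C] - 1) 1; rewrite subrK nm1 => h.
by apply: (le_trans h); rewrite addrC lerD2l; move: tail; rewrite /K; congr (_ <= _); ring.
Qed.

(** First [rho] is chosen close to 1 in terms of the finitely many coefficients to be controlled,
    then [D] so large that [K * rho ^+ D <= 1]. The resulting torus bound [2 ^+ X0 * 2] depends on
    neither. *)
Lemma finite_cyclic_normalized : cl q (@delta1 R).
Proof.
apply: (@cyclic_of_weak R q X0 qfin ((2 ^+ X0 * 2) ^+ 2)); first by rewrite sqr_ge0.
move=> S eta eta0; pose A := \sum_(x <- geo P S) `|x.1| * \sum_(0 <= n < S) `|q n|.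
have A0 : 0 <= A by apply: sumr_ge0 => x _; rewrite mulr_ge0 // sumr_ge0.
(* At an index below [S] the dilation changes the coefficient of the inverse times [q] by at most
   [S * (1 - r) * A], and [1 - r <= 2 * e]. *)
pose e := Num.min 2^-1 (eta / (2 * S.+1%:R * (A + 1))).
have e0 : 0 < e by rewrite lt_min invr_gt0 ltr0n /= divr_gt0 // !mulr_gt0 // ltr_wpDl.
have e1 : e <= 2^-1 by rewrite ge_min lexx.
pose rho := 1 - e.
have r0 : 0 < rho by rewrite /rho; lra.
have r1 : rho < 1 by rewrite /rho; lra.
set r := rho ^+ 2.
have hr : S%:R * (1 - r) * A <= eta.
  have h : e * (2 * S.+1%:R * (A + 1)) <= eta.
    by rewrite -ler_pdivlMr ?mulr_gt0 ?ltr_wpDl // ge_min lexx orbT.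
  have h1 : 1 - r <= 2 * e by rewrite /r /rho; nra.
  apply: le_trans h; apply: (@le_trans _ _ (S%:R * (2 * e) * A)).
    by rewrite ler_wpM2r // ler_wpM2l.
  rewrite -[S.+1%:R]natr1; have := ler0n R S; move: (S%:R : R) => s s0.
  have : 0 <= e * s by rewrite mulr_ge0 // ltW.
  have : 0 <= e * A by rewrite mulr_ge0 // ltW.
  by move: e0; clearbody e A; rewrite !(mulrDl, mulrDr); nra.
set K := X0.+1%:R * B / (1 - rho) ^+ X0.
have K0 : 0 <= K by rewrite divr_ge0 ?exprn_ge0 ?mulr_ge0 ?n1_ge0 // subr_ge0 ltW.
have K10 : 0 < (K + 1)^-1 by rewrite invr_gt0 ltr_wpDl.
have [D0 hD0] := expr_small (ltW r0) r1 K10.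
pose D := maxn S D0.
exists (T D r); split; first exact: wT.
- move=> N; apply: (@le_trans _ _ (n2 (maxn N (\max_(x <- T D r) x.2 * X0)%N) (comb (T D r) q))).
    by apply: n2_mono; exact: leq_maxl.
  apply: torus_bound; first by rewrite mulr_ge0 // exprn_ge0.
  move=> psi cp np; rewrite (ev_torus cp) ?leq_maxr //.
  apply: (le_trans (torus_estimate _ r0 r1 cp np)); rewrite ler_wpM2l ?exprn_ge0 // -/K.
  have h : rho ^+ D <= (K + 1)^-1 by apply: hD0; exact: leq_maxr.
  have : K * rho ^+ D <= K * (K + 1)^-1 by rewrite ler_wpM2l.
  have : K * (K + 1)^-1 <= 1 by rewrite ler_pdivrMr ?ltr_wpDl // mul1r lerDl.
  by move: (K * _) (K * _) => a b; lra.
move=> n /andP[n0 nS].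
have On : (Om n <= S)%N by apply: leq_trans (ltnW nS); apply: ltnW; exact: Om_lt.
have [L hL hL'] := geo_split P (leq_maxl S D0 : (S <= D)%N).
have pwd k : (Om n < k)%N -> comb (pw P k) (@delta1 R) n = 0.
  move=> nk; rewrite /comb big_seq big1 // => x /(pw_Om wP P1) h; rewrite /dil.
  by case: ifP => [/(Om_dvd n0) h1|]; rewrite ?mulr0 //; move: nk; rewrite ltnNge (leq_trans h h1).
have -> : delta1 R n = comb (geo P S) q n by rewrite geo_comb // pwd ?subr0.
have -> : comb (T D r) q n = \sum_(x <- geo P S) r ^+ Om x.2 * x.1 * dil x.2 q n.
  rewrite /comb /T /F big_map big_filter hL big_cat /= [X in _ + X]big_seq_cond [X in _ + X]big1 ?addr0.
    rewrite big_mkcond; apply: eq_bigr => x _; case: ifP => // /negbT; rewrite -ltnNge => h.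
    rewrite /dil; case: ifP => [/(Om_dvd n0) h1|]; rewrite ?mulr0 //.
    by move: h; rewrite ltnNge (leq_trans h1) // (leq_trans On) // leq_maxl.
  move=> x /andP[/(hL' wP P1) h _]; rewrite /dil; case: ifP => [/(Om_dvd n0) h1|]; rewrite ?mulr0 //.
  by move: h; rewrite ltnNge (leq_trans h1).
rewrite /comb -sumrB; apply: (le_trans (ler_norm_sum _ _ _)); apply: le_trans hr.
rewrite /A mulr_sumr; apply: ler_sum => x _.
rewrite /dil; case: ifP => [xn|_]; last first.
  rewrite !mulr0 subrr normr0 !mulr_ge0 ?subr_ge0 ?sumr_ge0 // exprn_ile1 ?(ltW r0) ?(ltW r1) //.
have rr0 : 0 <= r by rewrite exprn_ge0 // ltW.
have rr1 : r <= 1 by rewrite exprn_ile1 // ltW.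
have -> : r ^+ Om x.2 * x.1 * q (n %/ x.2) - x.1 * q (n %/ x.2) =
    - ((1 - r ^+ Om x.2) * (x.1 * q (n %/ x.2)%N)) by ring.
have h0 : 0 <= 1 - r ^+ Om x.2 by rewrite subr_ge0 exprn_ile1.
rewrite normrN !normrM ger0_norm //; apply: ler_pM; rewrite ?mulr_ge0 //.
  apply: (le_trans (one_sub_expr_le _ rr0 rr1)); rewrite ler_wpM2r ?subr_ge0 // ler_nat.
  by apply: leq_trans On; exact: Om_dvd.
rewrite ler_wpM2l // (bigD1_seq (n %/ x.2)%N) ?mem_index_iota ?iota_uniq //=; last first.
  by apply: leq_ltn_trans nS; exact: leq_div.
by rewrite lerDl sumr_ge0.
Qed.

End FiniteCyclic.

(** The hypothesis at the function vanishing at all primes gives [Q 1 != 0], which permits the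
    normalization. *)
Lemma finite_cyclic (R : realType) (Q : nat -> R) (X0 : nat) :
  (forall n, (X0 <= n)%N -> Q n = 0) ->
  (forall psi : nat -> R[i], cmultiplicative psi ->
    (forall p, prime p -> nm (psi p) < 1) -> ev psi X0 Q != 0) ->
  cl Q (@delta1 R).
Proof.
move=> Qfin QZ; have Q1 : Q 1%N != 0.
  apply: contraPneq isT => Q10 _; have c0 : cmultiplicative (fun n => (0 : R[i]) ^+ Om n) by exact: cmult_expr.
  have p1 p : prime p -> nm ((0 : R[i]) ^+ Om p) < 1.
    by move=> pp; rewrite /Om (tadd_prime _ pp) expr1 nm0 ltr01.
  have /eqP := QZ _ c0 p1; apply.
  rewrite /ev big_nat big1 // => n /andP[n0 _]; have [->|n1] := eqVneq n 1%N.
    by rewrite Q10 mul0r.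
  have : (0 < Om n)%N by rewrite Om_gt0 // ltn_neqAle eq_sym n1.
  by case: (Om n) => // k _; rewrite expr0n mulr0.
apply: (@cl_trans _ _ (fun n => (Q 1%N)^-1 * Q n)).
  apply: (@cl_eq _ _ (fun n => (Q 1%N)^-1 * dil 1 Q n)) => [n _|].
    by rewrite /dil dvd1n divn1.
  by apply: cl_shift => //; exact: cl_refl.
apply: (@finite_cyclic_normalized _ _ X0) => /= [n h||psi cp p1].
- by rewrite (Qfin n h) mulr0.
- by rewrite mulVf.
rewrite (_ : ev _ _ _ = ((Q 1%N)^-1)%:C%C * ev psi X0 Q).
  by rewrite mulf_neq0 ?QZ // -nm_eq0 nm_real normr_eq0 invr_eq0.
by rewrite /ev mulr_sumr; apply: eq_bigr => n _; rewrite rmorphM mulrA.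
Qed.

(** * Sequences with common values of f(n) + f(n + t) *)

Section SmoothPart.
Variable R : realType.
Implicit Types (u v : nat -> R) (K : seq (R * nat)) (pi : nat_pred).

Definition spart pi u (n : nat) : R := if pi.-nat n then u n else 0.

Lemma spart_comb pi L u n : (forall x, x \in L -> pi.-nat x.2) -> (0 < n)%N ->
  spart pi (comb L u) n = comb L (spart pi u) n.
Proof.
move=> hL n0; rewrite /spart; case: ifP => pn.
  rewrite /comb big_seq [RHS]big_seq; apply: eq_bigr => x xL; congr (_ * _).
  rewrite /dil; case: ifP => // xn; case: ifP => // /negP; case.
  by move: pn; rewrite -{1}(divnK xn) pnatM => /andP[].
rewrite /comb big_seq big1 // => x xL; rewrite /dil; case: ifP => xn; last by rewrite mulr0.
rewrite ifF ?mulr0 //; apply/negP => h; move/negP: pn; apply.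
by rewrite -(divnK xn) pnatM h hL.
Qed.

(** Convolution with the two-term Euler factor [1 + x.1 * x.2^-s]. The iterate [sts] suits induction
    over the factors, its expansion [KT] suits [comb] and [evl]. *)
Definition st (x : R * nat) u n := u n + x.1 * dil x.2 u n.
Definition sts K u := foldr st u K.
Definition KT K : seq (R * nat) := foldr (fun x => conv [:: (1, 1%N); x]) [:: (1, 1%N)] K.

Lemma wf_KT K : wf K -> wf (KT K).
Proof. by elim: K => //= x K IH /andP[x0 /IH h]; apply: wf_conv; rewrite //= x0. Qed.

Lemma comb_KT K u n : wf K -> comb (KT K) u n = sts K u n.
Proof.
elim: K n => [|x K IH] n /=; first by rewrite /comb big_seq1 /= mul1r /dil dvd1n divn1.
move=> /andP[x0 wK]; rewrite comb_conv ?wf_KT // [LHS]/comb big_cons big_seq1 /= mul1r /st.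
rewrite {1}/dil dvd1n divn1 IH //; congr (_ + _ * _).
by rewrite /dil; case: ifP => // _; rewrite IH.
Qed.

Lemma KT_nat pi K : (forall x, x \in K -> pi.-nat x.2) -> forall x, x \in KT K -> pi.-nat x.2.
Proof.
elim: K => [|y K IH] hK x /=; first by rewrite inE => /eqP ->.
have hK' z : z \in K -> pi.-nat z.2 by move=> zK; apply: hK; rewrite inE zK orbT.
have y0 : pi.-nat y.2 by apply: hK; exact: mem_head.
case/flattenP => _ /mapP[z zL ->] /mapP[w wK ->] /=; rewrite pnatM [X in _ && X](IH hK') // andbT.
by move: zL; rewrite !inE => /orP[] /eqP ->.
Qed.

Lemma evl_KT (psi : nat -> R[i]) K : cmultiplicative psi -> wf K ->
  evl psi (KT K) = \prod_(x <- K) (1 + (x.1)%:C%C * psi x.2).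
Proof.
move=> cp; have evl_conv L L' : wf L -> wf L' -> evl psi (conv L L') = evl psi L * evl psi L'.
  move=> wL wL'; have h M : evl psi M = (polyl psi M).[1].
    by rewrite /polyl horner_sum /evl; apply: eq_bigr => x _; rewrite hornerCM hornerXn expr1n mulr1.
  by rewrite !h polyl_conv // hornerM.
elim: K => [_|x K IH /= /andP[x0 wK]].
  by rewrite big_nil /evl big_seq1 /= (proj1 cp) mulr1.
rewrite evl_conv ?wf_KT //= ?x0 // IH // big_cons; congr (_ * _).
by rewrite /evl big_cons big_seq1 /= (proj1 cp) mulr1.
Qed.

Lemma st_eq (P : pred nat) x u v : (forall n, P n -> (0 < n)%N) ->
  (forall n, (0 < n)%N -> (x.2 %| n)%N -> P n -> P (n %/ x.2)%N) ->
  (forall n, P n -> u n = v n) -> forall n, P n -> st x u n = st x v n.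
Proof.
move=> P0 PD uv n Pn; rewrite /st uv //; congr (_ + _ * _).
by rewrite /dil; case: ifP => // xn; rewrite uv // PD // P0.
Qed.

(** Since [1 < x.2], each factor is unitriangular for divisibility, hence injective on a set closed
    under division by [x.2]. *)
Lemma sts_inj (P : pred nat) K u : (forall n, P n -> (0 < n)%N) ->
  (forall x n, x \in K -> (0 < n)%N -> (x.2 %| n)%N -> P n -> P (n %/ x.2)%N) ->
  (forall x, x \in K -> (1 < x.2)%N) ->
  (forall n, P n -> sts K u n = 0) -> forall n, P n -> u n = 0.
Proof.
move=> P0; elim: K => [|x K IH] //= PD K1 h.
apply: IH => [y n yK|y yK|]; [by apply: PD; rewrite inE yK orbT | by apply: K1; rewrite inE yK orbT |].
elim/ltn_ind => n IHn Pn; have := h n Pn; rewrite /st /dil; case: ifP => xn; last by rewrite mulr0 addr0.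
have n0 := P0 n Pn; have x1 : (1 < x.2)%N by apply: K1; exact: mem_head.
rewrite (IHn (n %/ x.2)%N) ?ltn_Pdiv ?mulr0 ?addr0 //.
by apply: PD => //; exact: mem_head.
Qed.

Lemma sts_lin (I : finType) (c : I -> R) (w : I -> nat -> R) K n :
  sts K (fun m => \sum_i c i * w i m) n = \sum_i c i * sts K (w i) n.
Proof.
elim: K n => [|x K IH] n //=; rewrite {1}/st IH /dil; case: ifP => xn.
  rewrite IH mulr_sumr -big_split /=; apply: eq_bigr => i _.
  by rewrite /st /dil xn; ring.
by rewrite mulr0 addr0; apply: eq_bigr => i _; rewrite /st /dil xn mulr0 addr0.
Qed.

Lemma sts_double K u n : (forall x, x \in K -> odd x.2) ->
  sts K u (2 * n) = sts K (fun m => u (2 * m)%N) n.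
Proof.
elim: K n => [|x K IH] n //= hK; have x1 : odd x.2 by apply: hK; exact: mem_head.
have hK' y : y \in K -> odd y.2 by move=> yK; apply: hK; rewrite inE yK orbT.
rewrite /st IH //; congr (_ + _ * _); rewrite /dil Gauss_dvdr; last by rewrite coprimen2.
by case: ifP => // xn; rewrite -IH // muln_divA.
Qed.

Definition vanishes p (E : nat) u := forall n, (0 < n)%N -> (p ^ E %| n)%N -> u n = 0.

Lemma st_vanishes p E x u : coprime x.2 p -> (0 < x.2)%N -> vanishes p E u -> vanishes p E (st x u).
Proof.
move=> cx x0 vu n n0 pn; rewrite /st vu // add0r /dil; case: ifP => xn; last by rewrite mulr0.
rewrite vu ?mulr0 //; first by rewrite divn_gt0 // dvdn_leq.
have : (p ^ E %| n %/ x.2 * x.2)%N by rewrite divnK.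
by rewrite Gauss_dvdl // coprime_sym coprimeXr.
Qed.

(** What [f n / n] satisfies when [f] is eventually invariant under multiplication by [p ^ J]. The
    matching two-term factor then cancels all multiples of [p ^ (E + J)]. *)
Definition scales p (J E : nat) u :=
  forall m, (0 < m)%N -> (p ^ E %| m)%N -> u (p ^ J * m)%N = (p ^ J)%:R^-1 * u m.

Lemma st_scales p J E x u : coprime x.2 p -> (0 < x.2)%N -> scales p J E u -> scales p J E (st x u).
Proof.
move=> cx x0 su m m0 pm; rewrite /st su // mulrDr; congr (_ + _); rewrite [RHS]mulrCA; congr (_ * _).
have cJ : coprime x.2 (p ^ J) by exact: coprimeXr.
rewrite /dil Gauss_dvdr //; case: ifP => xm; last by rewrite mulr0.
rewrite -muln_divA // su //; first by rewrite divn_gt0 // dvdn_leq.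
have : (p ^ E %| m %/ x.2 * x.2)%N by rewrite divnK.
by rewrite Gauss_dvdl // coprime_sym coprimeXr.
Qed.

Lemma st_self_vanishes p J E u : prime p -> scales p J E u ->
  vanishes p (E + J) (st (- (p ^ J)%:R^-1, (p ^ J)%N) u).
Proof.
move=> pp su n n0; rewrite expnD mulnC => /dvdnP[k E0]; have p0 := prime_gt0 pp.
rewrite E0 mulnCA /st /dil /= dvdn_mulr // mulKn ?expn_gt0 ?p0 //.
have h : (0 < k * p ^ E)%N by move: n0; rewrite E0 mulnCA muln_gt0 => /andP[].
by rewrite su ?dvdn_mull // mulNr addrN.
Qed.

Definition KP (s : seq nat) (J : nat) : seq (R * nat) := [seq (- (p ^ J)%:R^-1, (p ^ J)%N) | p <- s].

(** By coprimality the factor at one prime preserves both [scales] and [vanishes] at the others, so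
    the primes can be treated one after another. *)
Lemma KP_vanishes s J E u : uniq s -> (forall p, p \in s -> prime p) ->
  (forall p, p \in s -> scales p J E u) -> forall p, p \in s -> vanishes p (E + J) (sts (KP s J) u).
Proof.
move=> us sp su.
have cop p p' : prime p -> prime p' -> p != p' -> coprime (p' ^ J) p.
  by move=> pp pp' ne; apply: coprimeXl; rewrite prime_coprime // dvdn_prime2 // eq_sym.
have main r : uniq r -> (forall p, p \in r -> p \in s) ->
   (forall p, p \in r -> vanishes p (E + J) (sts (KP r J) u)) /\
   (forall p, p \in s -> p \notin r -> scales p J E (sts (KP r J) u)).
  elim: r => [|x r IH] /=; first by move=> _ _; split=> // p ps _; exact: su.
  move=> /andP[xr ur] rs.
  have xs : x \in s by apply: rs; exact: mem_head.
  have rs' p : p \in r -> p \in s by move=> pr; apply: rs; rewrite inE pr orbT.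
  have [IH1 IH2] := IH ur rs'; have x0 : (0 < x ^ J)%N by rewrite expn_gt0 prime_gt0 // sp.
  split=> p.
    rewrite inE => /predU1P[->|pr].
      by apply: st_self_vanishes; [exact: sp | exact: IH2].
    apply: st_vanishes => //=; last exact: IH1.
    by apply: cop; [exact/sp/rs' | exact: sp | apply: contraNneq xr => <-].
  move=> ps; rewrite inE negb_or => /andP[px pr].
  by apply: st_scales => //=; [apply: cop => //; exact: sp | exact: IH2].
by move=> p ps; have [h _] := main s us (fun p h => h); exact: h.
Qed.

Lemma dvdn_logs (m n : nat) : (0 < m)%N -> (0 < n)%N ->
  (forall p, prime p -> (p %| m)%N -> (logn p m <= logn p n)%N) -> (m %| n)%N.
Proof.
move=> m0 n0 h; apply/(dvdn_partP _ m0) => p; rewrite mem_primes => /and3P[pp _ pm].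
by rewrite p_part pfactor_dvdn // h.
Qed.

(** A number composed of primes of [q] that does not divide [q ^ E] contains some [p] more than [E]
    times. *)
Lemma spart_finite (q E : nat) u : (0 < q)%N ->
  (forall p, prime p -> (p %| q)%N -> vanishes p E u) ->
  forall n, (q ^ E < n)%N -> spart (\pi(q)) u n = 0.
Proof.
move=> q0 hu n nE; rewrite /spart; case: ifP => // pn; have n0 : (0 < n)%N by exact: leq_ltn_trans nE.
apply: contrapT => un; move: nE; rewrite ltnNge dvdn_leq ?expn_gt0 ?q0 //.
apply: dvdn_logs; rewrite ?expn_gt0 ?q0 // => p pp pn'.
have pq : (p %| q)%N.
  by move/pnatP: pn => /(_ n0 p pp pn'); rewrite mem_primes => /and3P[].
rewrite lognX (leq_trans (_ : _ <= E)%N) ?leq_pmulr ?logn_gt0 ?mem_primes ?pp ?q0 //.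
rewrite leqNgt; apply/negP => h; apply: un; apply: (hu p pp pq) => //.
by rewrite pfactor_dvdn // ltnW.
Qed.

(** A prime [p] not dividing [q] is removed by the factor [1 - chi p / p * p^-s], which cancels
    exactly the multiples of [p]. After the primes up to [Y] the result agrees with the smooth part
    for [n <= Y], and beyond [Y] the difference is dominated by the tail of [b]. *)
Lemma cl_spart (q : nat) (f chi : nat -> R) (C : R) : (0 < q)%N ->
  (forall n, `|f n| <= C) ->
  (forall p m, prime p -> ~~ (p %| q)%N -> f (p * m)%N = chi p * f m) ->
  cl (fun n => f n / n%:R) (spart (\pi(q)) (fun n => f n / n%:R)).
Proof.
move=> q0 fC hchi; set b := fun n => f n / n%:R.
pose bad Y n := has (fun p => [&& prime p, ~~ (p %| q)%N & (p %| n)%N]) (iota 0 Y).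
pose bY Y n : R := if bad Y n then 0 else b n.
have cb Y : cl b (bY Y).
  elim: Y => [|Y IH]; first exact: cl_refl.
  have bS n : bad Y.+1 n = bad Y n || [&& prime Y, ~~ (Y %| q)%N & (Y %| n)%N].
    by rewrite /bad -addn1 iotaD has_cat /= orbF.
  have [/andP[pY Yq]|nY] := boolP (prime Y && ~~ (Y %| q)%N); last first.
    by apply: cl_eq IH => n _; rewrite /bY bS andbA (negbTE nY) orbF.
  have Y0 : Y%:R != 0 :> R by rewrite pnatr_eq0 -lt0n prime_gt0.
  apply: (@cl_eq _ _ (fun n => bY Y n + (- (chi Y / Y%:R)) * dil Y (bY Y) n)); last first.
    by apply: cl_add => //; apply: cl_shift => //; exact: prime_gt0.
  move=> n n0; rewrite /bY bS pY Yq /= /dil.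
  have [Yn|nYn] := boolP (Y %| n)%N; last by rewrite orbF mulr0 addr0.
  rewrite orbT -{1 2}(divnK Yn); set m := (n %/ Y)%N.
  have -> : bad Y (m * Y)%N = bad Y m.
    rewrite /bad; apply: eq_in_has => p; rewrite mem_iota add0n => /andP[_ pY'].
    case pp : (prime p) => //=; congr (_ && _); rewrite Euclid_dvdM // [(p %| Y)%N]dvdn_prime2 //.
    by rewrite (ltn_eqF pY') orbF.
  case: ifP => _; first by rewrite mulr0 addr0.
  by rewrite /b mulnC hchi // natrM invfM; ring.
apply: cl_lim => e e0; have [Y hY] := tail0_bounded fC e0.
exists (bY Y.+1) => // N.
have small n : (n <= Y)%N -> (0 < n)%N -> bY Y.+1 n = spart (\pi(q)) b n.
  move=> nY n0; rewrite /bY /spart; case: ifP => [/hasP[p _ /and3P[pp pq pn]]|/hasPn h].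
    rewrite ifF //; apply/negP => /pnatP => /(_ n0 p pp pn).
    by rewrite mem_primes (negbTE pq) !andbF.
  rewrite ifT //; apply/pnatP => // p pp pn; rewrite mem_primes pp q0 /=.
  apply: contraT => pq; have := h p; rewrite mem_iota /= add0n ltnS (leq_trans (dvdn_leq n0 pn) nY).
  by rewrite pp pq pn => /(_ isT).
have le n : (bY Y.+1 n - spart (\pi(q)) b n) ^+ 2 <= b n ^+ 2.
  rewrite /bY /spart; case: ifP => _; case: ifP => _; rewrite ?subr0 ?sub0r ?subrr ?sqrrN ?lexx //.
  - by rewrite expr0n sqr_ge0.
  - by rewrite expr0n sqr_ge0.
have [NY|YN] := leqP N Y.+1.
  rewrite /n2 big_nat big1 ?ltW // => n /andP[n0 nN].
  by rewrite small ?subrr ?expr0n // -ltnS (leq_trans nN).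
rewrite /n2 (big_cat_nat (n := Y.+1)) ?(ltnW YN) //= [X in X + _]big_nat [X in X + _]big1 ?add0r.
  apply: le_trans (hY Y.+1 N (leqnSn _)); apply: ler_sum => n _; exact: le.
by move=> n /andP[n0 nY]; rewrite small ?subrr ?expr0n.
Qed.

End SmoothPart.

(** * Order of vanishing and evaluations carried by finitely many primes *)

Section PolynomialLemmas.
Variable R : realType.
Local Notation C := R[i].

(** The real inner product [Re (z * conj w)] of the plane. *)
Definition ip (z w : C) : R := complex.Re z * complex.Re w + complex.Im z * complex.Im w.

Lemma nm_sub_sqr (z w : C) : nm (z - w) ^+ 2 = nm z ^+ 2 + nm w ^+ 2 - 2 * ip z w.
Proof. by case: z w => [a b] [c d]; rewrite !nm_sqr /ip /=; ring. Qed.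

Lemma ipZr (x : R) (z w : C) : ip z (x%:C%C * w) = x * ip z w.
Proof. by case: z w => [a b] [c d]; rewrite /ip /=; ring. Qed.

Lemma ip_sum (I : finType) (c : I -> R) (z : I -> C) (w : C) :
  ip (\sum_i (c i)%:C%C * z i) w = \sum_i c i * ip (z i) w.
Proof.
elim/big_rec2: _ => [|i x y _ <-]; first by rewrite /ip /= !mul0r addr0.
by case: (z i) y w => [a b] [d e] [g k]; rewrite /ip /=; ring.
Qed.

Lemma horner_small (P : {poly C}) (e : R) : 0 < e ->
  exists2 d : R, 0 < d & forall y, nm y <= d -> nm (P.[y] - P.[0]) <= e.
Proof.
move=> e0; have /factor_theorem[q hq] : root (P - (P.[0])%:P) 0.
  by rewrite /root hornerD hornerN hornerC subrr.
pose K := \sum_(i < size q) nm q`_i; have K0 : 0 <= K by apply: sumr_ge0 => i _; exact: nm_ge0.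
exists (Num.min 1 (e / (K + 1))); first by rewrite lt_min ltr01 divr_gt0 // ltr_wpDl.
move=> y; rewrite le_min => /andP[y1 y2].
have -> : P.[y] - P.[0] = q.[y] * y.
  have := congr1 (fun p => p.[y]) hq.
  by rewrite /= hornerD hornerN hornerC hornerM polyC0 subr0 hornerX.
have qK : nm q.[y] <= K.
  rewrite horner_coef; apply: (le_trans (nm_sum _ _ _)); apply: ler_sum => i _.
  by rewrite nmM nmX ler_piMr ?nm_ge0 // exprn_ile1 ?nm_ge0.
rewrite nmM; apply: (@le_trans _ _ (K * (e / (K + 1)))); first by apply: ler_pM; rewrite ?nm_ge0.
by rewrite mulrCA ger_pMr // ler_pdivrMr ?ltr_wpDl // mul1r lerDl.
Qed.

(* Near a zero of [P] of order [m > 0] the argument of [P] takes every value,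
   in particular the one opposite to the argument of [A]. *)
Lemma no_zero_of_ip_ge0 (P A : {poly C}) (d : R) : 0 < d -> P != 0 -> A.[0] != 0 ->
  (forall y, nm y <= d -> 0 <= ip A.[y] P.[y]) -> P.[0] != 0.
Proof.
move=> d0 P0 A0 h; apply/negP => /eqP Pz.
have [m [P1 /implyP/(_ P0) P1n0 E]] := multiplicity_XsubC P 0.
rewrite polyC0 subr0 in E.
have m0 : (0 < m)%N.
  case: m E => // E; move/eqP: Pz; rewrite E expr0 mulr1 => hP1.
  by move: P1n0; rewrite /root hP1.
have p10 : P1.[0] != 0 by exact: P1n0.
have [w hw] : exists w : C, w ^+ m = - (A.[0] / P1.[0]).
  by exists (m.-root (- (A.[0] / P1.[0]))); rewrite rootCK.
pose G := (w ^+ m)%:P * P1.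
have G0 : G.[0] = - A.[0] by rewrite hornerCM hw mulNr divfK.
have a0 : 0 < nm A.[0] by rewrite nm_gt0.
(* With [a] the modulus of [A.[0]], this tolerance gives [|A - G| >= 1.8 a] and [|A|, |G| <= 1.1 a]
   near 0. As [3.24 > 2 * 1.21], the inner product of [A] and [G] is negative there. *)
have e0 : 0 < nm A.[0] / 10 by rewrite divr_gt0.
have [d1 d10 h1] := horner_small A e0; have [d2 d20 h2] := horner_small G e0.
have w0 : w != 0.
  apply: contraNneq A0 => w0; move: hw; rewrite w0 expr0n gtn_eqF //= => /eqP.
  by rewrite eq_sym oppr_eq0 mulf_eq0 invr_eq0 (negbTE p10) orbF.
pose s := Num.min d (Num.min d1 d2) / nm w.
have nw : 0 < nm w by rewrite nm_gt0.
have s0 : 0 < s by rewrite divr_gt0 // !lt_min d0 d10 d20.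
have nsw : nm (s%:C%C * w) = Num.min d (Num.min d1 d2).
  by rewrite nmM nm_real gtr0_norm // /s divfK // gt_eqF.
set y := s%:C%C * w in nsw.
have yd : nm y <= d by rewrite nsw ge_min lexx.
have yd1 : nm y <= d1 by rewrite nsw !ge_min lexx orbT.
have yd2 : nm y <= d2 by rewrite nsw !ge_min lexx !orbT.
have PG : P.[y] = (s ^+ m)%:C%C * G.[y].
  by rewrite E hornerM hornerXn /G hornerCM {2}/y exprMn rmorphXn /=; ring.
have := h y yd; rewrite PG ipZr pmulr_rge0 ?exprn_gt0 // => ipG.
have hA := h1 y yd1; have hG := h2 y yd2.
have e1 := nm_sub_sqr A.[y] G.[y].
have hA' : nm A.[y] <= nm A.[0] * (11 / 10).
  by have := nmD (A.[y] - A.[0]) A.[0]; rewrite subrK; lra.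
have hG' : nm G.[y] <= nm A.[0] * (11 / 10).
  by have := nmD (G.[y] - G.[0]) G.[0]; rewrite subrK G0 nmN; rewrite G0 in hG; lra.
have hAG : nm A.[0] * (18 / 10) <= nm (A.[y] - G.[y]).
  have := nmD (A.[y] - G.[y]) ((G.[y] - G.[0]) - (A.[y] - A.[0])).
  have -> : A.[y] - G.[y] + (G.[y] - G.[0] - (A.[y] - A.[0])) = 2%:R * A.[0] by rewrite G0; ring.
  have := nmB (G.[y] - G.[0]) (A.[y] - A.[0]); rewrite nmM nm_natr; lra.
have := nm_ge0 A.[y]; have := nm_ge0 G.[y].
move: e1 hA' hG' hAG a0; move: (nm (_ - _)) (nm A.[y]) (nm G.[y]) (nm A.[0]) (ip _ _) ipG => D a g z i i0 e1 ha hg hd z0 g0 a1.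
have z18 : 0 <= z * (18 / 10) by rewrite mulr_ge0 // ltW.
have : (z * (18 / 10)) ^+ 2 <= D ^+ 2 by rewrite lerXn2r ?nnegrE // (le_trans z18).
have z11 : 0 <= z * (11 / 10) by rewrite mulr_ge0 // ltW.
have : a ^+ 2 <= (z * (11 / 10)) ^+ 2 by rewrite lerXn2r ?nnegrE.
have : g ^+ 2 <= (z * (11 / 10)) ^+ 2 by rewrite lerXn2r ?nnegrE.
have : 0 < z ^+ 2 by rewrite exprn_gt0.
rewrite !exprMn; lra.
Qed.

Lemma ev_widen (psi : nat -> C) X M (u : nat -> R) : (X <= M)%N -> (forall n, (X <= n)%N -> u n = 0) ->
  ev psi M u = ev psi X u.
Proof.
move=> XM u0; rewrite /ev [RHS](big_nat_widen _ _ _ _ _ XM) /= [RHS]big_mkcond.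
by apply: eq_bigr => n _; case: ltnP => // /u0 ->; rewrite rmorph0 mul0r.
Qed.

Lemma ev_dil (psi : nat -> C) X k (u : nat -> R) : cmultiplicative psi -> (0 < k)%N ->
  (forall n, (X <= n)%N -> u n = 0) -> ev psi (k * X) (dil k u) = psi k * ev psi X u.
Proof.
move=> cp k0 u0; have := @ev_comb_trunc R psi [:: (1, k)] (k * X)%N X u cp.
rewrite /evl big_seq1 /= mul1r k0 => <- //.
  apply: eq_ev => n _; rewrite /comb big_seq1 /= mul1r /dil /trunc; case: ifP => // _.
  by case: ltnP => // /u0.
by move=> x; rewrite inE => /eqP ->.
Qed.

Lemma ev_lin (I : finType) (psi : nat -> C) X (c : I -> R) (u : I -> nat -> R) :
  ev psi X (fun n => \sum_i c i * u i n) = \sum_i (c i)%:C%C * ev psi X (u i).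
Proof.
rewrite /ev; under [RHS]eq_bigr do rewrite mulr_sumr.
rewrite [RHS]exchange_big /=; apply: eq_bigr => n _.
by rewrite rmorph_sum mulr_suml; apply: eq_bigr => i _; rewrite rmorphM mulrA.
Qed.

Lemma cmult_dvd0 (psi : nat -> C) d n : cmultiplicative psi -> (0 < n)%N -> (d %| n)%N ->
  psi d = 0 -> psi n = 0.
Proof.
move=> [_ pM] n0 /dvdnP[k E] pd; move: n0; rewrite E muln_gt0 => /andP[k0 d0].
by rewrite pM // pd mulr0.
Qed.

Lemma adm_finite_primes (psi : nat -> C) (s : seq nat) : cmultiplicative psi ->
  (forall p, prime p -> nm (psi p) < 1) -> (forall p, p \in s -> prime p) ->
  (forall p, prime p -> p \notin s -> psi p = 0) ->
  adm psi (\prod_(p <- s) (1 - nm (psi p) ^+ 2)^-1).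
Proof.
move=> cp p1 sp p0; have c1 : cmultiplicative (fun n => nm (psi n)).
  by case: cp => [e1 eM]; split=> [|m n m0 n0]; rewrite ?e1 ?nm1 ?eM ?nmM.
have cO : cmultiplicative (fun=> 1 : R) by split=> [|m n _ _]; rewrite ?mulr1.
have s1 p : prime p -> nm (psi p) ^+ 2 < 1 by move=> /p1 h; rewrite exprn_ilt1 ?nm_ge0.
split=> // [n n0|N].
  by have [] := cmult_le c1 cO (fun p pp => conj (nm_ge0 _) (ltW (p1 p pp))) n0.
have c2 : cmultiplicative (fun n => nm (psi n) ^+ 2).
  by case: c1 => [e1 eM]; split=> [|m n m0 n0]; rewrite ?e1 ?expr1n ?eM ?exprMn.
apply: (le_trans (@sum_peel _ _ s N c2 _ _)) => [n _|p ps|].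
- exact: sqr_ge0.
- by split; [exact: sp | exact/s1/sp].
rewrite ler_piMr //.
  by rewrite big_seq prodr_ge0 // => p ps; rewrite invr_ge0 subr_ge0 ltW // s1 // sp.
apply: (@le_trans _ _ (\sum_(1 <= n < N | n == 1%N) (1 : R))); last first.
  by rewrite big_nat1_eq; case: ifP.
rewrite big_mkcond [leRHS]big_mkcond; apply: ler_sum_nat => n /andP[n0 _].
have [->|n1] := eqVneq n 1%N; first by case: ifP => _; rewrite ?ler01 // (proj1 cp) nm1 expr1n.
case: ifP => // /allP hn; have n2 : (1 < n)%N by rewrite ltn_neqAle eq_sym n1.
have pp := pdiv_prime n2; have pn := pdiv_dvd n; have p_gt0 := prime_gt0 pp.
have -> : psi n = 0.
  apply: (cmult_dvd0 cp n0 pn); apply: p0 => //.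
  by apply/negP => /hn; rewrite pn.
by rewrite nm0 expr0n.
Qed.

End PolynomialLemmas.

(** * Zero-freeness from the common half sum *)

Section OddJumpData.
Variables (R : realType) (t : nat) (I : finType) (f : I -> nat -> R) (H : nat -> R).
Local Notation C := R[i].
Local Notation q := (2 * t)%N.
Hypothesis todd : odd t.
Hypothesis pf : forall i m n, m = n %[mod q] -> f i m = f i n.
Hypothesis cf : forall i, cl (fun n => f i n / n%:R) (@delta1 R).
Hypothesis fH : forall i n, f i n + f i (n + t)%N = 2 * H n.
Hypothesis Hn0 : exists n, H n != 0.
Variable i0 : I.

Let t0 : (0 < t)%N. Proof. by case: t todd. Qed.
Let q0 : (0 < q)%N. Proof. by rewrite muln_gt0. Qed.

Let H_per n : H (n + t) = H n.
Proof.
have two : 2 != 0 :> R by [].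
apply: (mulfI two); rewrite -!(fH i0) addrC; congr (_ + _); apply: pf.
by rewrite -addnA addnn -mul2n modnDr.
Qed.

(** A unit [n] modulo [2 t] is odd, so [n * t] is congruent to [t] and the relation between [f i]
    and [H] is carried to itself. Hence [H] has the multiplier of every [f i], and as [H] is not
    zero it determines it. *)
Lemma common_multiplier : exists chi : nat -> R, forall n, coprime n q ->
  [/\ chi n ^+ 2 = 1, forall i m, f i (n * m)%N = chi n * f i m &
      forall m, H (n * m)%N = chi n * H m].
Proof.
have [m0 Hm0] := Hn0; exists (fun n => H (n * m0)%N / H m0) => n cn.
have key i : exists2 w, w ^+ 2 = 1 & (forall m, f i (n * m)%N = w * f i m) /\
   forall m, H (n * m)%N = w * H m.
  have [w [w2 hw]] := unit_multiplier q0 (pf i) (cf i) cn; exists w => //; split=> // m.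
  have two : 2 != 0 :> R by [].
  apply: (mulfI two); rewrite -(fH i) mulrCA -(fH i) mulrDr -!hw; congr (_ + _).
  apply: pf; rewrite mulnDr; have n1 : odd n.
    by rewrite -coprimen2; move: cn; rewrite coprimeMr => /andP[].
  have -> : (n * t = t + n./2 * q)%N.
    by rewrite -[in LHS](odd_double_half n) n1 -mul2n mulnDl mul1n; congr addn; ring.
  by rewrite addnA [in RHS]addnC modnMDl.
split=> [|i m|m].
- by have [w w2 [_ ->]] := key i0; rewrite mulfK.
- have [w w2 [-> ->]] := key i; rewrite mulfK //.
- by have [w w2 [_ hH]] := key i0; rewrite !hH mulfK.
Qed.

Variable chi : nat -> R.
Hypothesis chiP : forall n, coprime n q ->
  [/\ chi n ^+ 2 = 1, forall i m, f i (n * m)%N = chi n * f i m &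
      forall m, H (n * m)%N = chi n * H m].

(** Although 2 is not a unit modulo [2 t], [2 + t] is, [t] being odd; and [(2 + t) * m'] is
    congruent to [2 * m] when [m'] is the even one among [m] and [m + t]. *)
Let eps := chi (2 + t).

Let eps_unit : coprime (2 + t) q.
Proof.
rewrite coprimeMr coprimen2 oddD todd /= coprime_sym /coprime gcdnDr.
by rewrite -/(coprime _ _) coprimen2.
Qed.

Let eps2 : eps ^+ 2 = 1. Proof. by have [] := chiP eps_unit. Qed.

Let f_double i m : f i (2 * m)%N = eps * f i (if odd m then m + t else m)%N.
Proof.
have [_ <- _] := chiP eps_unit; apply: pf; case: ifP => om; rewrite mulnDl.
  have -> : (2 * (m + t) + t * (m + t) = 2 * m + ((m + t)./2 + 1) * q)%N.
    have emt : ~~ odd (m + t) by rewrite oddD om todd.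
    have h := even_halfK emt; rewrite -mul2n in h; set k := (m + t)./2 in h *.
    by rewrite -[in X in (_ + _ * X)%N]h mulnDr; ring.
  by rewrite addnC modnMDl.
have -> : (2 * m + t * m = 2 * m + m./2 * q)%N.
  by rewrite -[in X in (_ + _ * X)%N](even_halfK (negbT om)) -mul2n; congr addn; ring.
by rewrite addnC modnMDl.
Qed.

Let f_double_odd i m : odd m -> f i (2 * m)%N = eps * (2 * H m - f i m).
Proof. by move=> om; rewrite f_double om -(fH i) addrC addKr. Qed.

Let f_double_even i m : ~~ odd m -> f i (2 * m)%N = eps * f i m.
Proof. by move=> om; rewrite f_double (negbTE om). Qed.

Let J := totient q.

(** Modulo the [p]-part of [q] both arguments vanish, modulo the rest [p ^ J] is 1. The exponent [q]
    is a crude bound for the multiplicity of [p] in [q]. *)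
Let f_scale i p m : prime p -> (p ^ q %| m)%N -> f i (p ^ J * m)%N = f i m.
Proof.
move=> pp pm; apply: pf; have [->|m0] := posnP m; first by rewrite muln0.
apply/eqP; rewrite eqn_mod_dvd ?leq_pmull ?expn_gt0 ?prime_gt0 //.
rewrite -[X in (_ %| _ - X)%N]mul1n -mulnBl -(partnC p q0) Gauss_dvd ?coprime_partC //.
apply/andP; split.
  apply: dvdn_mull; apply: dvdn_trans pm; rewrite p_part dvdn_exp2l // ltnW // ltn_logl //.
apply: dvdn_mulr; rewrite -eqn_mod_dvd ?expn_gt0 ?prime_gt0 //; apply/eqP.
have cp : coprime p q`_p^'.
  by rewrite (@pnat_coprime p) ?pnat_id ?part_pnat.
have -> : J = (totient q`_p^' * totient q`_p)%N.
  by rewrite /J -{1}(partnC p q0) totient_coprime ?coprime_partC // mulnC.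
rewrite expnM.
by rewrite -modnXm (Euler_exp_totient cp) modnXm exp1n.
Qed.

Let b i n := f i n / n%:R.
Let bH n := H n / n%:R.

Let Kt := KP R (primes t) J.
Let K2 : R * nat := (- (eps / 2), 2%N).
Let K := rcons Kt K2.

Let odd_prime p : p \in primes t -> odd p /\ prime p.
Proof.
rewrite mem_primes => /and3P[pp _ pt]; split=> //; case: (even_prime pp) => // p2.
by move: todd; rewrite -(divnK pt) p2 oddM andbF.
Qed.

Let Kt_odd x : x \in Kt -> odd x.2.
Proof. by move=> /mapP[p /odd_prime[po _] ->] /=; rewrite oddX po orbT. Qed.

Let Kt_gt1 x : x \in Kt -> (1 < x.2)%N.
Proof.
move=> /mapP[p /odd_prime[_ pp] ->] /=; rewrite -[1%N](expn0 p) ltn_exp2l ?prime_gt1 //.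
by rewrite totient_gt0.
Qed.

Let wK : wf K.
Proof.
apply/allP => x; rewrite mem_rcons inE => /predU1P[->|/Kt_gt1 /ltnW] //.
Qed.

(* By [f_double_odd] and [f_double_even], [f i (2 ^ k * m)] is [eps ^ k (2 H m - f i m)] for
   odd [m] and [k > 0], so the Euler factor [1 - (eps / 2) 2^-s] truncates the
   powers of 2; the factors [1 - p^(-J) p^(-J s)] do the same for [p %| t]. *)
Let b2 i := st K2 (b i).

Let b2_odd i n : odd n -> b2 i n = b i n.
Proof. by move=> on; rewrite /b2 /st /dil /= dvdn2 on mulr0 addr0. Qed.

Let b2_double i n : odd n -> b2 i (2 * n) = eps * (bH n - b i n).
Proof.
move=> on; rewrite /b2 /st /dil /= dvdn_mulr // mulKn // /b /bH f_double_odd // natrM.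
by field; rewrite pnatr_eq0; case: n on.
Qed.

Let b2_four i n : (0 < n)%N -> (4 %| n)%N -> b2 i n = 0.
Proof.
move=> n0 /dvdnP[k E]; have En : n = (2 * (2 * k))%N by rewrite E; ring.
have k0 : k%:R != 0 :> R by rewrite pnatr_eq0 -lt0n; move: n0; rewrite E muln_gt0 => /andP[].
rewrite /b2 /st /dil /= En dvdn_mulr // mulKn // /b.
rewrite [f i (2 * (2 * k))%N]f_double_even ?oddM // !natrM.
by field; rewrite k0.
Qed.

Let a i n : R := if odd n then spart (\pi(q)) (sts Kt (b i)) n else 0.
Let h n : R := if odd n then spart (\pi(q)) (sts Kt bH) n else 0.
Let Q i := spart (\pi(q)) (comb (KT K) (b i)).

Let sts_K i n : sts K (b i) n = sts Kt (b2 i) n.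
Proof. by rewrite /K /sts foldr_rcons. Qed.

Let odd_div x n : (0 < n)%N -> (x %| n)%N -> odd n -> odd (n %/ x)%N.
Proof. by move=> _ xn; rewrite -{1}(divnK xn) oddM => /andP[]. Qed.

Let sts_odd_eq u v n : (forall m, odd m -> u m = v m) -> odd n -> sts Kt u n = sts Kt v n.
Proof.
move=> uv; elim: Kt n => [|x L IH] n on /=; first exact: uv.
apply: (@st_eq _ odd) => // [m|m]; first by case: m.
exact: odd_div.
Qed.

Let piq2 : 2%N \in \pi(q). Proof. by rewrite mem_primes q0 dvdn_mulr. Qed.

Let sts_four i : vanishes 2 2 (sts Kt (b2 i)).
Proof.
have hx x : x \in Kt -> coprime x.2 2 /\ (0 < x.2)%N.
  by move=> xK; rewrite coprimen2 Kt_odd // ltnW // Kt_gt1.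
elim: Kt hx => [_|x L IH hx] /=; first exact: b2_four.
have [x1 x2] := hx x (mem_head _ _); apply: st_vanishes => //.
by apply: IH => y yL; apply: hx; rewrite inE yL orbT.
Qed.

Let Q_split i n : (0 < n)%N -> Q i n = a i n + eps * dil 2 (fun m => h m - a i m) n.
Proof.
move=> n0; rewrite /Q /spart comb_KT // sts_K /a /h /dil dvdn2.
case on : (odd n) => /=.
  by rewrite mulr0 addr0 /spart; case: ifP => // _; apply: sts_odd_eq on; exact: b2_odd.
rewrite add0r; have En : n = (2 * n./2)%N by rewrite mul2n even_halfK ?on.
rewrite divn2; set m := n./2 in En *.
have [om|em] := boolP (odd m); last first.
  rewrite subrr mulr0; case: ifP => // _; apply: sts_four => //.
  by rewrite En -[(2 ^ 2)%N]/(2 * 2)%N dvdn_pmul2l // dvdn2.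
have pn : (\pi(q)).-nat n = (\pi(q)).-nat m.
  by rewrite En pnatM (pnatE _ (isT : prime 2)) piq2.
rewrite pn /spart; case: ifP => _; last by rewrite subrr mulr0.
rewrite En sts_double // (@sts_odd_eq _ (fun m => eps * (bH m - b i m))) //; last first.
  exact: b2_double.
elim: Kt m om {En pn n0 on} => [|x L IH] m om //=.
have m0 : (0 < m)%N by case: m om.
rewrite /st IH // /dil; case: ifP => xm; last by rewrite !mulr0 !addr0.
by rewrite IH ?odd_div //; ring.
Qed.

Let Kq : {subset [seq x.2 | x <- K] <= [pred n | (\pi(q)).-nat n]}.
Proof.
move=> _ /mapP[x + ->]; rewrite inE mem_rcons inE => /predU1P[->|/mapP[p pt ->]] /=.
  by rewrite (pnatE _ (isT : prime 2)).
have [_ pp] := odd_prime pt; rewrite pnatX (pnatE _ pp) mem_primes pp q0 dvdn_mull //.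
by move: pt; rewrite mem_primes => /and3P[].
Qed.

Let Q_finite i n : (q ^ (q + J) < n)%N -> Q i n = 0.
Proof.
move=> hn; rewrite /Q /spart comb_KT // -/(spart _ _ _); move: n hn; apply: spart_finite => // p pp.
rewrite Euclid_dvdM // dvdn_prime2 // => /orP[/eqP ->|pt].
  move=> n n0 pn; rewrite sts_K; apply: sts_four => //; apply: dvdn_trans pn.
  by rewrite dvdn_exp2l // (leq_trans _ (leq_addr _ _)) // leq_pmulr.
have ptt : p \in primes t by rewrite mem_primes pp t0.
move=> n n0 pn; rewrite sts_K; apply: (KP_vanishes (u := b2 i) (E := q)) (ptt) _ n0 pn => //.
- exact: primes_uniq.
- by move=> p' /odd_prime[].
move=> p' p't; have [p'o pp'] := odd_prime p't; apply: st_scales => //=; first by rewrite coprime2n.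
move=> m m0 pm; rewrite /b f_scale // natrM invfM; ring.
Qed.

Let X1 := (q ^ (q + J)).+1.

Let Q0 i n : (X1 <= n)%N -> Q i n = 0. Proof. exact: Q_finite. Qed.

Let a0 i n : (X1 <= n)%N -> a i n = 0.
Proof.
move=> hn; have [on|en] := boolP (odd n); last by rewrite /a (negbTE en).
have n0 : (0 < n)%N by exact: leq_trans hn.
by have := Q_split i n0; rewrite /dil dvdn2 on mulr0 addr0 Q0.
Qed.

Let eps_neq0 : eps != 0.
Proof. by apply: contra_eq_neq eps2 => ->; rewrite expr0n eq_sym oner_eq0. Qed.

Let eps_norm : `|eps| = 1.
Proof. by apply/eqP; rewrite -(@eqrXn2 _ 2) ?expr1n // real_normK ?num_real ?eps2. Qed.

(** Finiteness passes from [Q] and [a] to [h] through [Q_split] at [2 * n]. *)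
Let h0 n : (X1 <= n)%N -> h n = 0.
Proof.
move=> hn; have n0 : (0 < n)%N by exact: leq_trans hn.
have := Q_split i0 (_ : (0 < 2 * n)%N); rewrite muln_gt0 n0 => /(_ isT).
rewrite /dil dvdn_mulr // mulKn // Q0; last by rewrite (leq_trans hn) // leq_pmull.
rewrite {1}/a oddM /= add0r a0 // subr0 => /esym/eqP.
by rewrite mulf_eq0 (negbTE eps_neq0) => /eqP.
Qed.

Let K_small x : x \in K -> `|x.1| < 1.
Proof.
rewrite mem_rcons inE => /predU1P[->|/mapP[p pt ->]] /=.
  by rewrite normrN normrM eps_norm mul1r ger0_norm ?invr_ge0 // invf_lt1 ?ltr1n.
have [_ pp] := odd_prime pt; rewrite normrN ger0_norm ?invr_ge0 // invf_lt1 ?ltr0n ?expn_gt0 ?prime_gt0 //.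
by rewrite ltr1n -[1%N](expn0 p) ltn_exp2l ?prime_gt1 // totient_gt0.
Qed.

(** [psi] need not be square summable, but [Q i] sees only the primes dividing [q]; cutting [psi]
    down to these makes the evaluation bounded. There [Q i] takes the value of [b i] times the Euler
    factors of [K], which are nonzero because their coefficients have modulus below 1. *)
Let Q_nonvanishing i (psi : nat -> C) : cmultiplicative psi ->
  (forall p, prime p -> nm (psi p) < 1) -> ev psi X1 (Q i) != 0.
Proof.
move=> cp p1; pose psi' := cmul (fun p => if p \in primes q then psi p else 0).
have cp' : cmultiplicative psi' by exact: cmulP.
have pp' p : prime p -> psi' p = if p \in primes q then psi p else 0.
  by move=> pp; rewrite /psi' cmul_prime.
have -> : ev psi X1 (Q i) = ev psi' X1 (Q i).
  apply: eq_big_nat => n /andP[n0 _]; rewrite /Q /spart.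
  case: ifP => [/pnatP pn|_]; last by rewrite rmorph0 !mul0r.
  congr (_ * _); apply: cmult_eq => // p pp pd.
  by rewrite pp' // (pn n0 p pp pd).
have p1' p : prime p -> nm (psi' p) < 1.
  by move=> pp; rewrite pp' //; case: ifP => _; rewrite ?nm0 ?ltr01 // p1.
pose Psi := \prod_(p <- primes q) (1 - nm (psi' p) ^+ 2)^-1.
have hadm : adm psi' Psi.
  apply: adm_finite_primes => // [p|p pp /negbTE pq]; last by rewrite pp' // pq.
  by rewrite mem_primes => /andP[].
have Psi0 : 0 < Psi.
  rewrite /Psi big_seq prodr_gt0 // => p; rewrite mem_primes => /andP[pp _].
  by rewrite invr_gt0 subr_gt0 exprn_ilt1 ?nm_ge0 // p1'.
have [cB hcB] := periodic_bounded q0 (pf i).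
have tb : tail0 (b i) by exact: tail0_bounded hcB.
have [d d0 [Xa hd]] := cyclic_nonvanishing (cf i) tb Psi0.
have [_ hpsi1 _] := hadm.
have k0 : evl psi' (KT K) != 0.
  rewrite evl_KT // prodf_seq_neq0; apply/allP => x xK /=.
  apply/negP; rewrite addr_eq0 => /eqP E; have := congr1 (@nm R) E.
  rewrite nm1 nmN nmM nm_real => E1; have := K_small xK; rewrite ltNge => /negP; apply.
  by rewrite {1}E1 ler_piMr // hpsi1 //; exact: (allP wK x xK).
set kap := evl _ _ in k0.
have nk : 0 < nm kap by rewrite nm_gt0.
have e0 : 0 < nm kap * d / 2 by rewrite divr_gt0 // mulr_gt0.
have [Xb hb] := ev_comb_approx (wf_KT wK) tb e0 Psi0.
have [M0 hM] := hb (maxn Xa Xb) (leq_maxr _ _).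
have := hM (maxn M0 X1) (leq_maxl _ _) psi' hadm; have := hd (maxn Xa Xb) (leq_maxl _ _) psi' hadm.
set X := maxn Xa Xb; set M := maxn M0 X1 => h1 h2.
have <- : ev psi' M (comb (KT K) (b i)) = ev psi' X1 (Q i).
  rewrite -(@ev_widen _ _ X1 M) ?leq_maxr //; last exact: Q0.
  apply: eq_big_nat => n /andP[n0 _]; rewrite /Q /spart; case: ifP => // /negbT pn.
  rewrite rmorph0 mul0r (_ : psi' n = 0) ?mulr0 //.
  have [p pn' pq] : exists2 p, prime p && (p %| n)%N & p \notin primes q.
    apply: contrapT => hp; move/negP: pn; apply; apply/pnatP => // p pp pn.
    by apply: contrapT => /negP pq; apply: hp; exists p => //; rewrite pp.
  case/andP: pn' => pp pn'; apply: (cmult_dvd0 cp' n0 pn').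
  by rewrite pp' // (negbTE pq).
apply/negP => /eqP E; move: h2; rewrite E sub0r nmN nmM -/kap leNgt => /negP; apply.
apply: (@lt_le_trans _ _ (nm kap * d)); last by rewrite ler_pM2l.
by rewrite ltr_pdivrMr // ltr_pMr ?mulr_gt0 // ltr1n.
Qed.

Let Q_ev i (psi : nat -> C) : cmultiplicative psi ->
  ev psi X1 (Q i) = ev psi X1 (a i) + eps%:C%C * psi 2%N * (ev psi X1 h - ev psi X1 (a i)).
Proof.
move=> cp; rewrite -(@ev_widen _ _ X1 (2 * X1)) ?leq_pmull //; last exact: Q0.
have h2 n : (X1 <= n)%N -> h n - a i n = 0 by move=> hn; rewrite h0 // a0 // subrr.
rewrite (@eq_ev _ _ _ _ (fun n => a i n + eps * dil 2 (fun m => h m - a i m) n)).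
  rewrite evD (@ev_widen _ _ X1) ?leq_pmull //; last exact: a0.
  congr (_ + _); rewrite -evB -mulrA -(ev_dil cp) //.
  by rewrite /ev mulr_sumr; apply: eq_bigr => n _; rewrite rmorphM mulrA.
by move=> n /andP[n0 _]; exact: Q_split.
Qed.

Let odd_ev (psi psi' : nat -> C) (u : nat -> R) : (forall n, ~~ odd n -> u n = 0) ->
  cmultiplicative psi -> cmultiplicative psi' -> (forall p, prime p -> odd p -> psi p = psi' p) ->
  ev psi X1 u = ev psi' X1 u.
Proof.
move=> u0 cp cp' pp'; apply: eq_big_nat => n /andP[n0 _].
have [on|/u0 ->] := boolP (odd n); last by rewrite rmorph0 !mul0r.
congr (_ * _); apply: cmult_eq => // p pp pn; apply: pp' => //.
by move: on; rewrite -(divnK pn) oddM => /andP[].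
Qed.

Let a_even i n : ~~ odd n -> a i n = 0. Proof. by rewrite /a => /negbTE ->. Qed.
Let h_even n : ~~ odd n -> h n = 0. Proof. by rewrite /h => /negbTE ->. Qed.

(* [Q i] is affine in [psi 2], which is free in the unit disc. *)
Let dominated i (psi : nat -> C) : cmultiplicative psi -> (forall p, prime p -> nm (psi p) < 1) ->
  nm (ev psi X1 h) ^+ 2 <= 2 * ip (ev psi X1 (a i)) (ev psi X1 h).
Proof.
move=> cp p1; set A := ev psi X1 (a i); set B := ev psi X1 h.
suff : nm (A - B) <= nm A.
  move=> hAB; have := nm_sub_sqr A B.
  have : nm (A - B) ^+ 2 <= nm A ^+ 2 by rewrite lerXn2r ?nnegrE ?nm_ge0.
  by move: (nm _ ^+ 2) (nm _ ^+ 2) (nm _ ^+ 2) (ip _ _) => x y z w; lra.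
rewrite leNgt; apply/negP => hlt; have AB0 : 0 < nm (A - B) by apply: le_lt_trans hlt; exact: nm_ge0.
(* As [eps ^+ 2 = 1], this is the root of the affine function [A + eps * v * (B - A)]; it would lie
   in the open disc. *)
pose v := eps%:C%C * A / (A - B).
have v1 : nm v < 1.
  by rewrite /v !nmM nmV nm_real eps_norm mul1r ltr_pdivrMr ?mul1r //.
pose psi' := cmul (fun p => if p == 2%N then v else psi p).
have cp' : cmultiplicative psi' by exact: cmulP.
have p1' p : prime p -> nm (psi' p) < 1.
  by move=> pp; rewrite /psi' cmul_prime //; case: eqP => _ //; exact: p1.
have eo p : prime p -> odd p -> psi p = psi' p.
  by move=> pp po; rewrite /psi' cmul_prime //; case: eqP po => // ->.
have := Q_nonvanishing i cp' p1'; rewrite Q_ev //.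
rewrite -(odd_ev (@a_even i) cp cp' eo) -(odd_ev h_even cp cp' eo).
rewrite -/A -/B /psi' cmul_prime //= /v -(opprB A B).
have AB : A - B != 0 by rewrite -nm_gt0.
have -> : A + eps%:C%C * (eps%:C%C * A / (A - B)) * - (A - B) = A - eps%:C%C ^+ 2 * A by field.
by rewrite -rmorphXn eps2 rmorph1 mul1r subrr eqxx.
Qed.

(** Undoing the Euler factors, [h = 0] would make [H] vanish at odd smooth numbers, then at all odd
    numbers by [chi], then everywhere since [H] has the odd period [t]. *)
Let h_neq0 : exists n, (0 < n)%N /\ h n != 0.
Proof.
apply: contrapT => hn; have {}hn n : (0 < n)%N -> h n = 0.
  by move=> n0; apply: contrapT => /eqP hn'; apply: hn; exists n.
pose P := [pred n | odd n && (\pi(q)).-nat n].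
have P0 n : P n -> (0 < n)%N by move=> /andP[+ _]; case: n.
have PD x n : x \in Kt -> (0 < n)%N -> (x.2 %| n)%N -> P n -> P (n %/ x.2)%N.
  move=> _ n0 xn /andP[on pn]; rewrite /P /= odd_div //=.
  by move: pn; rewrite -{1}(divnK xn) pnatM => /andP[].
have z : forall n, P n -> sts Kt bH n = 0.
  by move=> n Pn; have := hn n (P0 n Pn); rewrite /h /spart; case/andP: Pn => -> ->.
have bH0 := @sts_inj R P Kt bH P0 PD Kt_gt1 z.
have HP n : P n -> H n = 0.
  move=> Pn; have /eqP := bH0 n Pn; rewrite /bH mulf_eq0 invr_eq0 pnatr_eq0.
  by rewrite (gtn_eqF (P0 n Pn)) orbF => /eqP.
have Hodd n : odd n -> H n = 0.
  move=> on; have n0 : (0 < n)%N by case: n on.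
  rewrite -(partnC (\pi(q)) n0) mulnC.
  have [|_ _ ->] := chiP (n := n`_(\pi(q))^').
    rewrite coprime_sym; apply: (@pnat_coprime \pi(q)); last exact: part_pnat.
    by rewrite pnat_pi.
  rewrite HP ?mulr0 // /P /= part_pnat andbT.
  by move: on; rewrite -{1}(partnC (\pi(q)) n0) oddM => /andP[].
have [n Hn] := Hn0; move/eqP: Hn; apply; have [on|en] := boolP (odd n); first exact: Hodd.
by rewrite -H_per Hodd // oddD (negbTE en) todd.
Qed.

Let exists_torus_point : exists psi : nat -> C, [/\ cmultiplicative psi,
  forall n, nm (psi n) = 1 & ev psi X1 h != 0].
Proof.
apply: contrapT => hn; have [n [n0 /eqP]] := h_neq0; apply.
have [nX|] := ltnP n X1; last exact: h0.
have := @torus_bound R X1 h 0 (lexx _); rewrite expr0n /= => hT.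
have {}hT : n2 X1 h <= 0.
  apply: hT => psi cp np; rewrite le_eqVlt nm_eq0; apply/orP; left.
  by apply: contrapT => /negP hp; apply: hn; exists psi.
apply/eqP; rewrite -sqrf_eq0 eq_le sqr_ge0 andbT; apply: le_trans hT.
rewrite /n2 (bigD1_seq n) ?mem_index_iota ?iota_uniq ?n0 //= lerDl sumr_ge0 // => m _.
exact: sqr_ge0.
Qed.

Let margin (psi : nat -> C) Y : (forall p, prime p -> nm (psi p) < 1) ->
  exists2 d : R, 0 < d & forall p, prime p -> (p < Y)%N -> nm (psi p) + 2 * d < 1.
Proof.
move=> p1; elim: Y => [|Y [d d0 hd]]; first by exists 1.
have [pY|nY] := boolP (prime Y); last first.
  exists d => // p pp; rewrite ltnS leq_eqVlt => /predU1P[pY|]; last exact: hd.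
  by move: nY; rewrite -pY pp.
exists (Num.min d ((1 - nm (psi Y)) / 4)); first by rewrite lt_min d0 divr_gt0 // subr_gt0 p1.
move=> p pp; rewrite ltnS leq_eqVlt => /predU1P[->|pY'].
  have : Num.min d ((1 - nm (psi Y)) / 4) <= (1 - nm (psi Y)) / 4 by rewrite ge_min lexx orbT.
  by have := p1 Y pY; lra.
have : Num.min d ((1 - nm (psi Y)) / 4) <= d by rewrite ge_min lexx.
by have := hd p pp pY'; lra.
Qed.

(** Join [psi] by a complex line to a torus point where [h] does not vanish, so that [h] is a
    nonzero polynomial on the line. If it vanished at [psi], then [a i0] could not, as [Q i0] is
    nonzero there; but [dominated] keeps their inner product nonnegative nearby, contradicting
    [no_zero_of_ip_ge0]. *)
Let h_zero_free (psi : nat -> C) : cmultiplicative psi -> (forall p, prime p -> nm (psi p) < 1) ->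
  ev psi X1 h != 0.
Proof.
move=> cp p1; have [psi1 [cp1 np1 hp1]] := exists_torus_point.
have [d d0 hd] := margin X1 p1.
(* Primes from [X1] on are sent to 0: they divide no index below [X1], and only finitely many primes
   then need a margin inside the unit disc. *)
pose Psi : nat -> {poly C} := cmul (fun p =>
  if (p < X1)%N then (psi p)%:P + (psi1 p - psi p)%:P * 'X else 0).
have cPsi : cmultiplicative Psi by exact: cmulP.
pose line y n := (Psi n).[y].
have cl_ y : cmultiplicative (line y).
  by case: cPsi => e1 eM; split=> [|m n m0 n0]; rewrite /line ?e1 ?hornerC // eM // hornerM.
have lp y p : prime p -> line y p = if (p < X1)%N then psi p + (psi1 p - psi p) * y else 0.
  move=> pp; rewrite /line /Psi cmul_prime //; case: ifP => _; last by rewrite horner0.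
  by rewrite hornerD hornerC hornerCM hornerX.
have le u y psi' : cmultiplicative psi' -> (forall p, psi p + (psi1 p - psi p) * y = psi' p) ->
    ev (line y) X1 u = ev psi' X1 u.
  move=> cp' hy; apply: eq_big_nat => n /andP[n0 nX]; congr (_ * _).
  apply: cmult_eq => // p pp pn; rewrite lp // hy ifT //.
  by apply: leq_ltn_trans nX; exact: dvdn_leq.
pose pol (u : nat -> R) : {poly C} := \sum_(1 <= n < X1) ((u n)%:C%C)%:P * Psi n.
have polE u y : (pol u).[y] = ev (line y) X1 u.
  by rewrite /pol horner_sum; apply: eq_bigr => n _; rewrite hornerCM.
have at0 u : (pol u).[0] = ev psi X1 u by rewrite polE; apply: le => // p; rewrite mulr0 addr0.
rewrite -at0; apply/negP => /eqP hz.
have A0 : (pol (a i0)).[0] != 0.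
  have := Q_nonvanishing i0 cp p1; rewrite Q_ev // -!at0 hz.
  by apply: contraNneq => ->; rewrite subrr mulr0 addr0.
have P0 : pol h != 0.
  apply: contraNneq hp1 => hz1; rewrite -(@le h 1 psi1) // => [|p]; last by rewrite mulr1 addrC subrK.
  by rewrite -polE hz1 horner0.
have := no_zero_of_ip_ge0 d0 P0 A0; rewrite hz eqxx => hc; apply: (notF (hc _)).
move=> y yd; rewrite !polE; have l1 p : prime p -> nm (line y p) < 1.
  move=> pp; rewrite lp //; case: ifP => [pX|_]; last by rewrite nm0 ltr01.
  apply: le_lt_trans (hd p pp pX); apply: (le_trans (nmD _ _)); rewrite lerD2l nmM.
  apply: ler_pM; rewrite ?nm_ge0 //; apply: (le_trans (nmB _ _)).
  by rewrite np1; have := p1 p pp; lra.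
have := dominated i0 (cl_ y) l1; have := sqr_ge0 (nm (ev (line y) X1 h)).
by move: (ip _ _) (_ ^+ 2) => x z; lra.
Qed.

Variable c : I -> R.
Hypothesis c0 : forall i, 0 < c i.

Let F n := \sum_i c i * f i n.
Let QF n := \sum_i c i * Q i n.

(** The sum of the inequalities [dominated] gives [|A - S B| <= |A|], and forces [A] to be nonzero
    since [B] is. A zero would mean [|A| = |psi 2| |A - S B|] with [|psi 2| < 1]. *)
Let QF_zero_free (psi : nat -> C) : cmultiplicative psi -> (forall p, prime p -> nm (psi p) < 1) ->
  ev psi X1 QF != 0.
Proof.
move=> cp p1; rewrite ev_lin; pose A := \sum_i (c i)%:C%C * ev psi X1 (a i).
pose S := \sum_i c i; set B := ev psi X1 h.
have -> : \sum_i (c i)%:C%C * ev psi X1 (Q i) = A + eps%:C%C * psi 2%N * (S%:C%C * B - A).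
  rewrite /A /S rmorph_sum mulr_suml -sumrB mulr_sumr -big_split /=.
  by apply: eq_bigr => i _; rewrite Q_ev // -/B; ring.
have S0 : 0 < S by rewrite /S (bigD1 i0) //= ltr_pwDl // sumr_ge0 // => i _; exact: ltW.
have B0 : 0 < nm B by rewrite nm_gt0; exact: h_zero_free.
have dom : S * nm B ^+ 2 <= 2 * ip A B.
  rewrite /A ip_sum /S mulr_suml mulr_sumr; apply: ler_sum => i _.
  by rewrite [leRHS]mulrCA; apply: ler_wpM2l; [exact: ltW | exact: dominated].
apply/negP; rewrite addr_eq0 => /eqP E.
have := congr1 (@nm R) E; rewrite nmN !nmM nm_real eps_norm mul1r nmBC => E1.
have e2 := nm_sub_sqr A (S%:C%C * B); rewrite ipZr nmM nm_real ger0_norm ?ltW // in e2.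
have v1 := p1 2%N isT.
have hle : nm (A - S%:C%C * B) ^+ 2 <= nm A ^+ 2.
  rewrite e2; have : 0 <= S * (2 * ip A B - S * nm B ^+ 2) by rewrite mulr_ge0 ?subr_ge0 // ltW.
  by rewrite exprMn; move: (nm A ^+ 2) (nm B ^+ 2) (ip A B) => x y z; nra.
have A0 : 0 < nm A.
  rewrite nm_gt0; apply: contraTneq dom => ->; rewrite -ltNge /ip /= !mul0r addr0 mulr0.
  by rewrite mulr_gt0 // exprn_gt0.
have := le_of_sqr (ltW A0) hle; have := nm_ge0 (A - S%:C%C * B); have := nm_ge0 (psi 2%N).
by rewrite E1; move: (nm _) (nm _) v1 A0 E1 => x y; move: (nm A) => z; nra.
Qed.

Theorem cyclic_combination : cl (fun n => F n / n%:R) (@delta1 R).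
Proof.
apply: (@cl_trans _ _ QF); last first.
  apply: (@finite_cyclic R QF X1) => [n hn|]; last exact: QF_zero_free.
  by rewrite /QF big1 // => i _; rewrite Q0 ?mulr0.
have pF m n : m = n %[mod q] -> F m = F n.
  by move=> mn; apply: eq_bigr => i _; rewrite (pf i mn).
have [B hB] := periodic_bounded q0 pF.
have cs : cl (fun n => F n / n%:R) (spart (\pi(q)) (fun n => F n / n%:R)).
  apply: (cl_spart q0 hB (chi := chi)) => p m pp pq.
  have [|_ hf _] := chiP (n := p); first by rewrite prime_coprime.
  by rewrite /F mulr_sumr; apply: eq_bigr => i _; rewrite hf mulrCA.
apply: cl_eq (cl_comb (wf_KT wK) cs) => n n0.
rewrite -spart_comb //; last first.
  apply: KT_nat => x xK; have := Kq (map_f snd xK); by rewrite inE.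
rewrite /QF /Q /spart; case: ifP => _; last by rewrite big1 // => i _; rewrite mulr0.
rewrite comb_KT //.
transitivity (sts K (fun m => \sum_i c i * b i m) n).
  congr (sts _ _ _); apply: funext => m; rewrite /F mulr_suml.
  by apply: eq_bigr => i _; rewrite /b mulrA.
by rewrite sts_lin; apply: eq_bigr => i _; rewrite comb_KT.
Qed.

End OddJumpData.

Lemma cyclic_positive_combination (R : realType) (t : nat) (I : finType) (f : I -> nat -> R)
    (H : nat -> R) (c : I -> R) (i0 : I) :
  odd t -> (forall i m n, m = n %[mod 2 * t] -> f i m = f i n) ->
  (forall i, cl (fun n => f i n / n%:R) (@delta1 R)) ->
  (forall i n, f i n + f i (n + t)%N = 2 * H n) -> (exists n, H n != 0) -> (forall i, 0 < c i) ->
  cl (fun n => (\sum_i c i * f i n) / n%:R) (@delta1 R).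
Proof.
move=> todd pf cf fH Hn0 c0; have [chi chiP] := common_multiplier todd pf cf fH Hn0 i0.
exact: (cyclic_combination todd pf cf fH Hn0 i0 chiP c0).
Qed.

(** * Discrete sine transform of step functions *)

Section SineTransform.
Variable R : realType.
Implicit Types (N n : nat) (w : nat -> R).

Lemma pi_le4 : pi <= 4 :> R.
Proof. by have [/andP[_ h] _] := pihalf_02_cos_pihalf R; move: h; rewrite ler_pdivrMr //; lra. Qed.

Lemma sin_le (x : R) : 0 <= x -> sin x <= x.
Proof.
rewrite le_eqVlt => /predU1P[<-|x0]; first by rewrite sin0.
have [c _] := @MVT R sin cos 0 x x0 (fun y _ => is_derive_sin y)
  (continuous_subspaceT (@continuous_sin R)).
by rewrite sin0 !subr0 => ->; rewrite ler_piMl ?cos_le1 // ltW.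
Qed.

Lemma sin_ge_quarter (x : R) : 0 <= x -> x <= pi / 2 -> x / 4 <= sin x.
Proof.
move=> x0 xpi; have two : pi / 2 <= 2 :> R by rewrite ler_pdivrMr //; have := pi_le4; lra.
have small (y : R) : 0 <= y -> y <= 1 -> y / 2 <= sin y.
  rewrite le_eqVlt => /predU1P[<-|y0 y1]; first by rewrite mul0r sin0.
  have [c hc] := @MVT R sin cos 0 y y0 (fun z _ => is_derive_sin z)
    (continuous_subspaceT (@continuous_sin R)).
  rewrite sin0 !subr0 => ->; rewrite mulrC ler_pM2r //.
  move: hc; rewrite in_itv /= => /andP[c0 cy].
  have -> : cos c = 1 - 2 * sin (c / 2) ^+ 2.
    have -> : cos c = cos (c / 2 + c / 2) by congr cos; field.
    by rewrite cosD -!expr2 cos2sin2; ring.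
  have h1 : sin (c / 2) <= 1 / 2 by apply: (le_trans (sin_le _)); lra.
  have h0 : 0 <= sin (c / 2) by apply: sin_ge0_pi; have := pi_ge2 R; lra.
  by move: (sin _) h0 h1 => s; nra.
have [x1|x1] := leP x 1; first by have := small x x0 x1; lra.
have : sin 1 <= sin x.
  have pi1 := pihalf_ge1 R.
  have m1 : x \in `[(- (pi / 2)), (pi / 2)] by rewrite in_itv /=; apply/andP; split; lra.
  have m2 : 1 \in `[(- (pi / 2)), (pi / 2 : R)] by rewrite in_itv /=; apply/andP; split; lra.
  by rewrite leNgt (ltr_sin m1 m2) -leNgt ltW.
by have := small 1 ler01 (lexx _); lra.
Qed.

Definition cN N (k : nat) : R := cos (k%:R * (pi / N%:R)).
Definition sN N (k : nat) : R := sin (k%:R * (pi / N%:R)).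

Lemma natr_neq0 N : (0 < N)%N -> N%:R != 0 :> R.
Proof. by rewrite pnatr_eq0 -lt0n. Qed.

Lemma rou_cN N k : (0 < N)%N -> rou R (2 * N) ^+ k = (cN N k +i* sN N k)%C.
Proof.
move=> N0; rewrite /rou expiX /expi /cN /sN; congr (cos _ +i* sin _)%C;
by rewrite natrM; field; rewrite natr_neq0.
Qed.

Lemma cN_add2N N k : (0 < N)%N -> cN N (k + 2 * N) = cN N k.
Proof.
move=> N0; rewrite /cN natrD natrM -(cosD2pi (k%:R * _)); congr cos.
by rewrite -mulr_natl; field; rewrite natr_neq0.
Qed.

Lemma cN_mod N k l : (0 < N)%N -> k = l %[mod 2 * N] -> cN N k = cN N l.
Proof.
move=> N0; have h j m : cN N (m + j * (2 * N)) = cN N m.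
  by elim: j => [|j IH]; rewrite ?addn0 // mulSn [(2 * N + _)%N]addnC addnA cN_add2N.
by move=> kl; rewrite (divn_eq k (2 * N)) (divn_eq l (2 * N)) ![(_ * _ + _)%N]addnC !h kl.
Qed.

Lemma sum_cN N k : (0 < N)%N ->
  \sum_(0 <= n < 2 * N) cN N (k * n) = if (2 * N %| k)%N then (2 * N)%:R else 0.
Proof.
move=> N0; have NN : (0 < 2 * N)%N by rewrite muln_gt0.
have -> : \sum_(0 <= n < 2 * N) cN N (k * n) = complex.Re (\sum_(0 <= n < 2 * N) rou R (2 * N) ^+ (k * n)).
  by rewrite Re_sum; apply: eq_bigr => n _; rewrite rou_cN.
rewrite sum_rou //; case: ifP => // _.
by rewrite -(rmorph_nat (real_complex R)).
Qed.

(* [fc N w n / n] is, up to the factor [2 / pi], the [n]-th sine coefficient of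
   the function equal to [w j] on [(j / N, (j + 1) / N)]. *)
Definition SN N w n : R := \sum_(0 <= j < N) w j * sN (2 * N) (n * (2 * j + 1)).
Definition fc N w n : R := \sum_(0 <= j < N) w j * (cN N (n * j) - cN N (n * j.+1)).

Lemma cos_sub (m d : R) : cos (m - d) - cos (m + d) = 2 * (sin m * sin d).
Proof. by rewrite cosB cosD; ring. Qed.

Lemma fcE N w n : (0 < N)%N -> fc N w n = 2 * sN (2 * N) n * SN N w n.
Proof.
move=> N0; rewrite /fc /SN mulr_sumr; apply: eq_bigr => j _.
rewrite [RHS]mulrCA; congr (_ * _); rewrite -mulrA [sN _ _ * _]mulrC -cos_sub /cN.
by congr (cos _ - cos _); rewrite -?[j.+1]addn1 !(natrM, natrD); field; rewrite natr_neq0.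
Qed.

Lemma sN_mul N j k n : (0 < N)%N -> (k <= 2 * N)%N ->
  sN (2 * N) (n * (2 * j + 1)) * sN (2 * N) (n * (2 * k + 1)) =
  2^-1 * (cN N ((j + (2 * N - k)) * n) - cN N ((j + k + 1) * n)).
Proof.
move=> N0 kN; have h : cN N ((j + (2 * N - k)) * n) =
    cos ((n * (2 * j + 1))%:R * (pi / (2 * N)%:R) - (n * (2 * k + 1))%:R * (pi / (2 * N)%:R)).
  have -> : (n * (2 * j + 1))%:R * (pi / (2 * N)%:R) - (n * (2 * k + 1))%:R * (pi / (2 * N)%:R) =
      (j%:R - k%:R) * n%:R * (pi / N%:R) :> R.
    by rewrite !(natrM, natrD); field; rewrite natr_neq0.
  have per (x : R) m : cos (x + m%:R * (2 * pi)) = cos x.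
    elim: m => [|m IH]; first by rewrite mul0r addr0.
    have -> : x + m.+1%:R * (2 * pi) = x + m%:R * (2 * pi) + pi *+ 2.
      by rewrite -[m.+1%:R]natr1 -[pi *+ 2]mulr_natl; ring.
    by rewrite cosD2pi.
  rewrite -(per _ n) /cN; congr (cos _); rewrite natrM natrD natrB // natrM.
  by field; rewrite natr_neq0.
rewrite h; have -> : cN N ((j + k + 1) * n) =
    cos ((n * (2 * j + 1))%:R * (pi / (2 * N)%:R) + (n * (2 * k + 1))%:R * (pi / (2 * N)%:R)).
  by rewrite /cN; congr (cos _); rewrite !(natrM, natrD); field; rewrite natr_neq0.
by rewrite cos_sub mulKf.
Qed.

(** Products of sines at midpoints become differences of cosines summed over the [2 N]-th roots of
    unity. As [j + k + 1] is never a multiple of [2 N], only [j = k] survives. *)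
Lemma parseval N w : (0 < N)%N ->
  \sum_(0 <= n < 2 * N) SN N w n ^+ 2 = N%:R * \sum_(0 <= j < N) w j ^+ 2.
Proof.
move=> N0; transitivity (\sum_(0 <= j < N) \sum_(0 <= k < N) w j * w k *
    (2^-1 * \sum_(0 <= n < 2 * N) (cN N ((j + (2 * N - k)) * n) - cN N ((j + k + 1) * n)))).
  under eq_bigr do rewrite expr2 /SN big_distrlr /=.
  rewrite exchange_big /=; apply: eq_bigr => j _; rewrite exchange_big /=.
  apply: eq_big_nat => k /andP[_ kN]; rewrite !mulr_sumr; apply: eq_bigr => n _.
  have k2 : (k <= 2 * N)%N by rewrite (leq_trans (ltnW kN)) // leq_pmull.
  by rewrite -sN_mul // mulrACA.
rewrite mulr_sumr; apply: eq_big_nat => j /andP[_ jN].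
rewrite (bigD1_seq j) ?mem_index_iota ?iota_uniq //= [X in _ + X]big_nat_cond [X in _ + X]big1 ?addr0 => [|k].
  have j2 : (j <= 2 * N)%N by rewrite (leq_trans (ltnW jN)) // leq_pmull.
  rewrite sumrB !sum_cN // subnKC // dvdnn ifF; last by apply/negP => /dvdn_leq; lia.
  by rewrite subr0 natrM; field.
move=> /andP[/andP[_ kN] kj]; rewrite sumrB !sum_cN //.
rewrite ifF; last first.
  apply/negP => /dvdnP[m E]; move: E kj => /eqP E /eqP kj; apply: kj; move/eqP: E.
  case: m => [|[|m]]; [lia|lia|].
  have : (2 * (2 * N) <= m.+2 * (2 * N))%N by rewrite leq_mul2r orbT.
  lia.
rewrite ifF; last by apply/negP => /dvdn_leq; lia.
by rewrite subrr !mulr0.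
Qed.

Lemma fc_refine N r w n : (0 < N)%N -> (0 < r)%N ->
  fc (N * r) (fun j => w (j %/ r)%N) n = fc N w n.
Proof.
move=> N0 r0; rewrite /fc sum_blocks; apply: eq_bigr => l _.
transitivity (w l * \sum_(0 <= j < r) (cN (N * r) (n * (l * r + j)) - cN (N * r) (n * (l * r + j).+1))).
  rewrite mulr_sumr; apply: eq_big_nat => j /andP[_ jr].
  by rewrite divnMDl // divn_small // addn0.
congr (_ * _).
have tel m : \sum_(0 <= j < m) (cN (N * r) (n * (l * r + j)) - cN (N * r) (n * (l * r + j).+1)) =
    cN (N * r) (n * (l * r)) - cN (N * r) (n * (l * r + m)).
  elim: m => [|m IH]; first by rewrite big_geq // addn0 subrr.
  by rewrite big_nat_recr //= IH addnS addrA subrK.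
rewrite tel; have e k : cN (N * r) (n * (k * r)) = cN N (n * k).
  by rewrite /cN; congr cos; rewrite !natrM; field; rewrite !natr_neq0.
by rewrite e; congr (_ - _); rewrite -[in X in (_ + X)%N](mul1n r) -mulnDl addn1 e.
Qed.

Lemma sum_refine N r w : (0 < r)%N ->
  \sum_(0 <= j < N * r) w (j %/ r)%N = r%:R * \sum_(0 <= j < N) w j.
Proof.
move=> r0; rewrite sum_blocks mulr_sumr; apply: eq_bigr => l _.
rewrite (eq_big_nat _ _ (F2 := fun=> w l)) => [|j /andP[_ jr]].
  by rewrite sumr_const_nat subn0 mulr_natl.
by rewrite divnMDl // divn_small // addn0.
Qed.

Lemma SN_reflect N w n : (0 < N)%N -> (n <= 2 * N)%N -> SN N w (2 * N - n) = SN N w n.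
Proof.
move=> N0 nN; apply: eq_bigr => j _; congr (_ * _); rewrite /sN.
have sp (x : R) m : sin ((2 * m + 1)%:R * pi - x) = sin x.
  elim: m => [|m IH].
    by rewrite muln0 add0n mul1r addrC sinDpi sinN opprK.
  have -> : (2 * m.+1 + 1)%:R * pi - x = (2 * m + 1)%:R * pi - x + pi *+ 2.
    by rewrite -[pi *+ 2]mulr_natl !natrD !natrM -[m.+1%:R]natr1; ring.
  by rewrite sinD2pi.
rewrite -[RHS](sp _ j); congr sin; rewrite !natrM natrB // !natrM.
by field; rewrite natr_neq0.
Qed.

(** Refining the grid changes neither side but lets one period of [SN] reach beyond [M]. Then
    [sin x <= x] and [pi <= 4] bound the coefficients by [4 / Nr] times [SN], and [parseval] sums
    the squares. *)
Lemma n2_le_energy N w M : (0 < N)%N ->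
  n2 M (fun n => fc N w n / n%:R) <= 16 * (N%:R^-1 * \sum_(0 <= j < N) w j ^+ 2).
Proof.
move=> N0; pose r := M.+1; have r0 : (0 < r)%N by [].
pose w' j := w (j %/ r)%N; have Nr0 : (0 < N * r)%N by rewrite muln_gt0 N0.
have -> : N%:R^-1 * \sum_(0 <= j < N) w j ^+ 2 = (N * r)%:R^-1 * \sum_(0 <= j < N * r) w' j ^+ 2.
  rewrite (sum_refine N (fun j => w j ^+ 2) r0) natrM.
  by field; rewrite !natr_neq0.
rewrite (@eq_n2 _ _ _ (fun n => fc (N * r) w' n / n%:R)) => [|n _]; last by rewrite fc_refine.
set Nr := (N * r)%N in Nr0 *.
have Nr1 : 0 < Nr%:R :> R by rewrite ltr0n.
apply: (@le_trans _ _ (\sum_(0 <= n < 2 * Nr) 16 / Nr%:R ^+ 2 * SN Nr w' n ^+ 2)); last first.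
  rewrite -mulr_sumr parseval // le_eqVlt; apply/orP; left; apply/eqP.
  by field; rewrite gt_eqF.
rewrite /n2; have MNr : (M <= 2 * Nr)%N.
  by rewrite /Nr /r (leq_trans (leqnSn M)) // mulnA leq_pmull // muln_gt0.
rewrite (big_nat_widen 1 M (2 * Nr) xpredT _ MNr) /=.
have Nr2 : (0 < 2 * Nr)%N by rewrite muln_gt0 Nr0.
rewrite [leRHS]big_ltn //.
have t0 n : 0 <= 16 / Nr%:R ^+ 2 * SN Nr w' n ^+ 2.
  by apply: mulr_ge0; [apply: divr_ge0 => //; exact: sqr_ge0 | exact: sqr_ge0].
rewrite -[leLHS]add0r; apply: lerD => //.
rewrite big_mkcond; apply: ler_sum_nat => n /andP[n0 nN].
case: ifP => _ //.
have n1 : 0 < n%:R :> R by rewrite ltr0n.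
have -> : 16 / Nr%:R ^+ 2 * SN Nr w' n ^+ 2 = (4 / Nr%:R * SN Nr w' n) ^+ 2.
  by field; rewrite gt_eqF.
rewrite fcE //.
rewrite -[leLHS]real_normK ?num_real // -[leRHS]real_normK ?num_real //.
rewrite lerXn2r ?nnegrE //.
rewrite !normrM mulrAC ler_wpM2r //.
have arg0 : 0 <= n%:R * (pi / (2 * Nr)%:R) :> R by rewrite mulr_ge0 ?divr_ge0 ?pi_ge0.
have s0 : 0 <= sN (2 * Nr) n.
  apply: sin_ge0_pi; rewrite arg0 /= mulrA ler_pdivrMr; last by rewrite ltr0n muln_gt0 Nr0.
  by rewrite mulrC ler_wpM2l ?pi_ge0 // ler_nat ltnW.
rewrite (ger0_norm s0) !ger0_norm ?invr_ge0 // ler_pdivrMr //.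
have hs := sin_le arg0; have p4 := pi_le4.
apply: (@le_trans _ _ (2 * (n%:R * (pi / (2 * Nr)%:R)))); first by rewrite ler_wpM2l.
have -> : 2 * (n%:R * (pi / (2 * Nr)%:R)) = pi / Nr%:R * n%:R :> R.
  by rewrite natrM; field; rewrite gt_eqF.
by rewrite ler_wpM2r // ler_wpM2r // invr_ge0.
Qed.

(** [SN] is symmetric about [N], so the indices [1 <= n <= N] carry at least half of the energy;
    there the sine in [fcE] is at least [n / (4 N)]. *)
Lemma energy_le_n2 N w : (0 < N)%N ->
  N%:R^-1 * \sum_(0 <= j < N) w j ^+ 2 <= 8 * n2 N.+1 (fun n => fc N w n / n%:R).
Proof.
move=> N0; have N1 : 0 < N%:R :> R by rewrite ltr0n.
have S0 : SN N w 0 = 0 by rewrite /SN big1 // => j _; rewrite /sN mul0n mul0r sin0 mulr0.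
have -> : N%:R^-1 * \sum_(0 <= j < N) w j ^+ 2 = (N%:R ^+ 2)^-1 * \sum_(0 <= n < 2 * N) SN N w n ^+ 2.
  by rewrite parseval //; field; rewrite gt_eqF.
have h1 : \sum_(0 <= n < 2 * N) SN N w n ^+ 2 <= 2 * \sum_(1 <= n < N.+1) SN N w n ^+ 2.
  rewrite big_ltn ?muln_gt0 // S0 expr0n add0r (big_cat_nat (n := N.+1)) //=; last by lia.
  rewrite [2 * _]mulr_natl [leRHS]mulr2n lerD2l.
  rewrite (@big_nat_rev _ _ _ N.+1) /=.
  have -> : \sum_(N.+1 <= n < 2 * N) SN N w (N.+1 + 2 * N - n.+1) ^+ 2 = \sum_(N.+1 <= n < 2 * N) SN N w (2 * N - (n - N)) ^+ 2.
    by apply: eq_big_nat => n /andP[h1 h2]; congr (SN N w _ ^+ 2); lia.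
  have -> : \sum_(N.+1 <= n < 2 * N) SN N w (2 * N - (n - N)) ^+ 2 = \sum_(N.+1 <= n < 2 * N) SN N w (n - N) ^+ 2.
    by apply: eq_big_nat => n /andP[h1 h2]; rewrite SN_reflect //; lia.
  rewrite -{1}(add1n N) big_addn.
  have -> : \sum_(1 <= i < 2 * N - N) SN N w (i + N - N) ^+ 2 = \sum_(1 <= i < N) SN N w i ^+ 2.
    by rewrite (_ : 2 * N - N = N)%N; [apply: eq_bigr => i _; rewrite addnK | lia].
  by rewrite [leRHS]big_nat_recr //= lerDl sqr_ge0.
apply: (@le_trans _ _ ((N%:R ^+ 2)^-1 * (2 * \sum_(1 <= n < N.+1) SN N w n ^+ 2))).
  by rewrite ler_wpM2l // invr_ge0 sqr_ge0.
rewrite /n2 !mulr_sumr; apply: ler_sum_nat => n /andP[n0]; rewrite ltnS => nN.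
have n1 : 0 < n%:R :> R by rewrite ltr0n.
have hs : n%:R / (4 * N%:R) <= sN (2 * N) n.
  have arg0 : 0 <= n%:R * (pi / (2 * N)%:R) :> R by rewrite mulr_ge0 ?divr_ge0 ?pi_ge0.
  have argle : n%:R * (pi / (2 * N)%:R) <= pi / 2 :> R.
    have -> : n%:R * (pi / (2 * N)%:R) = n%:R / N%:R * (pi / 2) :> R.
      by rewrite natrM; field; rewrite gt_eqF.
    rewrite ler_piMl ?divr_ge0 ?pi_ge0 // ler_pdivrMr // mul1r ler_nat //.
  apply: le_trans (sin_ge_quarter arg0 argle).
  have -> : n%:R * (pi / (2 * N)%:R) / 4 = n%:R / (4 * N%:R) * (pi / 2) :> R.
    by rewrite natrM; field; rewrite gt_eqF.
  by rewrite ler_peMr ?pihalf_ge1 // divr_ge0 ?mulr_ge0.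
have p0 : 0 <= n%:R / (4 * N%:R) :> R by rewrite divr_ge0 ?mulr_ge0.
have hs2 : (n%:R / (4 * N%:R)) ^+ 2 <= sN (2 * N) n ^+ 2.
  by rewrite lerXn2r ?nnegrE // (le_trans p0).
rewrite fcE // !exprMn exprVn.
have -> : (N%:R ^+ 2)^-1 * (2 * SN N w n ^+ 2) =
    8 * (2 ^+ 2 * (n%:R / (4 * N%:R)) ^+ 2 * SN N w n ^+ 2 / n%:R ^+ 2).
  by field; rewrite !gt_eqF.
rewrite ler_wpM2l // ler_wpM2r ?invr_ge0 ?sqr_ge0 // ler_wpM2r ?sqr_ge0 // ler_wpM2l ?sqr_ge0 //.
Qed.

End SineTransform.

Section OddExtension.
Variable R : realType.
Implicit Types (N n : nat) (v : nat -> R).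

(* Values on the cells of mesh [1 / N] of the odd 2-periodic extension. *)
Definition vext N v (s : nat) : R :=
  let r := (s %% (2 * N))%N in if (r < N)%N then v r else - v (2 * N - r.+1)%N.

Lemma vext_per N v s m : s = m %[mod 2 * N] -> vext N v s = vext N v m.
Proof. by rewrite /vext => ->. Qed.

Lemma vext_odd N v s m : (0 < N)%N -> (s + m.+1 = 0 %[mod 2 * N])%N -> vext N v m = - vext N v s.
Proof.
move=> N0 sm; have NN : (0 < 2 * N)%N by rewrite muln_gt0.
have h : (m %% (2 * N) = 2 * N - (s %% (2 * N)).+1)%N.
  have := ltn_pmod s NN; have := ltn_pmod m NN.
  have /eqP : (s %% (2 * N) + (m %% (2 * N)).+1 = 0 %[mod 2 * N])%N.
    by rewrite -addSnnS modnDmr addSnnS modnDml.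
  rewrite mod0n => /dvdnP[k]; move: (s %% _)%N (m %% _)%N => a b E aN bN.
  case: k E => [|[|k]] E; [lia|lia|].
  have : (2 * (2 * N) <= k.+2 * (2 * N))%N by rewrite leq_mul2r orbT.
  lia.
rewrite /vext h; have := ltn_pmod s NN; move: (s %% _)%N => a aN.
have -> : (2 * N - (2 * N - a.+1).+1 = a)%N by rewrite subnSK // subKn // ltnW.
case: (ltnP a N) => h1; case: (ltnP (2 * N - a.+1) N) => h2 //; rewrite ?opprK //; lia.
Qed.

Lemma vext_small N v s : (s < N)%N -> vext N v s = v s.
Proof.
move=> sN; rewrite /vext modn_small ?sN // (leq_trans sN) // leq_pmull //.
Qed.

Lemma fc_ext N v n : (0 < N)%N ->
  fc N v n = 2^-1 * \sum_(0 <= s < 2 * N) vext N v s * (cN R N (n * s) - cN R N (n * s.+1)).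
Proof.
move=> N0; rewrite (big_cat_nat (n := N)) //=; last by lia.
have -> : \sum_(0 <= s < N) vext N v s * (cN R N (n * s) - cN R N (n * s.+1)) = fc N v n.
  by apply: eq_big_nat => s /andP[_ sN]; rewrite vext_small.
have -> : \sum_(N <= s < 2 * N) vext N v s * (cN R N (n * s) - cN R N (n * s.+1)) = fc N v n.
  rewrite big_nat_rev -{1}(add0n N) big_addn (_ : 2 * N - N = N)%N; last by lia.
  apply: eq_big_nat => s /andP[_ sN].
  rewrite (_ : N + 2 * N - (s + N).+1 = 2 * N - s.+1)%N; last by lia.
  rewrite (@vext_odd _ _ s) //; last first.
    by rewrite (_ : s + (2 * N - s.+1).+1 = 2 * N)%N; [rewrite modnn mod0n | lia].
  rewrite vext_small // (_ : (2 * N - s.+1).+1 = 2 * N - s)%N; last by lia.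
  have e a : (a <= 2 * N)%N -> cN R N (n * (2 * N - a)) = cN R N (n * a).
    move=> aN; rewrite /cN -[RHS]cosN -[RHS](periodicn (@cosD2pi R) n).
    congr (cos _); rewrite natrM natrB // !natrM -mulrnA -[pi *+ _]mulr_natl natrM.
    by field; rewrite natr_neq0.
  by rewrite !e; [ring | lia | lia].
by field.
Qed.

End OddExtension.

Section Dilation.
Variable R : realType.
Implicit Types (N n : nat) (v : nat -> R).

Lemma sum_cN_rotations N k n r : (0 < N)%N -> (0 < k)%N ->
  \sum_(0 <= l < k) cN R (N * k) (n * (l * (2 * N) + r)) =
  if (k %| n)%N then k%:R * cN R N ((n %/ k) * r) else 0.
Proof.
move=> N0 k0; have Nk : (0 < N * k)%N by rewrite muln_gt0 N0.
have -> : \sum_(0 <= l < k) cN R (N * k) (n * (l * (2 * N) + r)) =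
   complex.Re (rou R (2 * (N * k)) ^+ (n * r) * \sum_(0 <= l < k) rou R k ^+ (n * l)).
  rewrite mulr_sumr Re_sum; apply: eq_bigr => l _.
  have -> : rou R k ^+ (n * l) = rou R (2 * (N * k)) ^+ (2 * N * (n * l)).
    rewrite /rou !expiX; congr expi; rewrite !natrM; field.
    by rewrite !natr_neq0.
  by rewrite -exprD rou_cN //=; congr (cN _ _ _); ring.
rewrite sum_rou //; case: ifP => [kn|_]; last by rewrite mulr0.
rewrite rou_cN // -(rmorph_nat (real_complex R)) mulrC ReZ /=; congr (_ * _).
rewrite /cN; congr (cos _); rewrite -{1}(divnK kn) !natrM; field.
by rewrite !natr_neq0.
Qed.

(** Over a full period of the fine grid the extension repeats [k] times. Summing the [k] rotated
    cosines leaves only the frequencies divisible by [k]. *)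
Lemma fc_dilate N k v n : (0 < N)%N -> (0 < k)%N ->
  fc (N * k) (vext N v) n = if (k %| n)%N then k%:R * fc N v (n %/ k) else 0.
Proof.
move=> N0 k0; have Nk : (0 < N * k)%N by rewrite muln_gt0 N0.
have -> : fc (N * k) (vext N v) n = 2^-1 * \sum_(0 <= s < k * (2 * N)) vext N v s *
    (cN R (N * k) (n * s) - cN R (N * k) (n * s.+1)).
  rewrite fc_ext // (_ : 2 * (N * k) = k * (2 * N))%N; last by ring.
  congr (_ * _); apply: eq_big_nat => s /andP[_ sN]; congr (_ * _).
  have [h|h] := ltnP s (N * k); first by rewrite vext_small.
  have e : (s + (2 * (N * k) - s.+1).+1 = 2 * (N * k))%N by lia.
  rewrite (@vext_odd _ (N * k) _ (2 * (N * k) - s.+1)) //; last first.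
    by rewrite -addSnnS addnC e modnn mod0n.
  rewrite vext_small; last by lia.
  rewrite -(@vext_odd _ N _ _ s) // -addSnnS addnC e.
  by rewrite (_ : 2 * (N * k) = k * (2 * N))%N ?modnMl ?mod0n //; ring.
rewrite sum_blocks exchange_big /=.
have -> : \sum_(0 <= j < 2 * N) \sum_(0 <= l < k) vext N v (l * (2 * N) + j) *
    (cN R (N * k) (n * (l * (2 * N) + j)) - cN R (N * k) (n * (l * (2 * N) + j).+1)) =
   \sum_(0 <= j < 2 * N) vext N v j * (if (k %| n)%N then
     k%:R * (cN R N ((n %/ k) * j) - cN R N ((n %/ k) * j.+1)) else 0).
  apply: eq_bigr => j _.
  under eq_bigr => l _.
    rewrite (@vext_per _ N v _ j) ?modnMDl // -addnS.
    over.
  rewrite -mulr_sumr sumrB !sum_cN_rotations //; case: ifP => _; last by rewrite subrr.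
  by congr (_ * _); rewrite mulrBr.
case: ifP => kn; last by rewrite big1 ?mulr0 // => j _; rewrite mulr0.
rewrite fc_ext // mulrCA; congr (_ * _); rewrite mulr_sumr; apply: eq_bigr => j _.
by rewrite mulrCA.
Qed.

End Dilation.

(** * A step function close to the first sine *)

Section SampledSine.
Variables (R : realType) (P : nat).
Hypothesis P1 : (1 < P)%N.
Let P0 : (0 < P)%N := ltnW P1.

(** Midpoint samples of [sin (pi x)]. Over one period the transform [SN] is carried by [n = 1] and
    its mirror image, so this step function can stand in for the sine. *)
Definition sampled_sine (j : nat) : R := sN R (2 * P) (2 * j + 1).
Local Notation w := sampled_sine.

Let sqr_sum : \sum_(0 <= j < P) w j ^+ 2 = P%:R / 2.
Proof.
have e j : w j ^+ 2 = 2^-1 * (1 - cN R P (2 * j + 1)).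
  have := @cos_sub R ((2 * j + 1)%:R * (pi / (2 * P)%:R)) ((2 * j + 1)%:R * (pi / (2 * P)%:R)).
  rewrite subrr cos0 -expr2 -/(sN R (2 * P) _) -/(w j) => h.
  rewrite /cN (_ : (2 * j + 1)%:R * (pi / P%:R) = (2 * j + 1)%:R * (pi / (2 * P)%:R) + (2 * j + 1)%:R * (pi / (2 * P)%:R)).
    by rewrite h mulKf.
  by rewrite [(2 * P)%:R]natrM; field; rewrite natr_neq0.
rewrite (eq_bigr _ (fun j _ => e j)) -mulr_sumr sumrB sumr_const_nat subn0.
have -> : \sum_(0 <= j < P) cN R P (2 * j + 1) =
    complex.Re (rou R (2 * P) * \sum_(0 <= j < P) rou R P ^+ (1 * j)).
  rewrite mulr_sumr Re_sum; apply: eq_bigr => j _.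
  have -> : rou R P ^+ (1 * j) = rou R (2 * P) ^+ (2 * j).
    rewrite /rou !expiX; congr expi; rewrite !natrM; field.
    by rewrite natr_neq0.
  by rewrite -exprS rou_cN //= addn1.
have -> : \sum_(0 <= j < P) rou R P ^+ (1 * j) = 0.
  rewrite sum_rou // ifF //; apply/negP; rewrite dvdn1 => /eqP h.
  by move: P1; rewrite h.
by rewrite mulr0 /= subr0 mulrC.
Qed.

Let SN1 : SN P w 1 = P%:R / 2.
Proof. by rewrite -sqr_sum; apply: eq_bigr => j _; rewrite mul1n expr2. Qed.

Let SN_last : SN P w (2 * P - 1) = P%:R / 2.
Proof. by rewrite SN_reflect //; lia. Qed.

(* [SN 1] and [SN (2 P - 1)] exhaust the total energy given by [parseval]. *)
Let SN_other n : (n < 2 * P)%N -> n != 1%N -> n != (2 * P - 1)%N -> SN P w n = 0.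
Proof.
move=> nP n1 n2; have := parseval w P0; rewrite sqr_sum.
have l1 : (1 < 2 * P)%N by lia.
have l2 : (2 * P - 1 < 2 * P)%N by lia.
have l12 : (2 * P - 1 != 1)%N by lia.
rewrite big_mkord (bigD1 (Ordinal l1)) //= (bigD1 (Ordinal l2)) -?val_eqE //=.
rewrite (bigD1 (Ordinal nP)) -?val_eqE /= ?n1 ?n2 //.
rewrite SN1 SN_last; set A := SN P w n; set B := \sum_(_ < _ | _) _ => h.
have B0 : 0 <= B by apply: sumr_ge0 => i _; exact: sqr_ge0.
apply/eqP; rewrite -sqrf_eq0 eq_le sqr_ge0 andbT.
by move: h; move: (A ^+ 2) => x; nra.
Qed.

Let prod_per n : `|sN R (2 * P) (n + 2 * P) * SN P w (n + 2 * P)| = `|sN R (2 * P) n * SN P w n|.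
Proof.
have s1 : sN R (2 * P) (n + 2 * P) = - sN R (2 * P) n.
  rewrite /sN -sinDpi; congr (sin _); rewrite natrD natrM.
  by field; rewrite natr_neq0.
have s2 : SN P w (n + 2 * P) = - SN P w n.
  rewrite /SN -sumrN; apply: eq_bigr => j _; rewrite -mulrN; congr (_ * _).
  rewrite /sN -sinDpi -[RHS](periodicn (@sinD2pi R) j); congr (sin _).
  rewrite -mulrnA -[pi *+ _]mulr_natl !(natrM, natrD).
  by field; rewrite natr_neq0.
by rewrite s1 s2 mulrNN.
Qed.

Let sN1 : (2 * P)%:R^-1 / 2 <= sN R (2 * P) 1 /\ sN R (2 * P) 1 <= 4 / (2 * P)%:R.
Proof.
have PP : 0 < (2 * P)%:R :> R by rewrite ltr0n muln_gt0.
have a0 : 0 <= 1%:R * (pi / (2 * P)%:R) :> R by rewrite mul1r divr_ge0 ?pi_ge0.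
have p2 : 2 <= (2 * P)%:R :> R by rewrite ler_nat; lia.
split.
  apply: le_trans (sin_ge_quarter a0 _).
    have x0 : 0 <= (2 * P)%:R^-1 :> R by rewrite invr_ge0.
    by rewrite mul1r; have := pi_ge2 R; move: (_^-1) x0 => x x0; nra.
  by rewrite mul1r ler_wpM2l ?pi_ge0 // lef_pV2 ?posrE.
apply: (le_trans (sin_le a0)); rewrite mul1r ler_wpM2r ?invr_ge0 //.
exact: pi_le4.
Qed.

Let fc_bound n : `|fc P w n| <= 2.
Proof.
have P2 : 0 < P%:R :> R by rewrite ltr0n.
rewrite fcE // -mulrA normrM ger0_norm // -[leRHS]mulr1 ler_wpM2l //.
have r n' : (n' < 2 * P)%N -> `|sN R (2 * P) n' * SN P w n'| <= 1.
  move=> nP; have [s1 s2] := sN1.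
  have s0 : 0 <= sN R (2 * P) 1 by apply: le_trans s1; rewrite divr_ge0 // invr_ge0.
  have b1 : `|sN R (2 * P) 1 * (P%:R / 2)| <= 1.
    rewrite ger0_norm ?mulr_ge0 ?divr_ge0 //.
    apply: (@le_trans _ _ (4 / (2 * P)%:R * (P%:R / 2))); first by rewrite ler_wpM2r ?divr_ge0.
    by rewrite le_eqVlt; apply/orP; left; apply/eqP; rewrite natrM; field; rewrite gt_eqF.
  have [->|n1] := eqVneq n' 1%N; first by rewrite SN1.
  have [->|n2] := eqVneq n' (2 * P - 1)%N; last by rewrite SN_other // mulr0 normr0.
  rewrite SN_last (_ : sN R (2 * P) (2 * P - 1) = sN R (2 * P) 1) //.
  rewrite /sN -[RHS](opprK) -sinN -sinDpi; congr (sin _).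
  rewrite natrB ?muln_gt0 //; field; rewrite pnatr_eq0; lia.
have -> : `|sN R (2 * P) n * SN P w n| = `|sN R (2 * P) (n %% (2 * P)) * SN P w (n %% (2 * P))|.
  rewrite {1 2}(divn_eq n (2 * P)); elim: (n %/ _)%N => [|k IH]; first by rewrite mul0n add0n.
  by rewrite (_ : k.+1 * (2 * P) + n %% (2 * P) = k * (2 * P) + n %% (2 * P) + 2 * P)%N ?prod_per //; ring.
by apply: r; rewrite ltn_pmod // muln_gt0.
Qed.

Lemma sampled_sine_coef1 : 4^-1 <= fc P w 1.
Proof.
have P2 : 0 < P%:R :> R by rewrite ltr0n.
rewrite fcE // SN1; have [s1 _] := sN1.
apply: (@le_trans _ _ (2 * ((2 * P)%:R^-1 / 2) * (P%:R / 2))); last first.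
  by rewrite ler_wpM2r ?divr_ge0 // ler_wpM2l.
by rewrite natrM le_eqVlt; apply/orP; left; apply/eqP; field; rewrite gt_eqF.
Qed.

(** Exact below [2 P - 1]. From there on [|fc P w n| <= 2] and [fc P w 1 >= 1/4] bound the
    normalized coefficients by [8 / n], and [64 * 2 = 128]. *)
Lemma sampled_sine_delta N :
  n2 N (fun n => (fc P w 1)^-1 * (fc P w n / n%:R) - delta1 R n) <= 128 / (2 * P - 1)%:R.
Proof.
have f1 : fc P w 1 != 0 by rewrite gt_eqF // (lt_le_trans _ sampled_sine_coef1).
have PP : (0 < 2 * P - 1)%N by lia.
have tail : \sum_(2 * P - 1 <= n < N) ((fc P w 1)^-1 * (fc P w n / n%:R) - delta1 R n) ^+ 2 <= 128 / (2 * P - 1)%:R.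
  apply: (@le_trans _ _ (64 * \sum_(2 * P - 1 <= n < N) (n%:R ^+ 2)^-1)); last first.
    apply: (@le_trans _ _ (64 * (2 / (2 * P - 1)%:R))); last by rewrite mulrA -natrM.
    by rewrite ler_wpM2l // sum_inv_sqr_tail.
  rewrite mulr_sumr; apply: ler_sum_nat => n /andP[nP _].
  have n1 : n != 1%N by lia.
  rewrite /delta1 (negbTE n1) subr0 mulrA expr_div_n ler_wpM2r ?invr_ge0 ?sqr_ge0 //.
  have -> : 64 = 8 ^+ 2 :> R by ring.
  rewrite -[leLHS]real_normK ?num_real // lerXn2r ?nnegrE //.
  rewrite normrM normfV; have h : `|fc P w 1|^-1 <= 4.
    by rewrite -[leRHS]invrK lef_pV2 ?posrE ?normr_gt0 // (le_trans sampled_sine_coef1) // ler_norm.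
  have -> : 8 = 4 * 2 :> R by ring.
  by rewrite ler_pM ?invr_ge0.
have z n : (0 < n < 2 * P - 1)%N -> (fc P w 1)^-1 * (fc P w n / n%:R) - delta1 R n = 0.
  move=> /andP[n0 nP]; rewrite /delta1; have [->|n1] := eqVneq n 1%N.
    by rewrite divr1 mulVf // subrr.
  have n2 : (n < 2 * P)%N by apply: leq_trans nP _; exact: leq_subr.
  have n3 : n != (2 * P - 1)%N by rewrite ltn_eqF.
  by rewrite [fc P w n]fcE // (SN_other n2 n1 n3) mulr0 mul0r mulr0 subr0.
have [NP|PN] := leqP N (2 * P - 1).
  rewrite /n2 big_nat big1 ?divr_ge0 // => n /andP[n0 nN].
  by rewrite z ?expr0n // n0 (leq_trans nN).
rewrite /n2 (big_cat_nat (n := (2 * P - 1)%N)) ?(ltnW PN) //= [X in X + _]big_nat [X in X + _]big1 ?add0r //.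
by move=> n hn; rewrite z ?expr0n.
Qed.

End SampledSine.

(** * Step functions in L2 *)

Section GridFunctions.
Variable R : realType.
Local Notation mu := (@lebesgue_measure R).
Implicit Types (u : R -> R) (w v : nat -> R) (N : nat).

(** The finite exceptional set [E] absorbs the values at the break points, which a step function
    leaves free. *)
Definition grid u N w := exists E : seq R, forall j x, (j < N)%N ->
  j%:R / N%:R < x -> x < j.+1%:R / N%:R -> x \notin E -> u x = w j.

Lemma grid_lin (a : R) u u' N w w' : grid u N w -> grid u' N w' ->
  grid (fun x => a * u x + u' x) N (fun j => a * w j + w' j).
Proof.
move=> [E hE] [E' hE']; exists (E ++ E') => j x jN x0 x1.
by rewrite mem_cat negb_or => /andP[xE xE']; rewrite (hE j) ?(hE' j).
Qed.

Lemma grid_refine u N r w : (0 < N)%N -> (0 < r)%N -> grid u N w ->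
  grid u (N * r) (fun j => w (j %/ r)%N).
Proof.
move=> N0 r0 [E hE]; exists E => j x jN x0 x1; apply: hE.
- by rewrite ltn_divLR.
- apply: le_lt_trans x0; rewrite ler_pdivrMr ?ltr0n // mulrAC ler_pdivlMr ?ltr0n ?muln_gt0 ?N0 //.
  by rewrite -!natrM ler_nat mulnCA mulnC leq_mul2r leq_divM orbT.
apply: (lt_le_trans x1); rewrite ler_pdivrMr ?ltr0n ?muln_gt0 ?N0 // mulrAC ler_pdivlMr ?ltr0n //.
by rewrite -!natrM ler_nat mulnCA mulnC leq_mul2l -ltn_divLR // ltnSn orbT.
Qed.

Lemma grid_eq u u' N w w' : (forall x, 0 < x < 1 -> u x = u' x) -> (forall j, (j < N)%N -> w j = w' j) ->
  grid u N w -> grid u' N w'.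
Proof.
move=> uu ww [E hE]; exists E => j x jN x0 x1 xE; rewrite -ww // -(hE j x) // uu //.
have N0 : 0 < N%:R :> R by rewrite ltr0n (leq_trans _ jN).
rewrite (le_lt_trans _ x0) ?divr_ge0 //= (lt_le_trans x1) // ler_pdivrMr // mul1r.
by rewrite ler_nat.
Qed.

Lemma finite_negligible (E : seq R) : mu.-negligible [set` E].
Proof.
have cE : countable [set` E]%classic by apply: finite_set_countable; exact: finite_seq.
exists [set` E]%classic; split => //; last exact: countable_lebesgue_measure0.
exact: countable_measurable.
Qed.

Lemma grid_cell N (x : R) : (0 < N)%N -> 0 < x < 1 ->
  (forall j, (j <= N)%N -> x != j%:R / N%:R) ->
  exists2 j, (j < N)%N & j%:R / N%:R < x < j.+1%:R / N%:R.
Proof.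
move=> N0 /andP[x0 x1] hx; have N1 : 0 < N%:R :> R by rewrite ltr0n.
have xN0 : 0 <= x * N%:R by rewrite mulr_ge0 ?ltW.
have /andP[t1 t2] := truncn_itv xN0; set j := Num.truncn _ in t1 t2 *.
have jN : (j < N)%N.
  rewrite -(ltr_nat R) (le_lt_trans t1) // -[ltRHS]mul1r ltr_pM2r //.
exists j => //; rewrite lt_neqAle eq_sym hx ?(ltnW jN) //= ler_pdivrMr // t1 /=.
by rewrite ltr_pdivlMr.
Qed.

Lemma measurable_modulo_finite (D : set R) (u F : R -> R) (E : seq R) :
  measurable D -> measurable_fun D F ->
  (forall x, D x -> x \notin E -> u x = F x) -> measurable_fun D u.
Proof.
move=> mD mF; elim: E u => [|e E IH] u h.
  by apply: eq_measurable_fun mF => x; rewrite inE => /h ->.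
pose u' x := if x == e then F e else u x.
have mu' : measurable_fun D u'.
  apply: IH => x Dx xE; rewrite /u'; case: eqP => [->//|/eqP xe].
  by apply: h => //; rewrite inE negb_or xe.
have DE : D = ((D `\ e) `|` (D `&` [set e]))%classic by rewrite setUC setUIDK.
rewrite DE; apply/measurable_funU.
- exact: measurableD.
- exact: measurableI.
split.
  apply: (@eq_measurable_fun _ _ _ _ _ u').
    by move=> x; rewrite inE => -[_ /eqP xe]; rewrite /u' (negbTE xe).
  apply: measurable_funS mu' => //; exact: subDsetl.
apply: (measurable_funS (measurable_set1 e)); first exact: subIsetr.
exact: measurable_fun_set1.
Qed.

Lemma measurableI01 : measurable (@I01 R).
Proof. exact: measurable_itv. Qed.

Lemma grid_inL2 u N w : (0 < N)%N -> grid u N w ->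
  inL2 u /\ (\int[mu]_(x in @I01 R) ((u x) ^+ 2)%:E = (N%:R^-1 * \sum_(0 <= j < N) w j ^+ 2)%:E)%E.
Proof.
move=> N0 [E hE]; have N1 : 0 < N%:R :> R by rewrite ltr0n.
pose B j : set R := `]j%:R / N%:R, j.+1%:R / N%:R[%classic.
have mB j : measurable (B j) by exact: measurable_itv.
pose F x : R := \sum_(j <- index_iota 0 N) w j * \1_(B j) x.
pose E' := E ++ [seq j%:R / N%:R | j <- index_iota 0 N.+1].
have Bx j x : (j < N)%N -> B j x -> forall i, (i < N)%N -> \1_(B i) x = (i == j)%:R :> R.
  move=> jN; rewrite /B /= in_itv /= => /andP[x0 x1] i iN; rewrite indicE.
  have [->|ij] := eqVneq i j; first by rewrite mem_set //= in_itv /= x0.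
  rewrite memNset //= in_itv /= => /andP[y0 y1]; move/negP: ij; apply.
  have := lt_trans x0 y1; have := lt_trans y0 x1.
  by rewrite !ltr_pM2r ?invr_gt0 // !ltr_nat !ltnS eqn_leq => -> ->.
have cell x : @I01 R x -> x \notin E' -> exists2 j, (j < N)%N & B j x /\ x \notin E.
  rewrite /I01 /= in_itv /= => x01; rewrite mem_cat negb_or => /andP[xE xg].
  have hg j : (j <= N)%N -> x != j%:R / N%:R.
    by move=> jN; apply: contraNneq xg => ->; apply/mapP; exists j; rewrite // mem_index_iota.
  have [j jN jx] := grid_cell N0 x01 hg.
  by exists j => //; split=> //; rewrite /B /= in_itv.
have sumF (c : nat -> R) j x : (j < N)%N -> B j x -> \sum_(i <- index_iota 0 N) c i * \1_(B i) x = c j.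
  move=> jN jx; rewrite (bigD1_seq j) ?mem_index_iota ?iota_uniq //= (Bx j) // eqxx mulr1.
  rewrite big_nat_cond big1 ?addr0 // => i /andP[/andP[_ iN] ij].
  by rewrite (Bx j) // (negbTE ij) mulr0.
have uF x : @I01 R x -> x \notin E' -> u x = F x.
  move=> x01 xE'; have [j jN [jx xE]] := cell x x01 xE'.
  rewrite /F (sumF _ j) //; move: jx; rewrite /B /= in_itv /= => /andP[x0 x1].
  exact: hE.
have mI j : measurable_fun (@I01 R) (\1_(B j) : R -> R) by exact: measurable_indic.
have mF : measurable_fun (@I01 R) F.
  by apply: measurable_sum => j; apply: measurable_funM; [exact: measurable_cst | exact: mI].
have mu_ : measurable_fun (@I01 R) u.
  apply: measurable_modulo_finite uF => //; exact: measurableI01.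
have I_eq : (\int[mu]_(x in @I01 R) ((u x) ^+ 2)%:E = (N%:R^-1 * \sum_(0 <= j < N) w j ^+ 2)%:E)%E.
  pose F2 (x : R) : \bar R := (\sum_(j <- index_iota 0 N) ((w j ^+ 2)%:E * (\1_(B j) x)%:E))%E.
  have F2E x : F2 x = (\sum_(j <- index_iota 0 N) w j ^+ 2 * \1_(B j) x)%:E.
    by rewrite /F2 sumEFin.
  transitivity (\int[mu]_(x in @I01 R) F2 x)%E.
    apply: ae_eq_integral.
    - exact: measurableI01.
    - by apply/measurable_EFinP; apply: measurable_funX.
    - rewrite (funext F2E); apply/measurable_EFinP; apply: measurable_sum => j.
      by apply: measurable_funM; [exact: measurable_cst | exact: mI].
    apply: negligibleS (finite_negligible E') => x /= hx; apply: contrapT => /negP xE'.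
    apply: hx => x01; have [j jN [jx xE]] := cell x x01 xE'.
    by rewrite F2E (sumF (fun j => w j ^+ 2) j) // (uF x) // /F (sumF _ j).
  rewrite /F2 ge0_integral_sum; last 3 first.
  - exact: measurableI01.
  - by move=> j; apply: measurable_funeM; apply/measurable_EFinP; exact: mI.
  - by move=> j x _; rewrite mule_ge0 // lee_fin ?sqr_ge0.
  rewrite mulr_sumr -sumEFin; apply: eq_big_nat => j /andP[_ jN].
  rewrite ge0_integralZl_EFin ?sqr_ge0 //; last 2 first.
  - exact: measurableI01.
  - by apply/measurable_EFinP; exact: mI.
  transitivity ((w j ^+ 2)%:E * mu (B j `&` @I01 R))%E.
    by congr (_ * _)%E; exact: (integral_indic mu measurableI01 (mB j)).
  rewrite (_ : (B j `&` @I01 R)%classic = B j); last first.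
    apply/setIidl => x; rewrite /B /I01 /= !in_itv /= => /andP[x0 x1].
    rewrite (le_lt_trans _ x0) ?divr_ge0 //= (lt_le_trans x1) // ler_pdivrMr // mul1r ler_nat //.
  rewrite /B lebesgue_measure_itv /= lte_fin ltr_pM2r ?invr_gt0 // ltr_nat ltnSn.
  rewrite -EFinB -EFinM -mulrBl -[j.+1%:R]natr1 addrAC subrr add0r mul1r mulrC //.
split=> //; split=> //.
by rewrite I_eq ltry.
Qed.

End GridFunctions.

Section Coefficients.
Variable R : realType.
Local Notation mu := (@lebesgue_measure R).
Implicit Types (u phi : R -> R) (b : nat -> R).

(** The mesh is hidden so that functions on different grids can be added, by passing to a common
    refinement. *)
Definition has_coef u b := exists N w, [/\ (0 < N)%N, grid u N w &
  forall n, (0 < n)%N -> b n = fc N w n / n%:R].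

Lemma fc_lin (a : R) N w w' n : fc N (fun j => a * w j + w' j) n = a * fc N w n + fc N w' n.
Proof. by rewrite /fc mulr_sumr -big_split /=; apply: eq_bigr => j _; ring. Qed.

Lemma has_coef_lin (a : R) u b u' b' : has_coef u b -> has_coef u' b' ->
  has_coef (fun x => a * u x + u' x) (fun n => a * b n + b' n).
Proof.
move=> [N [w [N0 gw bw]]] [N' [w' [N0' gw' bw']]].
exists (N * N')%N, (fun j => a * w (j %/ N')%N + w' (j %/ N)%N); split.
- by rewrite muln_gt0 N0.
- by apply: grid_lin; [exact: grid_refine | rewrite mulnC; exact: grid_refine].
move=> n n0; rewrite fc_lin fc_refine // [(N * N')%N]mulnC fc_refine // bw // bw' //.
by rewrite mulrDl mulrA.
Qed.

Lemma has_coef0 : has_coef (fun=> 0) (fun=> 0).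
Proof.
exists 1%N, (fun=> 0); split=> //; first by exists [::].
by move=> n _; rewrite /fc big1 ?mul0r // => j _; rewrite mul0r.
Qed.

Lemma has_coef_sum (I : Type) (s : seq I) (c : I -> R) (u : I -> R -> R) (b : I -> nat -> R) :
  (forall i, has_coef (u i) (b i)) ->
  has_coef (fun x => \sum_(i <- s) c i * u i x) (fun n => \sum_(i <- s) c i * b i n).
Proof.
move=> ub; elim: s => [|i s IH].
  under [X in has_coef X]eq_fun do rewrite big_nil.
  under [X in has_coef _ X]eq_fun do rewrite big_nil.
  exact: has_coef0.
under [X in has_coef X]eq_fun do rewrite big_cons.
under [X in has_coef _ X]eq_fun do rewrite big_cons.
exact: has_coef_lin.
Qed.

Lemma has_coef_eq u u' b b' : (forall x, 0 < x < 1 -> u x = u' x) ->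
  (forall n, (0 < n)%N -> b n = b' n) -> has_coef u b -> has_coef u' b'.
Proof.
move=> uu bb [N [w [N0 gw bw]]]; exists N, w; split=> //; first exact: grid_eq gw.
by move=> n n0; rewrite -bb // bw.
Qed.

Lemma has_coef_inL2 u b : has_coef u b -> inL2 u.
Proof. by move=> [N [w [N0 gw _]]]; have [] := grid_inL2 N0 gw. Qed.

(** Two-sided comparison of the L2 norm with the l2 norm, enough to carry approximation across in
    both directions. *)
Lemma has_coef_energy u b : has_coef u b -> exists I : R,
  [/\ (\int[mu]_(x in @I01 R) ((u x) ^+ 2)%:E = I%:E)%E, forall M, n2 M b <= 16 * I &
      exists M, I <= 8 * n2 M b].
Proof.
move=> [N [w [N0 gw bw]]]; have [_ hI] := grid_inL2 N0 gw.
exists (N%:R^-1 * \sum_(0 <= j < N) w j ^+ 2); split=> // [M|].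
  by rewrite (eq_n2 _ bw) n2_le_energy.
by exists N.+1; rewrite (eq_n2 _ bw) energy_le_n2.
Qed.

Lemma has_coef_tail0 u b : has_coef u b -> tail0 b.
Proof.
move=> [N [w [N0 gw bw]]].
have h : tail0 (fun n => fc N w n / n%:R).
  apply: (@tail0_bounded _ _ (\sum_(0 <= j < N) `|w j| * 2)) => n.
  apply: (le_trans (ler_norm_sum _ _ _)); apply: ler_sum => j _.
  rewrite normrM ler_wpM2l //; apply: (le_trans (ler_normB _ _)).
  by rewrite -[2]/(1 + 1) lerD // /cN ler_norml cos_geN1 cos_le1.
move=> e e0; have [X0 hX] := h e e0; exists X0.+1 => X N' hXX.
apply: le_trans (hX X N' (ltnW hXX)); rewrite le_eqVlt; apply/orP; left; apply/eqP.
apply: eq_big_nat => n /andP[Xn _]; rewrite bw //.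
by apply: leq_trans Xn; apply: leq_trans hXX.
Qed.

(** The exceptional points are those of [E] and their reflections, translated into the period
    containing cell [s]. *)
Lemma oddext_cell phi N v (E : seq R) s x : (0 < N)%N ->
  (forall j x, (j < N)%N -> j%:R / N%:R < x -> x < j.+1%:R / N%:R -> x \notin E -> phi x = v j) ->
  s%:R / N%:R < x -> x < s.+1%:R / N%:R ->
  x \notin [seq z + 2 * (s %/ (2 * N))%:R | z <- E] ++ [seq 2 - z + 2 * (s %/ (2 * N))%:R | z <- E] ->
  oddext phi x = vext N v s.
Proof.
move=> N0 hE x0 x1; rewrite mem_cat negb_or => /andP[xE1 xE2].
have N1 : 0 < N%:R :> R by rewrite ltr0n.
set m := (s %/ (2 * N))%N in xE1 xE2; set r := (s %% (2 * N))%N.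
have rN : (r < 2 * N)%N by rewrite ltn_pmod // muln_gt0.
have sE : s%:R = 2 * m%:R * N%:R + r%:R :> R.
  by rewrite {1}(divn_eq s (2 * N)) natrD !natrM; ring.
pose y := x - 2 * m%:R.
have y0 : r%:R / N%:R < y.
  by move: x0; rewrite sE mulrDl mulfK ?gt_eqF // /y ltrBrDl.
have y1 : y < r.+1%:R / N%:R.
  move: x1; rewrite -[s.+1%:R]natr1 sE -addrA natr1 mulrDl mulfK ?gt_eqF //.
  by rewrite /y ltrBlDl.
have y2 : y < 2.
  by apply: (lt_le_trans y1); rewrite ler_pdivrMr // -natrM ler_nat.
have y00 : 0 < y by apply: le_lt_trans y0; rewrite divr_ge0.
have -> : oddext phi x = if (0 < y) && (y < 1) then phi y
    else if (1 < y) && (y < 2) then - phi (2 - y) else 0.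
  rewrite /oddext (_ : Num.floor (x / 2) = m%:Z).
    by rewrite -pmulrn.
  have xy : x = y + 2 * m%:R by rewrite subrK.
  apply/floor_def; rewrite intrD -!pmulrn ler_pdivlMr // ltr_pdivrMr // xy.
  by move: y00 y2; clear; move: y (m%:R : R) => y z ? ?; apply/andP; split; lra.
rewrite /vext -/r; case: ltnP => rN'.
  have -> : y < 1 by apply: (lt_le_trans y1); rewrite ler_pdivrMr // mul1r ler_nat.
  rewrite y00 /=; apply: hE => //; apply: contra xE1 => yE.
  by apply/mapP; exists y; rewrite // /y subrK.
have y11 : 1 < y by apply: le_lt_trans y0; rewrite ler_pdivlMr // mul1r ler_nat.
rewrite y00 y11 y2 /= ltNge (ltW y11) /=; congr (- _); apply: hE.
- by rewrite ltn_subLR // mul2n -addnn addSn ltnS leq_add2r.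
- rewrite ltrBrDr -ltrBrDl (lt_le_trans y1) // natrB // mulrBl natrM mulfK ?gt_eqF //.
  by rewrite opprB addrC subrK.
- rewrite subnSK // natrB ?(ltnW rN) // mulrBl natrM mulfK ?gt_eqF //.
  by rewrite ltrD2l ltrN2.
apply: contra xE2 => yE; apply/mapP; exists (2 - y) => //.
by rewrite /y; ring.
Qed.

Lemma has_coef_dil phi N v k : (0 < N)%N -> (0 < k)%N -> grid phi N v ->
  has_coef (fun x => oddext phi (k%:R * x)) (dil k (fun n => fc N v n / n%:R)).
Proof.
move=> N0 k0 [E hE]; exists (N * k)%N, (vext N v); split.
- by rewrite muln_gt0 N0.
- pose E1 s := [seq z + 2 * (s %/ (2 * N))%:R | z <- E] ++ [seq 2 - z + 2 * (s %/ (2 * N))%:R | z <- E].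
  have k1 : 0 < k%:R :> R by rewrite ltr0n.
  exists (flatten [seq [seq z / k%:R | z <- E1 s] | s <- index_iota 0 (N * k)]) => j x jN x0 x1 xE.
  apply: oddext_cell hE _ _ _ => //.
  + by move: x0; rewrite natrM invfM mulrA ltr_pdivrMr // [ltRHS]mulrC.
  + by move: x1; rewrite natrM invfM mulrA ltr_pdivlMr // [ltLHS]mulrC.
  apply: contra xE => kE; apply/flattenP; exists [seq z / k%:R | z <- E1 j].
    by apply/mapP; exists j; rewrite // mem_index_iota.
  by apply/mapP; exists (k%:R * x) => //; rewrite mulrC mulKf ?gt_eqF.
move=> n n0; rewrite fc_dilate // /dil; case: ifP => kn; last by rewrite mul0r.
rewrite -[in RHS](divnK kn) natrM mulnK //; set a := (n %/ k)%:R.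
have a0 : a != 0 by rewrite pnatr_eq0 -lt0n divn_gt0 // dvdn_leq.
by field; rewrite a0 pnatr_eq0 -lt0n k0.
Qed.

End Coefficients.

(** * Completeness of dilates and cyclicity of coefficients *)

Section Bridge.
Variable R : realType.
Local Notation mu := (@lebesgue_measure R).
Implicit Types (u phi : R -> R) (b v : nat -> R).

Lemma integral_sqrD (p q : R -> R) : measurable_fun (@I01 R) p -> measurable_fun (@I01 R) q ->
  (\int[mu]_(x in @I01 R) ((p x + q x) ^+ 2)%:E <=
   2%:E * \int[mu]_(x in @I01 R) ((p x) ^+ 2)%:E + 2%:E * \int[mu]_(x in @I01 R) ((q x) ^+ 2)%:E)%E.
Proof.
move=> mp mq; have m2 (f : R -> R) : measurable_fun (@I01 R) f ->
    measurable_fun (@I01 R) (fun x => ((f x) ^+ 2)%:E).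
  by move=> mf; apply/measurable_EFinP; exact: measurable_funX.
have s0 (f : R -> R) x : @I01 R x -> (0 <= ((f x) ^+ 2)%:E)%E by move=> _; rewrite lee_fin sqr_ge0.
rewrite -!ge0_integralZl_EFin //; try exact: measurableI01; try exact: m2; try exact: s0.
have p0 (f : R -> R) x : @I01 R x -> (0 <= 2%:E * ((f x) ^+ 2)%:E)%E.
  by move=> _; rewrite mule_ge0 // lee_fin ?sqr_ge0.
have mp2 (f : R -> R) : measurable_fun (@I01 R) f -> measurable_fun (@I01 R) (fun x => 2%:E * ((f x) ^+ 2)%:E)%E.
  by move=> mf; apply: measurable_funeM; exact: m2.
rewrite -ge0_integralD //; try exact: measurableI01; try exact: mp2; try exact: p0.
apply: ge0_le_integral; first exact: measurableI01.
- exact: (s0 (fun x => p x + q x)).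
- by apply: (m2 (fun x => p x + q x)); exact: measurable_funD.
- by apply: emeasurable_funD; exact: mp2.
move=> x _; rewrite -!EFinM -EFinD lee_fin.
by have := sqr_ge0 (p x - q x); nra.
Qed.

Lemma sampled_sine_grid P : (0 < P)%N ->
  grid (fun x => sampled_sine R P (Num.truncn (x * P%:R))) P (sampled_sine R P).
Proof.
move=> P0; exists [::] => j x jP x0 x1 _; congr sampled_sine; apply: truncn_def.
by rewrite -ler_pdivrMr -?ltr_pdivlMr ?ltr0n // (ltW x0).
Qed.

(** Approximating the sampled sine by dilates of [phi] approximates its coefficients by dilates of
    those of [phi], and these coefficients are nearly a multiple of [delta1]. *)
Lemma cyclic_of_complete phi N v : (0 < N)%N -> grid phi N v -> complete_dil phi ->
  cl (fun n => fc N v n / n%:R) (@delta1 R).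
Proof.
move=> N0 gv [_ hphi] e e0; set beta := fun n => fc N v n / n%:R.
pose P := (Num.truncn (512 / e)).+2.
have P1 : (1 < P)%N by [].
have P0 : (0 < P)%N by [].
have hP : 128 / (2 * P - 1)%:R <= e / 4.
  rewrite ler_pdivrMr; last by rewrite ltr0n; lia.
  have : 512 / e <= (2 * P - 1)%:R.
    rewrite ltW // (lt_le_trans (truncnS_gt _)) // ler_nat /P.
    by move: (Num.truncn _) => z; lia.
  by rewrite ler_pdivrMr //; lra.
pose w := sampled_sine R P; pose g (x : R) := w (Num.truncn (x * P%:R)).
have gg : grid g P w := sampled_sine_grid P0.
have cg : has_coef g (fun n => fc P w n / n%:R) by exists P, w.
(* Half of [e] is left to the sampled sine. The other half pays for the factor 2 of [n2D], 16 from
   [kap^-1] squared and 16 from the norm comparison: [2 * 16 * 16 / 1024 = 1 / 2]. *)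
have e1 : 0 < e / 32 / 32 by rewrite !divr_gt0.
have [K [a ha]] := hphi g (has_coef_inL2 cg) _ e1.
have cU := has_coef_sum (index_enum 'I_K) (fun k : 'I_K => - a k) (fun k => has_coef_dil N0 (ltn0Sn k) gv).
have [I [hI hI1 _]] := has_coef_energy (has_coef_lin 1 cg cU).
have Ie : I <= e / 32 / 32.
  rewrite -lee_fin -hI ltW //; apply: le_lt_trans ha; rewrite le_eqVlt; apply/orP; left; apply/eqP.
  apply: eq_integral => x _; congr (_ ^+ 2)%:E; rewrite mul1r -sumrN; congr (_ + _).
  by apply: eq_bigr => k _; rewrite mulNr.
set kap := fc P w 1; have kap4 : 4^-1 <= kap by exact: sampled_sine_coef1.
have k0 : 0 < kap by apply: lt_le_trans kap4; rewrite invr_gt0.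
exists [seq (kap^-1 * a k, k.+1) | k <- index_iota 0 K]; split.
  by apply/allP => _ /mapP[k _ ->].
move=> M; rewrite (@eq_n2 _ _ _ (fun n => (- kap^-1) * (1 * (fc P w n / n%:R) +
     \sum_(k < K) - a k * dil k.+1 beta n) + (kap^-1 * (fc P w n / n%:R) - delta1 R n))).
  apply: (le_trans (n2D _ _ _)); rewrite n2Z.
  have h1 := sampled_sine_delta R P1 M; have h2 := hI1 M.
  have h3 : (- kap^-1) ^+ 2 <= 16.
    rewrite sqrrN; have -> : 16 = 4 ^+ 2 :> R by ring.
    have k4 : kap^-1 <= 4 by rewrite -[leRHS]invrK lef_pV2 ?posrE ?invr_gt0.
    by rewrite lerXn2r ?nnegrE ?invr_ge0 ?(ltW k0).
  have n0 := n2_ge0 M (fun n => 1 * (fc P w n / n%:R) + \sum_(k < K) - a k * dil k.+1 beta n).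
  have key (x y k2 : R) : y <= 16 * I -> x <= 128 / (2 * P - 1)%:R -> 0 <= y -> k2 <= 16 ->
      2 * (k2 * y) + 2 * x <= e.
    by move=> hy hx y0 hk; have : k2 * y <= 16 * y by [rewrite ler_wpM2r]; lra.
  exact: (key _ _ _ h2 h1 n0 h3).
move=> n _; rewrite /comb big_map big_mkord; under eq_bigr do rewrite /= -mulrA.
rewrite -mulr_sumr; have -> : \sum_(k < K) - a k * dil k.+1 beta n = - \sum_(k < K) a k * dil k.+1 beta n.
  by rewrite -sumrN; apply: eq_bigr => k _; rewrite mulNr.
by ring.
Qed.

(** The complete function [phi1] serves as a source of dense step functions: an arbitrary [g] is
    first approximated by a combination [U] of its dilates, whose coefficients the cyclic sequence
    of [phi] then reaches. *)
Lemma complete_of_cyclic phi N v phi1 N1 v1 : (0 < N)%N -> grid phi N v ->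
  (0 < N1)%N -> grid phi1 N1 v1 -> complete_dil phi1 ->
  cl (fun n => fc N v n / n%:R) (@delta1 R) -> complete_dil phi.
Proof.
move=> N0 gv N10 gv1 [_ h1] hcl; split; first by have [] := grid_inL2 N0 gv.
move=> g [mg ig] e e0; have e4 : 0 < e / 4 by rewrite divr_gt0.
have [K [a ha]] := h1 g (conj mg ig) _ e4.
have cU := has_coef_sum (index_enum 'I_K) (fun k : 'I_K => a k) (fun k => has_coef_dil N10 (ltn0Sn k) gv1).
set U := fun x : R => \sum_(k <- index_enum 'I_K) _ in cU.
set bU := fun n : nat => \sum_(k <- index_enum 'I_K) _ in cU.
have e64 : 0 < e / 64 by rewrite divr_gt0.
have [L [wL hL]] := cl_delta1 hcl (has_coef_tail0 cU) e64.
pose W x := \sum_(y <- L) y.1 * oddext phi (y.2%:R * x).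
have cW : has_coef W (comb L (fun n => fc N v n / n%:R)).
  have : forall L', wf L' -> has_coef (fun x => \sum_(y <- L') y.1 * oddext phi (y.2%:R * x))
      (comb L' (fun n => fc N v n / n%:R)).
    elim=> [_|y L' IH /= /andP[y0 wL']].
      apply: has_coef_eq (has_coef0 R) => [x _|n _]; first by rewrite big_nil.
      by rewrite /comb big_nil.
    apply: has_coef_eq (has_coef_lin y.1 (has_coef_dil N0 y0 gv) (IH wL')) => [x _|n _].
      by rewrite big_cons.
    by rewrite /comb big_cons.
  exact.
have cD := has_coef_lin (-1) cW cU.
have [I [hI _ [M hM]]] := has_coef_energy cD.
have Ie : I <= e / 8.
  apply: (le_trans hM); have := hL M.
  rewrite (@eq_n2 _ _ _ (fun n => (-1) * (-1 * comb L (fun n => fc N v n / n%:R) n + bU n))).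
    by rewrite n2Z sqrrN expr1n mul1r; lra.
  by move=> n _; ring.
(* A dilation index may occur several times in [L]; its coefficients are collected. *)
pose K' := \max_(y <- L) y.2; pose a' k := \sum_(y <- L | y.2 == k.+1) y.1.
exists K', a'.
have WE x : \sum_(k < K') a' k * oddext phi (k.+1%:R * x) = W x.
  rewrite /a' /W; under eq_bigr do rewrite mulr_suml big_mkcond.
  rewrite exchange_big /= big_seq [RHS]big_seq; apply: eq_bigr => y yL.
  have y0 : (0 < y.2)%N := allP wL y yL.
  have yK : (y.2.-1 < K')%N.
    by rewrite prednK // /K'; exact: (@leq_bigmax_seq _ _ xpredT (fun y : R * nat => y.2)).
  rewrite -big_mkcond /= (bigD1 (Ordinal yK)) /= ?prednK //.
  rewrite big1 ?addr0 // => k /andP[/eqP h /negP k1]; case: k1; apply/eqP/val_inj => /=.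
  by rewrite h.
have mU : measurable_fun (@I01 R) U by have [] := has_coef_inL2 cU.
have mW : measurable_fun (@I01 R) W by have [] := has_coef_inL2 cW.
have mgU : measurable_fun (@I01 R) (fun x => g x - U x) by exact: measurable_funB.
have mD : measurable_fun (@I01 R) (fun x => -1 * W x + U x) by have [] := has_coef_inL2 cD.
rewrite [X in (X < _)%E](_ : _ = \int[mu]_(x in @I01 R) (((g x - U x) + (-1 * W x + U x)) ^+ 2)%:E)%E; last first.
  by apply: eq_integral => x _; rewrite WE; congr (_ ^+ 2)%:E; ring.
apply: (le_lt_trans (integral_sqrD mgU mD)); rewrite hI.
have [J hJ] : exists J : R, (\int[mu]_(x in @I01 R) ((g x - U x) ^+ 2)%:E = J%:E)%E.
  have h0 : (0 <= \int[mu]_(x in @I01 R) ((g x - U x) ^+ 2)%:E)%E.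
    by apply: integral_ge0 => x _; rewrite lee_fin sqr_ge0.
  move: ha h0; rewrite -/(U _); case: (\int[mu]_(x in _) _)%E => [J _ _||] //; first by exists J.
have Je : J < e / 4 by rewrite -lte_fin -hJ.
by rewrite hJ -!EFinM -EFinD lte_fin; lra.
Qed.

End Bridge.

(** * Jumps *)

Section StepFunctions.
Variable R : realType.
Implicit Types (phi : R -> R) (v : nat -> R).

Lemma isolation (s : seq R) (z : R) :
  exists2 d : R, 0 < d & forall y, y \in s -> y != z -> d <= `|y - z|.
Proof.
elim: s => [|x s [d d0 hd]]; first by exists 1.
have [->|xz] := eqVneq x z.
  exists d => // y; rewrite inE => /predU1P[->|ys yz]; first by rewrite eqxx.
  exact: hd.
exists (Num.min d `|x - z|); first by rewrite lt_min d0 normr_gt0 subr_eq0.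
move=> y; rewrite inE => /predU1P[->|ys] yz; first by rewrite ge_min lexx orbT.
by rewrite ge_min hd.
Qed.

Lemma oddext_id phi y : 0 < y -> y < 1 -> oddext phi y = phi y.
Proof.
move=> y0 y1; rewrite /oddext (_ : Num.floor (y / 2) = 0).
  by rewrite mulr0 subr0 y0 y1.
apply/floor_def; rewrite add0r divr_ge0 ?(ltW y0) //= ltr_pdivrMr //; lra.
Qed.

Lemma jump_eq phi (z e a b : R) : 0 < e ->
  (forall y, z < y -> y < z + e -> oddext phi y = a) ->
  (forall y, z - e < y -> y < z -> oddext phi y = b) -> jump phi z = a - b.
Proof.
move=> e0 hr hl; rewrite /jump; congr (_ - _); apply: cvg_lim => //; apply: cvg_near_cst.
  near=> y; apply: hr; near: y; first exact: nbhs_right_gt.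
  by apply: nbhs_right_lt; rewrite ltrDl.
near=> y; apply: hl; near: y; last exact: nbhs_left_lt.
by apply: nbhs_left_gt; rewrite gtrBl.
Unshelve. all: by end_near.
Qed.

Lemma count_lt (T : eqType) (P Q : pred T) (s : seq T) z : z \in s -> Q z -> ~~ P z ->
  subpred P Q -> (count P s < count Q s)%N.
Proof.
move=> + Qz Pz PQ; elim: s => //= x s IH; rewrite inE => /predU1P[<-|zs].
  by rewrite Qz (negbTE Pz) add0n add1n ltnS sub_count.
rewrite -addnS leq_add ?IH //; case Px : (P x) => //.
by rewrite PQ.
Qed.

Lemma step_const phi (s : seq R) :
  (forall x y : R, 0 < x -> y < 1 -> x <= y ->
    (forall z, z \in s -> ~ (x <= z /\ z <= y)) -> phi x = phi y) ->
  forall x y, 0 < x -> y < 1 -> x <= y -> x \notin s -> y \notin s ->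
  (forall z, x < z < y -> jump phi z = 0) -> phi x = phi y.
Proof.
move=> hs x y; have [k] := ubnP (count (fun z => x < z < y) s).
elim: k x y => // k IH x y hk x0 y1 xy xs ys hj.
have [/hasP[z zs /andP[xz zy]]|/hasPn hn] := boolP (has (fun z => x < z < y) s); last first.
  apply: hs => // z zs [xz zy]; have /negP := hn z zs; apply; rewrite !lt_neqAle xz zy !andbT.
  by apply/andP; split; [apply: contraNneq xs => -> | apply: contraNneq ys => <-].
have [d d0 hd] := isolation s z.
pose eta := Num.min d (Num.min (z - x) (y - z)) / 2.
have m0 : 0 < Num.min d (Num.min (z - x) (y - z)) by rewrite !lt_min d0 !subr_gt0 xz zy.
have eta0 : 0 < eta by rewrite divr_gt0.
have etad : eta < d.
  have : Num.min d (Num.min (z - x) (y - z)) <= d by rewrite ge_min lexx.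
  by rewrite /eta; lra.
have etax : x < z - eta.
  have : Num.min d (Num.min (z - x) (y - z)) <= z - x by rewrite !ge_min lexx orbT.
  by rewrite /eta; lra.
have etay : z + eta < y.
  have : Num.min d (Num.min (z - x) (y - z)) <= y - z by rewrite !ge_min lexx !orbT.
  by rewrite /eta; lra.
have out w : w != z -> `|w - z| < d -> w \notin s.
  by move=> wz wd; apply/negP => ws; have := hd w ws wz; rewrite leNgt wd.
have x's : z - eta \notin s.
  apply: out; first by rewrite lt_eqF // gtrBl.
  by rewrite addrAC subrr sub0r normrN gtr0_norm.
have y's : z + eta \notin s.
  apply: out; first by rewrite gt_eqF // ltrDl.
  by rewrite addrAC subrr add0r gtr0_norm.
have zin : x < z < y by rewrite xz zy.
have cnt (P : pred R) : (forall w, P w -> (x < w < y) && (w != z)) -> (count P s < k)%N.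
  move=> hP; rewrite ltnS in hk; apply: leq_trans hk; apply: (count_lt zs) => //.
    by apply/negP => /hP; rewrite eqxx andbF.
  by move=> w /hP /andP[].
have e1 : phi x = phi (z - eta).
  apply: IH => //.
  - by apply: cnt => w /andP[h1 h2]; rewrite h1 (lt_trans h2) ?lt_eqF //; lra.
  - by lra.
  - exact: ltW.
  - by move=> w /andP[h1 h2]; apply: hj; rewrite h1 (lt_trans h2) //; lra.
have e2 : phi (z + eta) = phi y.
  apply: IH => //.
  - by apply: cnt => w /andP[h1 h2]; rewrite h2 (lt_trans _ h1) ?gt_eqF //; lra.
  - by lra.
  - exact: ltW.
  - by move=> w /andP[h1 h2]; apply: hj; rewrite h2 (lt_trans _ h1) //; lra.
have jz := hj z zin.
have hr w : z < w -> w < z + eta -> oddext phi w = phi (z + eta).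
  move=> w1 w2; rewrite oddext_id; [|lra|lra]; apply: hs; [lra|lra|exact: ltW|].
  move=> a ais [wa ae]; have := hd a ais; rewrite gt_eqF ?(lt_le_trans w1) // => /(_ isT).
  by rewrite leNgt ger0_norm ?subr_ge0; [|lra]; move/negP; apply; lra.
have hl w : z - eta < w -> w < z -> oddext phi w = phi (z - eta).
  move=> w1 w2; rewrite oddext_id; [|lra|lra]; symmetry; apply: hs; [lra|lra|exact: ltW|].
  move=> a ais [wa ae]; have := hd a ais; rewrite lt_eqF ?(le_lt_trans ae) // => /(_ isT).
  by rewrite leNgt ler0_norm ?subr_le0; [|lra]; move/negP; apply; lra.
move: jz; rewrite (jump_eq eta0 hr hl) => /eqP; rewrite subr_eq0 => /eqP e3.
by rewrite e1 -e3 e2.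
Qed.

Lemma step_grid phi t : (0 < t)%N -> is_step phi ->
  (forall x : R, 0 < x < 1 -> jump phi x != 0 -> exists s : int, x = s%:~R / t%:R) ->
  exists v, grid phi t v.
Proof.
move=> t0 [s hs] hj; have t1 : 0 < t%:R :> R by rewrite ltr0n.
pose cell j (x : R) := [/\ j%:R / t%:R < x, x < j.+1%:R / t%:R & x \notin s].
have : forall j, exists a, forall x, (j < t)%N -> cell j x -> phi x = a.
  move=> j; have [[x0 hx0]|no] := pselect (exists x, cell j x); last first.
    by exists 0 => x _ hx; case: no; exists x.
  exists (phi x0) => x jt hx.
  have main y z : cell j y -> cell j z -> y <= z -> phi y = phi z.
    move=> [y0 y1 ys] [z0 z1 zs] yz; apply: (step_const hs) => //.
    - by apply: le_lt_trans y0; rewrite divr_ge0.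
    - by apply: (lt_le_trans z1); rewrite ler_pdivrMr // mul1r ler_nat.
    move=> w /andP[yw wz]; apply: contrapT => /eqP jw.
    have w0 := lt_trans y0 yw; have w1 := lt_trans wz z1.
    have [|i wi] := hj w _ jw.
      rewrite (le_lt_trans _ w0) ?divr_ge0 //= (lt_le_trans w1) // ler_pdivrMr // mul1r ler_nat //.
    move: w0 w1; rewrite wi !ltr_pM2r ?invr_gt0 // !pmulrn !ltr_int.
    by rewrite -[j.+1]addn1 PoszD ltzD1 leNgt => ->.
  have [xx|/ltW xx] := leP x x0; first exact: main.
  by symmetry; apply: main.
move=> /choice[v hv]; exists v, s => j x jt x0 x1 xs; exact: hv.
Qed.

Lemma grid_jump phi t v s : (0 < t)%N -> grid phi t v -> (0 < s)%N ->
  jump phi (s%:R / t%:R) = vext t v s - vext t v s.-1.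
Proof.
move=> t0 [E hE] s0; have t1 : 0 < t%:R :> R by rewrite ltr0n.
pose ex k := [seq z + 2 * (k %/ (2 * t))%:R | z <- E] ++ [seq 2 - z + 2 * (k %/ (2 * t))%:R | z <- E].
have [d1 d10 hd1] := isolation (ex s ++ ex s.-1) (s%:R / t%:R).
pose d := Num.min d1 t%:R^-1.
have d0 : 0 < d by rewrite lt_min d10 invr_gt0.
have dd1 : d <= d1 by rewrite ge_min lexx.
have dt : d <= t%:R^-1 by rewrite ge_min lexx orbT.
set z := s%:R / t%:R in hd1 *.
have out w : w != z -> `|w - z| < d -> w \notin ex s ++ ex s.-1.
  by move=> wz wd; apply/negP => ws; have := hd1 w ws wz; rewrite leNgt (lt_le_trans wd).
have z1 : s.+1%:R / t%:R = z + t%:R^-1 by rewrite -[s.+1%:R]natr1 mulrDl mul1r.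
have z2 : s.-1%:R / t%:R = z - t%:R^-1.
  by rewrite /z -[in RHS](prednK s0) -[s.-1.+1%:R]natr1 mulrDl mul1r addrK.
apply: (jump_eq d0) => y y0 y1.
  have : y \notin ex s ++ ex s.-1.
    by apply: out; [rewrite gt_eqF | rewrite gtr0_norm ?subr_gt0 // ltrBlDl].
  rewrite mem_cat negb_or => /andP[ye _]; apply: (oddext_cell t0 hE) ye => //.
  by rewrite z1 (lt_le_trans y1) // lerD2l.
have : y \notin ex s ++ ex s.-1.
  by apply: out; [rewrite lt_eqF | rewrite ltr0_norm ?subr_lt0 // opprB ltrBlDr -ltrBlDl].
rewrite mem_cat negb_or => /andP[_ ye]; apply: (oddext_cell t0 hE) ye => //.
  by rewrite z2 (le_lt_trans _ y0) // lerD2l lerN2.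
by rewrite prednK.
Qed.

Lemma grid_sum (I : Type) (r : seq I) (c : I -> R) (u : I -> R -> R) N (w : I -> nat -> R) :
  (forall i, grid (u i) N (w i)) ->
  grid (fun x => \sum_(i <- r) c i * u i x) N (fun j => \sum_(i <- r) c i * w i j).
Proof.
move=> h; elim: r => [|i r IH].
  by exists [::] => j x _ _ _ _; rewrite !big_nil.
have [E hE] := grid_lin (c i) (h i) IH; exists E => j x jN x0 x1 xE.
by rewrite !big_cons; exact: hE.
Qed.

Lemma fc_sum (I : finType) (c : I -> R) N (w : I -> nat -> R) n :
  fc N (fun j => \sum_i c i * w i j) n = \sum_i c i * fc N (w i) n.
Proof.
rewrite /fc; under eq_bigr do rewrite mulr_suml.
rewrite exchange_big /=; apply: eq_bigr => i _; rewrite mulr_sumr.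
by apply: eq_bigr => j _; rewrite mulrA.
Qed.

Lemma fc_per N v m n : (0 < N)%N -> m = n %[mod 2 * N] -> fc N v m = fc N v n.
Proof.
move=> N0 mn; apply: eq_bigr => j _; congr (_ * (_ - _)); apply: cN_mod => //;
by rewrite -modnMml mn modnMml.
Qed.

(** Adding [(2 * N).-1] subtracts 1 modulo the period, so that [s = 0] is included. *)
Definition jmp N v s : R := vext N v s - vext N v (s + (2 * N).-1).

Lemma jmp_per N v s m : s = m %[mod 2 * N] -> jmp N v s = jmp N v m.
Proof.
move=> sm; rewrite /jmp (vext_per v sm); congr (_ - _); apply: vext_per.
by rewrite -modnDml sm modnDml.
Qed.

Lemma jmp_pred N v s : (0 < N)%N -> (0 < s)%N -> jmp N v s = vext N v s - vext N v s.-1.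
Proof.
move=> N0 s0; congr (_ - _); apply: vext_per.
have -> : (s + (2 * N).-1 = s.-1 + 2 * N)%N by lia.
by rewrite modnDr.
Qed.

Lemma jmp_even N v a b : (0 < N)%N -> (2 * N %| a + b)%N -> jmp N v a = jmp N v b.
Proof.
move=> N0 /eqP ab; rewrite /jmp.
have NN : (0 < 2 * N)%N by rewrite muln_gt0.
rewrite (@vext_odd _ N v a (b + (2 * N).-1)) // ?(@vext_odd _ N v (a + (2 * N).-1) b) //.
- by rewrite opprK addrC.
- by rewrite (_ : a + (2 * N).-1 + b.+1 = a + b + 2 * N)%N ?modnDr ?ab ?mod0n //; lia.
- by rewrite (_ : a + (b + (2 * N).-1).+1 = a + b + 2 * N)%N ?modnDr ?ab ?mod0n //; lia.
Qed.

(** Summation by parts over a full period. *)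
Lemma fc_jmp N v n : (0 < N)%N ->
  fc N v n = 2^-1 * \sum_(0 <= s < 2 * N) jmp N v s * cN R N (n * s).
Proof.
move=> N0; rewrite fc_ext //; congr (_ * _).
pose G s := vext N v (s + (2 * N).-1) * cN R N (n * s).
have GS : \sum_(0 <= s < 2 * N) G s.+1 = \sum_(0 <= s < 2 * N) G s.
  have NN : (0 < 2 * N)%N by rewrite muln_gt0.
  rewrite -(prednK NN) big_nat_recr // [RHS]big_nat_recl //= addrC; congr (_ + _).
  rewrite prednK // /G; congr (_ * _); last by apply: cN_mod => //; rewrite muln0 mod0n modnMl.
  by apply: vext_per; rewrite modnDl.
transitivity (\sum_(0 <= s < 2 * N) vext N v s * cN R N (n * s) - \sum_(0 <= s < 2 * N) G s.+1).
  rewrite -sumrB; apply: eq_bigr => s _; rewrite mulrBr; congr (_ - _ * _).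
  by apply: vext_per; rewrite addSnnS prednK ?muln_gt0 // modnDr.
by rewrite GS -sumrB; apply: eq_bigr => s _; rewrite -mulrBl.
Qed.

(* Depends only on the jumps at the points [2 m / N]. *)
Definition half_sum N v n : R := 2^-1 * \sum_(0 <= m < N) jmp N v (2 * m) * cN R N (n * (2 * m)).

(** Shifting [n] by [N] multiplies the cosine at [s] by [(-1) ^ s], so the sum keeps only the jumps
    at even [s]. *)
Lemma fc_half N v n : (0 < N)%N -> fc N v n + fc N v (n + N) = 2 * half_sum N v n.
Proof.
move=> N0; rewrite !fc_jmp // -mulrDr -big_split /= /half_sum mulVKf //.
have alt s : cN R N ((n + N) * s) = (-1) ^+ odd s * cN R N (n * s).
  have per (x : R) : cos (x + pi *+ s) = (-1) ^+ odd s * cos x.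
    elim: s => [|s IH]; first by rewrite mulr0n addr0 mul1r.
    rewrite mulrS addrCA addrC cosDpi IH /=; case: (odd s); rewrite ?expr0 ?expr1; ring.
  rewrite -per /cN; congr (cos _); rewrite natrM natrD natrM -[pi *+ s]mulr_natl.
  by field; rewrite natr_neq0.
transitivity (2^-1 * \sum_(0 <= s < N * 2) (if odd s then 0 else 2 * (jmp N v s * cN R N (n * s)))).
  congr (_ * _); rewrite [(N * 2)%N]mulnC; apply: eq_bigr => s _; rewrite alt.
  by case: (odd s); rewrite ?expr0 ?expr1; ring.
rewrite sum_blocks mulr_sumr; apply: eq_bigr => m _.
rewrite big_nat_recr //= big_nat1 addn0 addn1 /= oddM andbF /= addr0 mulKf //.
by rewrite [(m * 2)%N]mulnC.
Qed.

Lemma sum_cN_even N k : (0 < N)%N ->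
  \sum_(0 <= n < N) cN R N (n * (2 * k)) = if (N %| k)%N then N%:R else 0.
Proof.
move=> N0; have -> : \sum_(0 <= n < N) cN R N (n * (2 * k)) = complex.Re (\sum_(0 <= n < N) rou R N ^+ (k * n)).
  rewrite Re_sum; apply: eq_bigr => n _; rewrite /rou expiX /expi /cN; congr (cos _).
  by rewrite !natrM; field; rewrite natr_neq0.
by rewrite sum_rou //; case: ifP => // _; rewrite -(rmorph_nat (real_complex R)).
Qed.

(** Inversion of the cosine transform. It cannot separate [m1] from its reflection [N - m1], but
    [jmp_even] makes the two jumps equal, so their contributions add up instead of cancelling. *)
Lemma half_sum_eq0 N v : (0 < N)%N -> (forall n, half_sum N v n = 0) -> forall m, jmp N v (2 * m) = 0.
Proof.
move=> N0 h m0; have NN : (0 < 2 * N)%N by rewrite muln_gt0.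
pose m1 := (m0 %% N)%N; have m1N : (m1 < N)%N by rewrite ltn_pmod.
have -> : jmp N v (2 * m0) = jmp N v (2 * m1).
  by apply: jmp_per; rewrite -!muln_modr modn_mod.
have cc m n : cN R N (n * (2 * m1)) * cN R N (n * (2 * m)) =
    2^-1 * (cN R N (n * (2 * (m + m1))) + cN R N (n * (2 * (m + (N - m1))))).
  have e1 : cN R N (n * (2 * (m + m1))) =
      cos ((n * (2 * m))%:R * (pi / N%:R) + (n * (2 * m1))%:R * (pi / N%:R)).
    by rewrite /cN; congr (cos _); rewrite !(natrM, natrD); ring.
  have e2 : cN R N (n * (2 * (m + (N - m1)))) =
      cos ((n * (2 * m))%:R * (pi / N%:R) - (n * (2 * m1))%:R * (pi / N%:R)).
    rewrite -[RHS](periodicn (@cosD2pi R) n) /cN; congr (cos _).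
    rewrite !(natrM, natrD) natrB ?(ltnW m1N) // -mulrnA -[pi *+ _]mulr_natl natrM.
    by field; rewrite natr_neq0.
  by rewrite e1 e2 cosD cosB /cN; field.
have : \sum_(0 <= n < N) cN R N (n * (2 * m1)) * (2 * half_sum N v n) = 0.
  by rewrite big1 // => n _; rewrite h !mulr0.
have -> : \sum_(0 <= n < N) cN R N (n * (2 * m1)) * (2 * half_sum N v n) =
  \sum_(0 <= m < N) jmp N v (2 * m) * (2^-1 * ((if (N %| m + m1)%N then N%:R else 0) +
     (if (N %| m + (N - m1))%N then N%:R else 0))).
  rewrite /half_sum; under eq_bigr do rewrite mulVKf // mulr_sumr.
  rewrite exchange_big /=; apply: eq_bigr => m _.
  under eq_bigr do rewrite mulrCA cc.
  by rewrite -mulr_sumr -mulr_sumr big_split /= !sum_cN_even.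
have -> : \sum_(0 <= m < N) jmp N v (2 * m) * (2^-1 * ((if (N %| m + m1)%N then N%:R else 0) +
     (if (N %| m + (N - m1))%N then N%:R else 0))) =
  jmp N v (2 * m1) * (2^-1 * \sum_(0 <= m < N) ((if (N %| m + m1)%N then N%:R else 0) +
     (if (N %| m + (N - m1))%N then N%:R else 0))).
  rewrite !mulr_sumr; apply: eq_big_nat => m /andP[_ mN].
  case: ifP => [d1|_].
    by rewrite (@jmp_even N v (2 * m) (2 * m1)) // -mulnDr dvdn_pmul2l.
  case: ifP => [d2|_]; last by rewrite addr0 !mulr0.
  rewrite (_ : m = m1) //; move: d2 => /dvdnP[[|[|k]] E]; [lia|lia|].
  by have : (2 * N <= k.+2 * N)%N; [rewrite leq_mul2r orbT | lia].
move/eqP; rewrite mulf_eq0 => /orP[/eqP //|]; rewrite mulf_eq0 invr_eq0 pnatr_eq0 /=.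
rewrite (bigD1_seq m1) ?mem_index_iota ?iota_uniq //= subnKC ?(ltnW m1N) // dvdnn.
have : 0 < N%:R :> R by rewrite ltr0n.
move=> N1 /eqP E; exfalso; move: E; apply/eqP; rewrite gt_eqF // ltr_wpDr //.
  by apply: sumr_ge0 => m _; rewrite addr_ge0 //; case: ifP.
by rewrite ltr_wpDl //; case: ifP.
Qed.

End StepFunctions.

Theorem theorem1p10 (R : realType) (n : nat) (phi : 'I_n -> R -> R) (t : nat) :
  (2 <= n)%N ->
  (forall i, Sr (phi i) /\ complete_dil (phi i)) ->
  odd t -> (0 < t)%N ->
  (forall i (x : R), 0 < x < 1 -> jump (phi i) x != 0 ->
     exists s : int, x = s%:~R / t%:R) ->
  (forall i j (m : nat), (1 <= m)%N ->
     jump (phi i) (2 * m%:R / t%:R) = jump (phi j) (2 * m%:R / t%:R)) ->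
  (exists i (m : nat), (1 <= m)%N /\ jump (phi i) (2 * m%:R / t%:R) != 0) ->
  forall c : 'I_n -> R, (forall i, 0 < c i) ->
    complete_dil (fun x => \sum_(i < n) c i * phi i x).
Proof.
move=> n2 hphi todd t0 hjump hcommon [i0 [m0 [m01 hm0]]] c c0.
have /choice[v hv] : forall i, exists v, grid (phi i) t v.
  by move=> i; apply: step_grid => //; [have [[]] := hphi i | exact: hjump].
have tt : (0 < 2 * t)%N by rewrite muln_gt0.
have jumpE i m : (1 <= m)%N -> jmp t (v i) (2 * m) = jump (phi i) (2 * m%:R / t%:R).
  move=> m1; have m2 : (0 < 2 * m)%N by rewrite muln_gt0.
  by rewrite jmp_pred // -natrM (grid_jump t0 (hv i) m2).
(* The hypothesis speaks of [m >= 1]; adding the period [t] to [m] covers [m = 0] too. *)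
have jmpE i m : jmp t (v i) (2 * m) = jmp t (v i0) (2 * m).
  have e k : jmp t (v k) (2 * m) = jmp t (v k) (2 * (m + t)).
    by apply: jmp_per; rewrite mulnDr modnDr.
  by rewrite !e !jumpE ?addn_gt0 ?t0 ?orbT //; apply: hcommon; rewrite addn_gt0 t0 orbT.
have halfE i k : half_sum t (v i) k = half_sum t (v i0) k.
  by rewrite /half_sum; congr (_ * _); apply: eq_bigr => m _; rewrite jmpE.
pose Phi := (fun x : R => \sum_(i < n) c i * phi i x).
have gPhi : grid Phi t (fun j => \sum_i c i * v i j) by exact: grid_sum.
have [_ phi0] := hphi i0.
(* The given function [phi i0] is the complete function through which arbitrary elements of L2 are
   approximated. *)
apply: (complete_of_cyclic t0 gPhi t0 (hv i0) phi0).
have -> : (fun k => fc t (fun j => \sum_i c i * v i j) k / k%:R) =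
    (fun k => (\sum_i c i * fc t (v i) k) / k%:R).
  by apply: funext => k; rewrite fc_sum.
apply: (cyclic_positive_combination i0 todd _ _ _ _ c0 (H := half_sum t (v i0))).
- by move=> i k l; exact: fc_per.
- by move=> i; have [_ h] := hphi i; exact: cyclic_of_complete (hv i) h.
- by move=> i k; rewrite fc_half // halfE.
apply: contrapT => h; move: hm0; rewrite -jumpE // half_sum_eq0 ?eqxx // => k.
by apply: contrapT => /eqP hk; apply: h; exists k.
Qed.
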